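(* Let $\kappa$ be a cardinal and $\theta\ge\kappa$. Suppose $V[G]$ is a forcing extension of $V$ by forcing which admits a gap below $\kappa$, and suppose $\kappa$ is measurable in $V[G][g]$ whenever $g$ is $V[G]$-generic for $\mathrm{coll}(\kappa,\theta)$ (i.e. $\kappa$ is measurable in $V[G]^{\mathrm{coll}(\kappa,\theta)}$). Then $\kappa$ is $\theta$-supercompact in $V$.
   Context: A forcing notion admits a gap below $\kappa$ if it factors as $\mathbb{P}_1*\dot{\mathbb{P}}_2$ where for some $\delta<\kappa$, $|\mathbb{P}_1|<\delta$ and $\mathbb{P}_1$ forces that $\dot{\mathbb{P}}_2$ is ${\le}\delta$-strategically closed (in the game of length $\delta+1$ in which the players alternately choose a descending sequence, the second player playing at limit stages, the second player has a strategy ensuring the play can always be continued). $\mathrm{coll}(\kappa,\theta)$ is the standard poset collapsing $\theta$ to $\kappa$, whose conditions are partial functions from $\kappa$ to $\theta$ of size less than $\kappa$, ordered by extension.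
   Formalization: The first factor P_1 of the gap is required to be nontrivial (every condition has incompatible extensions), since with trivial P_1 every forcing admits a gap and the claim fails; V is taken to be a countable model of ZFC so that generic extensions exist. *)

(* Defs.v *)
(* The set-theoretic universe is an arbitrary countable structure (V, mem)
   satisfying first-order ZFC; it need not be well founded.  A forcing
   extension is an actual structure containing a generic filter, and "forces"
   means "holds in every generic extension", as is usual over a countable
   ground model.  The notions below that take a [structure] quantify over its
   elements only, so each is the first-order notion relativized to it. *)

Record structure : Type := Structure {
  carrier :> Type;
  mem : carrier -> carrier -> Prop
}.
Arguments mem {s} _ _.

Notation "x ∈ y" := (mem x y) (at level 70, no associativity).
Notation "x ∉ y" := (~ mem x y) (at level 70, no associativity).

Definition countable (M : structure) : Prop :=
  exists e : nat -> M, forall x : M, exists n : nat, e n = x.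

Definition sub {M : structure} (x y : M) : Prop := forall z, z ∈ x -> z ∈ y.

Definition nonempty {M : structure} (x : M) : Prop := exists z, z ∈ x.

Definition is_upair {M : structure} (z x y : M) : Prop :=
  forall w, w ∈ z <-> w = x \/ w = y.

Definition is_opair {M : structure} (z x y : M) : Prop :=
  exists a b, is_upair a x x /\ is_upair b x y /\ is_upair z a b.

(* The ordered pair (x, y) belongs to r. *)
Definition rel {M : structure} (r x y : M) : Prop :=
  exists z, is_opair z x y /\ z ∈ r.

Definition is_succ {M : structure} (y x : M) : Prop :=
  forall w, w ∈ y <-> w ∈ x \/ w = x.

(* Formulas of set theory, with de Bruijn indices. *)

Inductive formula : Type :=
| FMem (m n : nat)
| FEq (m n : nat)
| FNot (f : formula)
| FAnd (f g : formula)
| FAll (f : formula).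

Definition scons {T : Type} (x : T) (e : nat -> T) (n : nat) : T :=
  match n with O => x | S m => e m end.

Fixpoint sat {M : structure} (e : nat -> M) (f : formula) : Prop :=
  match f with
  | FMem m n => e m ∈ e n
  | FEq m n => e m = e n
  | FNot g => ~ sat e g
  | FAnd g h => sat e g /\ sat e h
  | FAll g => forall x : M, sat (scons x e) g
  end.

Record ZFC (M : structure) : Prop := {
  zfc_extensionality :
    forall x y : M, (forall z, z ∈ x <-> z ∈ y) -> x = y;
  zfc_foundation :
    forall x : M, nonempty x -> exists y, y ∈ x /\ forall z, z ∈ x -> z ∉ y;
  zfc_pairing :
    forall x y : M, exists z, is_upair z x y;
  zfc_union :
    forall x : M, exists u, forall z, z ∈ u <-> exists y, y ∈ x /\ z ∈ y;
  zfc_powerset :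
    forall x : M, exists p, forall z, z ∈ p <-> sub z x;
  zfc_infinity :
    exists w : M, (exists o, o ∈ w /\ ~ nonempty o) /\
      forall x, x ∈ w -> exists y, y ∈ w /\ is_succ y x;
  zfc_separation :
    forall (f : formula) (e : nat -> M) (a : M),
      exists b, forall x, x ∈ b <-> x ∈ a /\ sat (scons x e) f;
  zfc_replacement :
    forall (f : formula) (e : nat -> M) (a : M),
      (forall x y y', x ∈ a -> sat (scons x (scons y e)) f ->
         sat (scons x (scons y' e)) f -> y = y') ->
      exists b, forall y,
        y ∈ b <-> exists x, x ∈ a /\ sat (scons x (scons y e)) f;
  zfc_choice :
    forall a : M,
      (forall x, x ∈ a -> nonempty x) ->
      (forall x y z, x ∈ a -> y ∈ a -> z ∈ x -> z ∈ y -> x = y) ->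
      exists c, forall x, x ∈ a -> exists! z, z ∈ x /\ z ∈ c
}.

Definition functional {M : structure} (f : M) : Prop :=
  forall x y y', rel f x y -> rel f x y' -> y = y'.

Definition rel_on {M : structure} (f a b : M) : Prop :=
  forall z, z ∈ f -> exists x y, is_opair z x y /\ x ∈ a /\ y ∈ b.

Definition is_fun {M : structure} (f a b : M) : Prop :=
  rel_on f a b /\ functional f /\ forall x, x ∈ a -> exists y, rel f x y.

Definition injects {M : structure} (a b : M) : Prop :=
  exists f, is_fun f a b /\
    forall x x' y, rel f x y -> rel f x' y -> x = x'.

Definition transitive {M : structure} (a : M) : Prop :=
  forall x, x ∈ a -> sub x a.

Definition is_ord {M : structure} (a : M) : Prop :=
  transitive a /\ forall x, x ∈ a -> transitive x.

Definition is_limit {M : structure} (a : M) : Prop :=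
  is_ord a /\ nonempty a /\ forall x, x ∈ a -> exists y, y ∈ a /\ x ∈ y.

Definition is_omega {M : structure} (w : M) : Prop :=
  is_limit w /\ forall x, x ∈ w -> ~ is_limit x.

Definition is_card {M : structure} (k : M) : Prop :=
  is_ord k /\ forall a, a ∈ k -> ~ injects k a.

(* |a| < k, for an ordinal k *)
Definition card_lt {M : structure} (a k : M) : Prop :=
  exists b, b ∈ k /\ injects a b.

Definition uncountable_card {M : structure} (k : M) : Prop :=
  is_card k /\ exists w, is_omega w /\ w ∈ k.

Definition complete_ultrafilter {M : structure} (k x u : M) : Prop :=
  (forall a, a ∈ u -> sub a x) /\
  x ∈ u /\
  (forall a b, a ∈ u -> sub a b -> sub b x -> b ∈ u) /\
  (forall a b, sub a x -> (forall z, z ∈ b <-> z ∈ x /\ z ∉ a) ->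
     (a ∈ u <-> b ∉ u)) /\
  (forall f b, sub f u -> nonempty f -> card_lt f k ->
     (forall z, z ∈ b <-> forall a, a ∈ f -> z ∈ a) -> b ∈ u).

Definition nonprincipal {M : structure} (u : M) : Prop :=
  forall x s, is_upair s x x -> s ∉ u.

Definition measurable {M : structure} (k : M) : Prop :=
  uncountable_card k /\
  exists u, complete_ultrafilter k k u /\ nonprincipal u.

(* x is the set of all subsets of t of size less than k *)
Definition is_Pkt {M : structure} (x k t : M) : Prop :=
  forall a, a ∈ x <-> sub a t /\ card_lt a k.

Definition fine_on {M : structure} (x t u : M) : Prop :=
  forall a b, a ∈ t -> (forall s, s ∈ b <-> s ∈ x /\ a ∈ s) -> b ∈ u.

(* A function regressive on a set in u is constant on a set in u. *)
Definition normal {M : structure} (u : M) : Prop :=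
  forall f a, functional f -> a ∈ u ->
    (forall s, s ∈ a -> exists y, rel f s y /\ y ∈ s) ->
    exists y b, b ∈ u /\ forall s, s ∈ b -> rel f s y.

(* k is t-supercompact: there is a normal fine k-complete ultrafilter on the
   set of subsets of t of size less than k. *)
Definition supercompact {M : structure} (k t : M) : Prop :=
  uncountable_card k /\
  exists x u, is_Pkt x k t /\ complete_ultrafilter k x u /\
    fine_on x t u /\ normal u.

(* In an order l, [rel l a b] means that a is stronger than b. *)

Definition is_poset {M : structure} (p l : M) : Prop :=
  nonempty p /\ rel_on l p p /\
  (forall a, a ∈ p -> rel l a a) /\
  (forall a b c, rel l a b -> rel l b c -> rel l a c).

Definition compatible {M : structure} (p l a b : M) : Prop :=
  exists c, c ∈ p /\ rel l c a /\ rel l c b.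

(* Equivalently: no generic filter for (p, l) lies in the ground model. *)
Definition nontrivial {M : structure} (p l : M) : Prop :=
  forall a, a ∈ p -> exists b c,
    rel l b a /\ rel l c a /\ ~ compatible p l b c.

Definition is_dense {M : structure} (p l d : M) : Prop :=
  sub d p /\ forall a, a ∈ p -> exists b, b ∈ d /\ rel l b a.

Definition dense_embedding {M : structure} (e p l p' l' : M) : Prop :=
  is_fun e p p' /\
  (forall a b a' b', rel e a a' -> rel e b b' -> rel l a b -> rel l' a' b') /\
  (forall a b a' b', rel e a a' -> rel e b b' ->
     compatible p' l' a' b' -> compatible p l a b) /\
  (forall a', a' ∈ p' -> exists b b', rel e b b' /\ rel l' b' a').

Definition forcing_equivalent {M : structure} (p l q m : M) : Prop :=
  exists r n, is_poset r n /\
    (exists e, dense_embedding e p l r n) /\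
    (exists e, dense_embedding e q m r n).

(* c, ordered by l, is the poset coll(k, t). *)
Definition is_coll {M : structure} (k t c l : M) : Prop :=
  (forall f, f ∈ c <-> rel_on f k t /\ functional f /\ card_lt f k) /\
  (forall z, z ∈ l <->
     exists f g, is_opair z f g /\ f ∈ c /\ g ∈ c /\ sub g f).

(* s is the set of stages up to d at which the second player moves: the nonzero
   limits, and the successors of stages at which the first player moves.  The
   first player moves at stage 0. *)
Definition second_player_stages {M : structure} (s d : M) : Prop :=
  forall b, b ∈ s <->
    (b ∈ d \/ b = d) /\
    (is_limit b \/ exists c, is_succ b c /\ c ∉ s).

Definition is_restriction {M : structure} (t f a : M) : Prop :=
  forall z, z ∈ t <-> z ∈ f /\ exists x y, is_opair z x y /\ x ∈ a.

(* f is a partial play of length a in which the second player, moving at the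
   stages in s, has followed the strategy h. *)
Definition play_following {M : structure} (p l s h f a : M) : Prop :=
  is_fun f a p /\
  (forall b c x y, b ∈ c -> rel f b x -> rel f c y -> rel l y x) /\
  (forall b, b ∈ a -> b ∈ s ->
     exists t x, is_restriction t f b /\ rel h t x /\ rel f b x).

(* The second player has a strategy h in the game with stages 0, ..., d that
   always supplies a legal move; the first player, moving only at stage 0 and at
   successor stages, can always move. *)
Definition strategically_closed {M : structure} (p l d : M) : Prop :=
  exists s h, second_player_stages s d /\ functional h /\
    forall a f, a ∈ s -> play_following p l s h f a ->
      exists x, rel h f x /\ x ∈ p /\ forall b y, rel f b y -> rel l x y.

(* y is the value of the name t by the filter g.  Every set is a name: its
   elements that are not pairs (name, condition in g) are ignored.  The witness
   f is a piece of the recursively defined evaluation function. *)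
Definition is_val {M : structure} (g t y : M) : Prop :=
  exists f, functional f /\ rel f t y /\
    forall x v, rel f x v ->
      (forall n a, a ∈ g -> rel x n a -> exists z, rel f n z) /\
      (forall z, z ∈ v <-> exists n a, a ∈ g /\ rel x n a /\ rel f n z).

(* N = V[G] is the extension of V by the V-generic filter G for (p, l), with i
   the inclusion of V into N. *)
Record generic_extension (V : structure) (p l : V)
    (N : structure) (i : V -> N) (G : N) : Prop := {
  gen_zfc : ZFC N;
  gen_inj : forall x y, i x = i y -> x = y;
  gen_mem : forall x y, i x ∈ i y <-> x ∈ y;
  gen_transitive : forall x y, y ∈ i x -> exists x', y = i x';
  gen_sub : sub G (i p);
  gen_nonempty : nonempty G;
  gen_upward : forall a b, i a ∈ G -> rel l a b -> i b ∈ G;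
  gen_directed : forall a b, i a ∈ G -> i b ∈ G ->
    exists c, i c ∈ G /\ rel l c a /\ rel l c b;
  gen_generic : forall d, is_dense p l d -> exists a, a ∈ d /\ i a ∈ G;
  gen_names : forall y, exists t : V, is_val G (i t) y
}.

(* The condition a forces [phi], where [phi N i G] is to be evaluated in the
   extension N by G, with inclusion i. *)
Definition forces {V : structure} (p l a : V)
    (phi : forall N : structure, (V -> N) -> N -> Prop) : Prop :=
  forall (N : structure) (i : V -> N) (G : N),
    generic_extension V p l N i G -> i a ∈ G -> phi N i G.

Definition name_mem {V : structure} (t u : V)
    (N : structure) (i : V -> N) (G : N) : Prop :=
  exists x y, is_val G (i t) x /\ is_val G (i u) y /\ x ∈ y.

(* (t, t') is a member of the value of the name u. *)
Definition name_rel {V : structure} (u t t' : V)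
    (N : structure) (i : V -> N) (G : N) : Prop :=
  exists r x x', is_val G (i u) r /\ is_val G (i t) x /\
    is_val G (i t') x' /\ rel r x x'.

Definition name_closed_poset {V : structure} (p2 l2 d : V)
    (N : structure) (i : V -> N) (G : N) : Prop :=
  exists p l, is_val G (i p2) p /\ is_val G (i l2) l /\
    is_poset p l /\ strategically_closed p l (i d).

(* (q, m) is the two-step iteration of (p1, l1) and the names (p2, l2): the
   conditions are the pairs (a, t) with t in the domain of p2 and a forcing
   that t belongs to p2. *)
Definition is_iteration {V : structure} (p1 l1 p2 l2 q m : V) : Prop :=
  (forall x, x ∈ q <-> exists a t, is_opair x a t /\ a ∈ p1 /\
     (exists b, rel p2 t b) /\ forces p1 l1 a (name_mem t p2)) /\
  (forall z, z ∈ m <-> exists x x' a t a' t',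
     is_opair z x x' /\ x ∈ q /\ x' ∈ q /\
     is_opair x a t /\ is_opair x' a' t' /\
     rel l1 a a' /\ forces p1 l1 a (name_rel l2 t t')).

(* "Factors as" is taken up to forcing equivalence.  That the first factor is
   nontrivial is part of the notion of a gap: otherwise every forcing notion
   would admit one, with p1 a point and d = 2. *)
Definition admits_gap_below {V : structure} (p l k : V) : Prop :=
  exists p1 l1 p2 l2 q m d : V,
    is_poset p1 l1 /\ nontrivial p1 l1 /\
    d ∈ k /\ card_lt p1 d /\
    (forall a, a ∈ p1 -> forces p1 l1 a (name_closed_poset p2 l2 d)) /\
    is_iteration p1 l1 p2 l2 q m /\
    forcing_equivalent p l q m.

(* Main.v *)
(** Collapse theta over V[G] by a generic g, put W = V[G][g], and let U be a
    measure on kappa in W.  A least function h that is not constant modulo U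
    behaves like the identity for a normal measure.  If F : kappa -> theta is the
    surjection given by g and s_al = F''h(al), then s_al is almost everywhere in
    V, and {Y in V : s_al is in Y for almost all al} is a normal fine measure on
    P_kappa(theta).

    Both this measure and the sets s_al are found in V by an approximation
    property of V in W: a subset A of a set of V, whose trace on each set of V of
    size at most b0 < delta is in V, is itself in V.  Otherwise take a name for A
    and consider, in V, the poset of pairs of a term for the second factor of the
    gap forcing and a name for a condition of the collapse.  It is
    strategically closed for games of length delta + 1, so one such pair serves
    every p in the small first factor at once: extensions of p decide in two
    different ways whether some point x_p belongs to A.  The points x_p form a
    small set of V, so some p decides the trace of A on it, which contradicts the
    choice of x_p. *)

From Stdlib Require Import ssreflect Arith Lia Classical ClassicalEpsilon FunctionalExtensionality PropExtensionality ProofIrrelevance.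
Require Import Defs.
Set Bullet Behavior "None".
Set SsrOldRewriteGoalsOrder.

(** The approximation property is usable because its hypothesis is cheap to verify: a trace on a set
    of V of size at most [b0] consists of fewer than kappa statements about almost all [al], and
    completeness of U finds one [al] that settles them all. One pair can carry two opposite
    decisions because the first factor is nontrivial. Below p take incompatible [pa] and [pb]. As A
    is not in V, some x stays undecided below [pa]; decide x below [pb] in any way, then in the
    opposite way below [pa]. Incompatibility allows both to be put into a single pair. Two features
    of the setting govern the foundations. V may be ill founded and is not assumed definable in its
    extensions, so inductions run inside the structures on definable predicates, and classes of V
    enter an extension only through sets of V. Moreover [forces] quantifies over actual extensions;
    countability makes this agree with a syntactic forcing relation, so that forced statements can
    be used in separation, replacement and recursion inside V. *)

Record ZF (M : structure) : Prop := {
  zf_ext : forall x y : M, (forall z, z ∈ x <-> z ∈ y) -> x = y;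
  zf_found : forall x : M, nonempty x -> exists y, y ∈ x /\ forall z, z ∈ x -> z ∉ y;
  zf_pair : forall x y : M, exists z, is_upair z x y;
  zf_union : forall x : M, exists u, forall z, z ∈ u <-> exists y, y ∈ x /\ z ∈ y;
  zf_pow : forall x : M, exists p, forall z, z ∈ p <-> sub z x;
  zf_inf : exists w : M, (exists o, o ∈ w /\ ~ nonempty o) /\
      forall x, x ∈ w -> exists y, y ∈ w /\ is_succ y x;
  zf_sep : forall (f : formula) (e : nat -> M) (a : M),
      exists b, forall x, x ∈ b <-> x ∈ a /\ sat (scons x e) f;
  zf_repl : forall (f : formula) (e : nat -> M) (a : M),
      (forall x y y', x ∈ a -> sat (scons x (scons y e)) f ->
         sat (scons x (scons y' e)) f -> y = y') ->
      exists b, forall y,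
        y ∈ b <-> exists x, x ∈ a /\ sat (scons x (scons y e)) f
}.
Existing Class ZF.
Existing Class ZFC.

#[export] Instance ZFC_ZF (M : structure) : ZFC M -> ZF M.
Proof. by case=> *; constructor. Qed.

(** * Definability *)

(* A family of models with a class of admissible parameters. Over a one-point
   family this is definability in a single model; over the family of all generic
   extensions it is definability uniform in the generic filter. *)
Record fam := Fam {
  idx : Type;
  st : idx -> structure;
  ok : (forall j, st j) -> Prop
}.
Arguments st : simpl never.

Definition ev (F : fam) (j : idx F) := nat -> st F j.
Arguments ev : clear implicits.

Fixpoint ren (r : nat -> nat) (f : formula) : formula :=
  match f with
  | FMem m n => FMem (r m) (r n)
  | FEq m n => FEq (r m) (r n)
  | FNot g => FNot (ren r g)
  | FAnd g h => FAnd (ren r g) (ren r h)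
  | FAll g => FAll (ren (fun k => match k with O => O | S m => S (r m) end) g)
  end.

Lemma sat_ren {M : structure} f : forall r (e : nat -> M),
  sat e (ren r f) <-> sat (fun k => e (r k)) f.
Proof.
elim: f => [m n|m n|g IH|g IH h IH'|g IH] r e //=.
- by rewrite IH.
- by rewrite IH IH'.
- split=> H x; move: (H x); rewrite IH; congr (sat _ _);
    apply: functional_extensionality; by case.
Qed.

(* Variables at even positions, parameters at odd ones. *)
Definition mix {T} (e p : nat -> T) (k : nat) : T :=
  if Nat.even k then e (Nat.div2 k) else p (Nat.div2 k).

Lemma mix_even {T} (e p : nat -> T) k : mix e p (2 * k) = e k.
Proof. by rewrite /mix Nat.even_mul /= Nat.div2_double. Qed.

Lemma mix_odd {T} (e p : nat -> T) k : mix e p (S (2 * k)) = p k.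
Proof.
rewrite /mix; have -> : Nat.even (S (2 * k)) = false.
  by rewrite Nat.even_succ -Nat.negb_even Nat.even_mul.
by rewrite Nat.div2_succ_double.
Qed.

Lemma even_odd_cases k : (exists m, k = 2 * m) \/ (exists m, k = S (2 * m)).
Proof.
case: (Nat.Even_or_Odd k) => [[m ->]|[m ->]]; [left|right]; exists m; lia.
Qed.

Definition Def (F : fam) (P : forall j, ev F j -> Prop) : Prop :=
  (exists d, ok F d) -> exists (f : formula) (p : nat -> forall j, st F j), (forall k, ok F (p k)) /\
    forall j e, sat (mix e (fun k => p k j)) f <-> P j e.
Arguments Def : clear implicits.

Definition DT (F : fam) (t : forall j, ev F j -> st F j) : Prop :=
  Def F (fun j e => e 0 = t j (fun k => e (S k))).
Arguments DT : clear implicits.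

Section DefRules.
Context {F : fam}.
Implicit Types (P Q : forall j, ev F j -> Prop) (t u : forall j, ev F j -> st F j).

Lemma Def_ext P Q : (forall j e, P j e <-> Q j e) -> Def F P -> Def F Q.
Proof. move=> H hP /hP [f [p [ho hf]]]; exists f, p; split=> // j e; by rewrite hf H. Qed.

Lemma Def_not P : Def F P -> Def F (fun j e => ~ P j e).
Proof. move=> hP /hP [f [p [ho hf]]]; exists (FNot f), p; split=> //= j e; by rewrite hf. Qed.

(** Two formulas are conjoined over the interleaved parameters [mix p q]; [renl] and [renr] send the
    odd positions into the half belonging to [p] or to [q] and leave the variables alone. *)
Definition renl k := if Nat.even k then k else S (2 * (2 * Nat.div2 k)).
Definition renr k := if Nat.even k then k else S (2 * S (2 * Nat.div2 k)).

Lemma mix_renl {T} (e p q : nat -> T) : (fun k => mix e (mix p q) (renl k)) = mix e p.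
Proof.
apply: functional_extensionality => k; rewrite [mix e p k]/mix /renl.
case E : (Nat.even k); first by rewrite /mix E.
by rewrite mix_odd mix_even.
Qed.

Lemma mix_renr {T} (e p q : nat -> T) : (fun k => mix e (mix p q) (renr k)) = mix e q.
Proof.
apply: functional_extensionality => k; rewrite [mix e q k]/mix /renr.
case E : (Nat.even k); first by rewrite /mix E.
by rewrite mix_odd mix_odd.
Qed.

Lemma mix_fam (p q : nat -> forall j, st F j) j :
  (fun k => mix p q k j) = mix (fun k => p k j) (fun k => q k j).
Proof. apply: functional_extensionality => k; rewrite /mix; by case: (Nat.even k). Qed.

Lemma Def_and P Q : Def F P -> Def F Q -> Def F (fun j e => P j e /\ Q j e).
Proof.
move=> hP hQ d; move: (hP d) (hQ d) => [f [p [ho hf]]] [g [q [ho' hg]]].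
exists (FAnd (ren renl f) (ren renr g)), (mix p q); split=> [k|j e /=].
  by rewrite /mix; case: (Nat.even k).
by rewrite !sat_ren mix_fam mix_renl mix_renr hf hg.
Qed.

(** A quantifier puts its variable in front of the whole interleaved environment, while it belongs
    in front of the even half only; this renaming repairs the difference. *)
Definition sconsr k := match k with O => O | _ => if Nat.even k then k - 1 else S k end.

Lemma mix_scons {T} (x : T) e p : (fun k => scons x (mix e p) (sconsr k)) = mix (scons x e) p.
Proof.
apply: functional_extensionality => k.
case: (even_odd_cases k) => -[m ->].
  case: m => [//|m]; rewrite mix_even.
  have -> : sconsr (2 * S m) = S (2 * m).
    rewrite /sconsr; have -> : Nat.even (2 * S m) = true by rewrite Nat.even_mul.
    case E : (2 * S m) => [|n]; lia.
  by rewrite [scons _ _ _]/= -[X in mix _ _ X]/(2 * m) mix_even.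
rewrite mix_odd; have -> : sconsr (S (2 * m)) = S (S (2 * m)).
  rewrite /sconsr Nat.even_succ -Nat.negb_even Nat.even_mul /=; lia.
by rewrite /= -(mix_odd e p m).
Qed.

Lemma Def_all0 P : Def F P -> Def F (fun j e => forall x, P j (scons x e)).
Proof.
move=> hP /hP [f [p [ho hf]]]; exists (FAll (ren sconsr f)), p; split=> // j e /=.
split=> H x; move: (H x); by rewrite sat_ren mix_scons hf.
Qed.

Lemma Def_all (P : forall j, ev F j -> st F j -> Prop) :
  Def F (fun j e => P j (fun k => e (S k)) (e 0)) -> Def F (fun j e => forall x, P j e x).
Proof. move=> H; exact: (Def_all0 _ H). Qed.

Lemma Def_or P Q : Def F P -> Def F Q -> Def F (fun j e => P j e \/ Q j e).
Proof.
move=> HP HQ; apply: (Def_ext (fun j e => ~ (~ P j e /\ ~ Q j e))).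
  by move=> j e; tauto.
by apply/Def_not/Def_and; apply: Def_not.
Qed.

Lemma Def_imp P Q : Def F P -> Def F Q -> Def F (fun j e => P j e -> Q j e).
Proof.
move=> HP HQ; apply: (Def_ext (fun j e => ~ (P j e /\ ~ Q j e))).
  by move=> j e; tauto.
by apply/Def_not/Def_and => //; apply: Def_not.
Qed.

Lemma Def_iff P Q : Def F P -> Def F Q -> Def F (fun j e => P j e <-> Q j e).
Proof. by move=> HP HQ; apply: Def_and; apply: Def_imp. Qed.

Lemma Def_ex (P : forall j, ev F j -> st F j -> Prop) :
  Def F (fun j e => P j (fun k => e (S k)) (e 0)) -> Def F (fun j e => exists x, P j e x).
Proof.
move=> H; apply: (Def_ext (fun j e => ~ forall x, ~ P j e x)).
  move=> j e; split=> [/not_all_ex_not [x hx]|[x hx] /(_ x)] //; exists x; exact: NNPP.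
by apply/Def_not/Def_all/Def_not.
Qed.

Lemma Def_ren (r : nat -> nat) P : Def F P -> Def F (fun j e => P j (fun k => e (r k))).
Proof.
move=> hP /hP [f [p [ho hf]]].
exists (ren (fun k => if Nat.even k then 2 * r (Nat.div2 k) else k) f), p; split=> // j e.
rewrite sat_ren -hf.
rewrite (_ : (fun k => _) = mix (fun k => e (r k)) (fun k => p k j)) //.
apply: functional_extensionality => k; rewrite [in RHS]/mix.
case E : (Nat.even k); by rewrite ?mix_even // /mix E.
Qed.

Lemma Def_v (P : Prop) : P -> Def F (fun j e => P).
Proof.
by move=> h [d hd]; exists (FEq 0 0), (fun _ => d); split.
Qed.

Lemma Def_mem0 m n : Def F (fun j e => e m ∈ e n).
Proof.
move=> [d hd]; exists (FMem (2 * m) (2 * n)), (fun _ => d); split=> // j e.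
by rewrite [sat _ _]/= -!/(2 * _) !mix_even.
Qed.

Lemma Def_eq0 m n : Def F (fun j e => e m = e n).
Proof.
move=> [d hd]; exists (FEq (2 * m) (2 * n)), (fun _ => d); split=> // j e.
by rewrite [sat _ _]/= -!/(2 * _) !mix_even.
Qed.

Lemma DT_var n : DT F (fun j e => e n).
Proof. exact: Def_eq0. Qed.

Lemma DT_ok c : ok F c -> DT F (fun j e => c j).
Proof. by move=> h _; exists (FEq 0 1), (fun _ => c); split. Qed.

Lemma DT_shift t : DT F t -> DT F (fun j e => t j (fun k => e (S k))).
Proof.
move=> H; exact: (Def_ren (fun k => match k with O => O | S m => S (S m) end) _ H).
Qed.

(** The syntax has no terms, so a definable function is substituted by quantifying over its
    value. *)
Lemma Def_subst (P : forall j, ev F j -> st F j -> Prop) t :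
  Def F (fun j e => P j (fun k => e (S k)) (e 0)) -> DT F t -> Def F (fun j e => P j e (t j e)).
Proof.
move=> HP Ht; apply: (Def_ext (fun j e => exists x, x = t j e /\ P j e x)).
  by move=> j e; split=> [[x [->]]|H] //; exists (t j e).
exact/Def_ex/Def_and.
Qed.

Lemma Def_subst2 (P : forall j, st F j -> st F j -> Prop) t u :
  Def F (fun j e => P j (e 0) (e 1)) -> DT F t -> DT F u ->
  Def F (fun j e => P j (t j e) (u j e)).
Proof.
move=> HP Ht Hu; apply: (Def_subst (fun j e x => P j x (u j e))) => //.
apply: (Def_subst (fun j e x => P j (e 0) x)); last exact: DT_shift.
exact: (Def_ren (fun k => match k with O => 1 | S _ => 0 end) _ HP).
Qed.

Lemma Def_subst3 (P : forall j, st F j -> st F j -> st F j -> Prop) t u (v : forall j, ev F j -> st F j) :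
  Def F (fun j e => P j (e 0) (e 1) (e 2)) -> DT F t -> DT F u -> DT F v ->
  Def F (fun j e => P j (t j e) (u j e) (v j e)).
Proof.
move=> hP ht hu hv; apply: (Def_subst (fun j e x => P j x (u j e) (v j e)) t) => //.
apply: (Def_subst (fun j e x => P j (e 0) x (v j (fun k => e (S k)))) (fun j e => u j (fun k => e (S k))));
  last exact: DT_shift.
apply: (Def_subst (fun j e x => P j (e 1) (e 0) x) (fun j e => v j (fun k => e (S (S k)))));
  last exact: (DT_shift _ (DT_shift _ hv)).
exact: (Def_ren (fun k => match k with O => 2 | 1 => 1 | _ => 0 end) _ hP).
Qed.

Lemma Def_mem t u : DT F t -> DT F u -> Def F (fun j e => t j e ∈ u j e).
Proof. exact: (Def_subst2 (fun j x y => x ∈ y)) (Def_mem0 0 1). Qed.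

Lemma Def_eq t u : DT F t -> DT F u -> Def F (fun j e => t j e = u j e).
Proof. exact: (Def_subst2 (fun j x y => x = y)) (Def_eq0 0 1). Qed.

Lemma DT_app1 (H : forall j, st F j -> st F j) t :
  Def F (fun j e => e 0 = H j (e 1)) -> DT F t -> DT F (fun j e => H j (t j e)).
Proof.
move=> HH Ht; apply: (Def_subst2 (fun j x y => x = H j y)) => //; first exact: Def_eq0.
exact: DT_shift.
Qed.

Lemma DT_app2 (H : forall j, st F j -> st F j -> st F j) t u :
  Def F (fun j e => e 0 = H j (e 1) (e 2)) -> DT F t -> DT F u -> DT F (fun j e => H j (t j e) (u j e)).
Proof.
move=> hH ht hu; apply: (Def_subst3 (fun j x y z => x = H j y z) (fun j e => e 0)
  (fun j e => t j (fun k => e (S k))) (fun j e => u j (fun k => e (S k)))) => //.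
- exact: DT_var.
- exact: DT_shift.
- exact: DT_shift.
Qed.

End DefRules.

Definition single (M : structure) : fam := Fam unit (fun _ => M) (fun _ => True).
Arguments single M : simpl never.

(** [s] merely shows that the structure is inhabited. If no set has the extension [P], the value is
    arbitrary, so each use is accompanied by a proof of [is_set]. *)
Definition mk {M : structure} (s : M) (P : M -> Prop) : M :=
  epsilon (inhabits s) (fun b => forall x, x ∈ b <-> P x).
Definition is_set {M : structure} (P : M -> Prop) : Prop :=
  exists b : M, forall x, x ∈ b <-> P x.

Lemma in_mk {M : structure} (s : M) P : is_set P -> forall x, x ∈ mk s P <-> P x.
Proof. by move=> h; exact: (epsilon_spec (inhabits s) _ h). Qed.

Lemma ext {M : structure} {HM : ZF M} (x y : M) : (forall z, z ∈ x <-> z ∈ y) -> x = y.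
Proof. exact: zf_ext. Qed.

Class famZF (F : fam) : Prop := fam_zf : forall j, ZF (st F j).
#[export] Instance single_zf (M : structure) : ZF M -> famZF (single M).
Proof. by move=> H j. Qed.

Lemma DT_mk {F : fam} {HF : famZF F} (s : forall j, ev F j -> st F j)
    (P : forall j, ev F j -> st F j -> Prop) :
  (forall j e, is_set (P j e)) -> Def F (fun j e => P j (fun k => e (S k)) (e 0)) ->
  DT F (fun j e => mk (s j e) (P j e)).
Proof.
move=> hs hP; apply: (Def_ext (fun j e => forall z, z ∈ e 0 <-> P j (fun k => e (S k)) z)).
  move=> j e; split=> [h|-> z]; last exact: in_mk.
  by have := HF j => ?; apply: ext => z; rewrite h in_mk.
apply/Def_all/Def_iff; first exact: Def_mem0.
exact: (Def_ren (fun k => match k with O => 0 | S m => S (S m) end) _ hP).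
Qed.

(** A proposition of the metatheory is decided classically and then defined by a trivial formula, so
    facts independent of the environment count as atoms. *)
Lemma Def_const {F : fam} (P : Prop) : Def F (fun j e => P).
Proof.
case: (classic P) => h; first exact: Def_v.
apply: (Def_ext (fun j e => ~ True)); first by tauto.
exact/Def_not/Def_v.
Qed.

Lemma DT_one {M : structure} (c : M) : DT (single M) (fun j e => c).
Proof. exact: (@DT_ok (single M) (fun _ => c)). Qed.

(* [df] proves definability by following the syntax of the goal.  The hooks below
   are extended as new operations are shown to be definable; [df_hyp] uses
   definability hypotheses from the context. *)
Ltac df_pairs := fail.
Ltac df_rec := fail.
Ltac df_prod := fail.
Ltac df_names := fail.
Ltac df_hyp := fail.
Ltac df_unfold :=
  lazymatch goal with
  | |- Def ?F (fun j e => @?B j e) =>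
      let B' := eval cbv beta in B in
      lazymatch B' with
      | fun j e => sub _ _ => unfold sub
      | fun j e => nonempty _ => unfold nonempty
      | fun j e => is_upair _ _ _ => unfold is_upair
      | fun j e => is_opair _ _ _ => unfold is_opair
      | fun j e => rel _ _ _ => unfold rel
      | fun j e => is_succ _ _ => unfold is_succ
      | fun j e => functional _ => unfold functional
      | fun j e => rel_on _ _ _ => unfold rel_on
      | fun j e => is_fun _ _ _ => unfold is_fun
      | fun j e => injects _ _ => unfold injects
      | fun j e => transitive _ => unfold transitive
      | fun j e => is_ord _ => unfold is_ord
      | fun j e => is_limit _ => unfold is_limit
      | fun j e => card_lt _ _ => unfold card_lt
      | fun j e => is_card _ => unfold is_card
      | fun j e => is_restriction _ _ _ => unfold is_restriction
      | fun j e => second_player_stages _ _ => unfold second_player_stages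
      | fun j e => play_following _ _ _ _ _ _ => unfold play_following
      | fun j e => is_val _ _ _ => unfold is_val
      end
  end.
Ltac df_step :=
  cbv beta;
  first
  [ assumption
  | lazymatch goal with
    | |- Def _ (fun j e => _ /\ _) => refine (Def_and _ _ _ _)
    | |- Def _ (fun j e => _ \/ _) => refine (Def_or _ _ _ _)
    | |- Def _ (fun j e => ~ _) => refine (Def_not _ _)
    | |- Def _ (fun j e => exists x, _) => refine (Def_ex _ _)
    | |- Def _ (fun j e => _ <-> _) => refine (Def_iff _ _ _ _)
    | |- Def _ (fun j e => _ ∈ _) => refine (Def_mem _ _ _ _)
    | |- Def _ (fun j e => _ = _) => refine (Def_eq _ _ _ _)
    | |- Def _ (fun j e => forall x, _) => first [refine (Def_imp _ _ _ _) | refine (Def_all _ _)]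
    | |- DT _ (fun j e => e _) => refine (DT_var _)
    | |- DT (single _) _ => refine (DT_one _)
    end
  | refine (Def_const _)
  | df_hyp | df_pairs | df_rec | df_prod | df_names | df_unfold ].
Ltac df := repeat df_step.

(** * Basic set theory *)

Lemma sep_is_set (M : structure) :
  (forall (f : formula) (e : nat -> M) (a : M),
     exists b, forall x, x ∈ b <-> x ∈ a /\ sat (scons x e) f) ->
  forall (a : M) (P : M -> Prop), (forall x, P x -> x ∈ a) ->
  Def (single M) (fun j e => P (e 0)) -> is_set P.
Proof.
move=> hsep a P hP /(_ (ex_intro _ (fun _ => a) I)) [f [p [_ hf]]].
have [b hb] := hsep (ren sconsr f) (mix (fun _ => a) (fun k => p k tt)) a.
exists b => x; rewrite hb sat_ren mix_scons (hf tt); split=> [[]|h] //=; split=> //; exact: hP.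
Qed.

Section Basic.
Context {M : structure} {HM : ZF M}.
Implicit Types x y z a b f r : M.

Lemma is_set_sub a (P : M -> Prop) :
  (forall x, P x -> x ∈ a) -> Def (single M) (fun j e => P (e 0)) -> is_set P.
Proof. exact/sep_is_set/zf_sep. Qed.

Lemma is_set_sep a (P : M -> Prop) :
  Def (single M) (fun j e => P (e 0)) -> is_set (fun x => x ∈ a /\ P x).
Proof. by move=> h; apply: (is_set_sub a) => [x []//|]; df. Qed.

Lemma is_set_repl a (R : M -> M -> Prop) :
  Def (single M) (fun j e => R (e 0) (e 1)) ->
  (forall x y y', x ∈ a -> R x y -> R x y' -> y = y') ->
  is_set (fun y => exists x, x ∈ a /\ R x y).
Proof.
move=> /(_ (ex_intro _ (fun _ => a) I)) [f [p [_ hf]]] hR.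
have E x y : R x y <-> sat (scons x (scons y (mix (fun _ => a) (fun k => p k tt))))
    (ren (fun k => match sconsr k with O => O | S m => S (sconsr m) end) f).
  rewrite sat_ren.
  have -> : (fun k => scons x (scons y (mix (fun _ : nat => a) (fun k0 : nat => p k0 tt)))
       match sconsr k with 0 => 0 | S m => S (sconsr m) end)
     = mix (scons x (scons y (fun _ => a))) (fun k => p k tt).
    rewrite -mix_scons; apply: functional_extensionality => k.
    case: (sconsr k) => [//|m] /=; by rewrite -mix_scons.
  by rewrite (hf tt).
have [|b hb] := zf_repl _ HM (ren (fun k => match sconsr k with O => O | S m => S (sconsr m) end) f)
  (mix (fun _ => a) (fun k => p k tt)) a; last first.
  exists b => y; rewrite hb; split=> -[x [hx h]]; exists x; split=> //; apply/E; exact: h.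
by move=> x y y' hx /E h /E h'; apply: hR h h'.
Qed.

Lemma is_set_img a (G : M -> M) :
  Def (single M) (fun j e => e 0 = G (e 1)) -> is_set (fun y => exists x, x ∈ a /\ y = G x).
Proof.
move=> h; apply: is_set_repl => [|x y y' _ -> //].
exact: (Def_ren (fun k => match k with O => 1 | S _ => 0 end) _ h).
Qed.

Definition upair x y := mk x (fun w => w = x \/ w = y).
Definition opair x y := upair (upair x x) (upair x y).
Definition un x := mk x (fun z => exists y, y ∈ x /\ z ∈ y).
Definition pw x := mk x (fun z => sub z x).
Definition cup x y := un (upair x y).
Definition sc x := cup x (upair x x).
Definition emp x := mk x (fun z => False).

Lemma set_upair x y : is_set (fun w => w = x \/ w = y).
Proof. by have [z hz] := zf_pair _ HM x y; exists z. Qed.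
Lemma in_upair x y w : w ∈ upair x y <-> w = x \/ w = y.
Proof. exact: (in_mk _ _ (set_upair x y)). Qed.
Lemma in_sing x w : w ∈ upair x x <-> w = x.
Proof. rewrite in_upair; tauto. Qed.
Lemma set_un x : is_set (fun z => exists y, y ∈ x /\ z ∈ y).
Proof. by have [z hz] := zf_union _ HM x; exists z. Qed.
Lemma in_un x z : z ∈ un x <-> exists y, y ∈ x /\ z ∈ y.
Proof. exact: (in_mk _ _ (set_un x)). Qed.
Lemma set_pw x : is_set (fun z => sub z x).
Proof. by have [z hz] := zf_pow _ HM x; exists z. Qed.
Lemma in_pw x z : z ∈ pw x <-> sub z x.
Proof. exact: (in_mk _ _ (set_pw x)). Qed.
Lemma in_cup x y z : z ∈ cup x y <-> z ∈ x \/ z ∈ y.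
Proof.
rewrite in_un; split=> [[w [/in_upair [->|->]]]|[h|h]]; try tauto;
  [exists x|exists y]; rewrite in_upair; tauto.
Qed.
Lemma in_sc x z : z ∈ sc x <-> z ∈ x \/ z = x.
Proof. by rewrite in_cup in_sing. Qed.
Lemma set_emp : is_set (fun z : M => False).
Proof.
have [w [[o [_ ho]] _]] := zf_inf M HM; exists o => x; split=> // h; apply: ho; by exists x.
Qed.
Lemma in_emp x z : z ∉ emp x.
Proof. by move/(in_mk _ _ set_emp). Qed.

Lemma is_upairE z x y : is_upair z x y <-> z = upair x y.
Proof.
split=> [h|-> w]; last exact: in_upair.
by apply: ext => w; rewrite h in_upair.
Qed.
Lemma upair_inj x y x' y' : upair x y = upair x' y' -> (x = x' /\ y = y') \/ (x = y' /\ y = x').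
Proof.
move=> E; have H w : w = x \/ w = y <-> w = x' \/ w = y' by rewrite -!in_upair E.
case: (proj1 (H x) (or_introl eq_refl)) (proj1 (H y) (or_intror eq_refl))
  (proj2 (H x') (or_introl eq_refl)) (proj2 (H y') (or_intror eq_refl)) => ?;
  case=> ?; case=> ?; case=> ?; subst; auto.
Qed.
Lemma opair_inj x y x' y' : opair x y = opair x' y' -> x = x' /\ y = y'.
Proof.
move=> /upair_inj [[/upair_inj E /upair_inj E']|[/upair_inj E /upair_inj E']];
  intuition (subst; auto).
Qed.
Lemma is_opairE z x y : is_opair z x y <-> z = opair x y.
Proof.
split=> [[a [b [/is_upairE -> [/is_upairE -> /is_upairE ->]]]]//|->].
exists (upair x x), (upair x y); by rewrite !is_upairE.
Qed.
Lemma relE r x y : rel r x y <-> opair x y ∈ r.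
Proof.
split=> [[z [/is_opairE ->]]//|h]; exists (opair x y); by rewrite is_opairE.
Qed.
Lemma opair_un2 r x y : opair x y ∈ r -> x ∈ un (un r) /\ y ∈ un (un r).
Proof.
move=> h; split; apply/in_un; exists (upair x y); rewrite in_upair; split; auto;
  apply/in_un; exists (opair x y); split=> //; apply/in_upair; auto.
Qed.
Lemma rel_un2 r x y : rel r x y -> x ∈ un (un r) /\ y ∈ un (un r).
Proof. by move/relE/opair_un2. Qed.
Lemma is_succE y x : is_succ y x <-> y = sc x.
Proof.
split=> [h|-> w]; last exact: in_sc.
by apply: ext => w; rewrite h in_sc.
Qed.
End Basic.

Section BasicDT.
Context {F : fam} {HF : famZF F}.
Implicit Types (t u v : forall j, ev F j -> st F j).
Lemma DT_upair t u : DT F t -> DT F u -> DT F (fun j e => upair (t j e) (u j e)).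
Proof.
move=> ht hu; apply: DT_mk => [j e|]; first by have := HF j => ?; exact: set_upair.
apply: Def_or; apply: Def_eq; by [exact: Def_eq0|exact: DT_shift].
Qed.
Lemma DT_opair t u : DT F t -> DT F u -> DT F (fun j e => opair (t j e) (u j e)).
Proof. by move=> ht hu; apply: DT_upair; apply: DT_upair. Qed.
Lemma DT_un t : DT F t -> DT F (fun j e => un (t j e)).
Proof.
move=> ht; apply: DT_mk => [j e|]; first by have := HF j => ?; exact: set_un.
apply/Def_ex/Def_and; last by df. apply: Def_mem; first by df. exact: (DT_shift _ (DT_shift _ ht)).
Qed.
Lemma DT_cup t u : DT F t -> DT F u -> DT F (fun j e => cup (t j e) (u j e)).
Proof. by move=> ht hu; apply/DT_un/DT_upair. Qed.
Lemma DT_sc t : DT F t -> DT F (fun j e => sc (t j e)).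
Proof. by move=> ht; apply/DT_cup => //; apply: DT_upair. Qed.
Lemma DT_pw t : DT F t -> DT F (fun j e => pw (t j e)).
Proof.
move=> ht; apply: DT_mk => [j e|]; first by have := HF j => ?; exact: set_pw.
rewrite /sub; apply/Def_all/Def_imp; first by df. apply: Def_mem; first by df.
exact: (DT_shift _ (DT_shift _ ht)).
Qed.
Lemma Def_rel t u v : DT F t -> DT F u -> DT F v -> Def F (fun j e => rel (t j e) (u j e) (v j e)).
Proof.
move=> ht hu hv; apply: (Def_ext (fun j e => opair (u j e) (v j e) ∈ t j e)).
  by move=> j e; have := HF j => ?; rewrite relE.
by apply: Def_mem => //; apply: DT_opair.
Qed.
Lemma Def_is_opair t u v : DT F t -> DT F u -> DT F v -> Def F (fun j e => is_opair (t j e) (u j e) (v j e)).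
Proof.
move=> ht hu hv; apply: (Def_ext (fun j e => t j e = opair (u j e) (v j e))).
  by move=> j e; have := HF j => ?; rewrite is_opairE.
by apply: Def_eq => //; apply: DT_opair.
Qed.
End BasicDT.

Ltac df_pairs ::= lazymatch goal with
  | |- Def _ (fun j e => rel _ _ _) => refine (Def_rel _ _ _ _ _ _)
  | |- Def _ (fun j e => is_opair _ _ _) => refine (Def_is_opair _ _ _ _ _ _)
  | |- DT _ (fun j e => upair _ _) => refine (DT_upair _ _ _ _)
  | |- DT _ (fun j e => opair _ _) => refine (DT_opair _ _ _ _)
  | |- DT _ (fun j e => un _) => refine (DT_un _ _)
  | |- DT _ (fun j e => cup _ _) => refine (DT_cup _ _ _ _)
  | |- DT _ (fun j e => sc _) => refine (DT_sc _ _)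
  | |- DT _ (fun j e => pw _) => refine (DT_pw _ _)
  end.

Section AppRules.
Context {M : structure}.
Notation D := (Def (single M)).
Notation T := (DT (single M)).
Lemma Def_app1 (P : M -> Prop) t : D (fun j e => P (e 0)) -> T t -> D (fun j e => P (t j e)).
Proof.
exact: (@Def_subst (single M) (fun j e x => P x) t). Qed.
Lemma Def_app2 (P : M -> M -> Prop) t u :
  D (fun j e => P (e 0) (e 1)) -> T t -> T u -> D (fun j e => P (t j e) (u j e)).
Proof. exact: (@Def_subst2 (single M) (fun j => P)). Qed.
Lemma Def_app3 (P : M -> M -> M -> Prop) t u v :
  D (fun j e => P (e 0) (e 1) (e 2)) -> T t -> T u -> T v -> D (fun j e => P (t j e) (u j e) (v j e)).
Proof. exact: (@Def_subst3 (single M) (fun j => P)). Qed.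
Lemma DT_fun1 (H : M -> M) t : D (fun j e => e 0 = H (e 1)) -> T t -> T (fun j e => H (t j e)).
Proof. exact: (@DT_app1 (single M) (fun _ => H)). Qed.
Lemma DT_fun2 (H : M -> M -> M) t u :
  D (fun j e => e 0 = H (e 1) (e 2)) -> T t -> T u -> T (fun j e => H (t j e) (u j e)).
Proof. exact: (@DT_app2 (single M) (fun _ => H)). Qed.
End AppRules.

Ltac df_hyp ::= match goal with
  | H : Def (single _) (fun j e => ?P (e 0)) |- Def (single _) (fun j e => ?P _) => refine (Def_app1 P _ H _)
  | H : Def (single _) (fun j e => ?P (e 0) (e 1)) |- Def (single _) (fun j e => ?P _ _) =>
      refine (Def_app2 P _ _ H _ _)
  | H : Def (single _) (fun j e => ?P (e 0) (e 1) (e 2)) |- Def (single _) (fun j e => ?P _ _ _) =>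
      refine (Def_app3 P _ _ _ H _ _ _)
  | H : Def (single _) (fun j e => e 0 = ?P (e 1)) |- DT (single _) (fun j e => ?P _) =>
      refine (DT_fun1 P _ H _)
  | H : Def (single _) (fun j e => e 0 = ?P (e 1) (e 2)) |- DT (single _) (fun j e => ?P _ _) =>
      refine (DT_fun2 P _ _ H _ _)
  end.

(** * Foundation, transitive closure, recursion *)

Section Found.
Context {M : structure} {HM : ZF M}.
Implicit Types x y z a b f r t w : M.
Notation D := (Def (single M)).

Lemma mem_irr x : x ∉ x.
Proof.
move=> h; have [|y [/in_sing -> H]] := zf_found _ HM (upair x x).
  by exists x; rewrite in_sing.
by apply: (H x) => //; rewrite in_sing.
Qed.

Lemma mem_asym x y : x ∈ y -> y ∉ x.
Proof.
move=> h h'; have [|z [/in_upair [->|->] H]] := zf_found _ HM (upair x y).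
- by exists x; rewrite in_upair; auto.
- by apply: (H y) => //; rewrite in_upair; auto.
- by apply: (H x) => //; rewrite in_upair; auto.
Qed.

Lemma sc_inj x y : sc x = sc y -> x = y.
Proof.
move=> E; have: x ∈ sc y by rewrite -E in_sc; auto.
have: y ∈ sc x by rewrite E in_sc; auto.
by rewrite !in_sc => -[h|?] [h'|?] //; case: (mem_asym _ _ h h').
Qed.

Lemma emp_unique x y : ~ nonempty x -> ~ nonempty y -> x = y.
Proof. by move=> hx hy; apply: ext => z; split=> h; [case: hx|case: hy]; exists z. Qed.

Lemma sc_nonempty x : nonempty (sc x).
Proof. by exists x; rewrite in_sc; auto. Qed.

Definition inductive x := (forall o, ~ nonempty o -> o ∈ x) /\ forall y, y ∈ x -> sc y ∈ x.

(** The intersection of all inductive sets. Induction is restricted to definable predicates, since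
    the natural numbers of the structure may be nonstandard. *)
Lemma omega_exists : exists w, inductive w /\ forall P : M -> Prop, D (fun j e => P (e 0)) ->
  (forall o, ~ nonempty o -> P o) -> (forall x, x ∈ w -> P x -> P (sc x)) ->
  forall x, x ∈ w -> P x.
Proof.
have [w0 [[o [ho ne]] hs]] := zf_inf M HM.
have hw0 : inductive w0.
  split=> [o' ho'|y hy]; first by rewrite (emp_unique o' o).
  by have [z [hz /is_succE <-]] := hs _ hy.
have [w hw] : is_set (fun x => x ∈ w0 /\ forall I, inductive I -> x ∈ I).
  by apply: is_set_sep; rewrite /inductive; df.
exists w; split.
  split=> [o' ho'|y /hw [hy H]]; rewrite hw; split.
  - exact: (proj1 hw0).
  - by move=> I []; auto.
  - exact: (proj2 hw0).
  - by move=> I hI; apply: (proj2 hI); apply: H.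
move=> P hP h0 hS.
have [I hI] := is_set_sep w P hP.
have HI : inductive I.
  split=> [o' ho'|y /hI [hy Py]]; rewrite hI; split; auto.
    by rewrite hw; split; [exact: (proj1 hw0)|move=> I' []; auto].
  move/hw: hy => [hy H]; rewrite hw; split; first exact: (proj2 hw0).
  by move=> I' hI'; apply: (proj2 hI'); apply: H.
by move=> x /hw [_ /(_ _ HI) /hI []].
Qed.

(** Union of the iterates of [un] on [x] along the internal omega. Recursion is not yet available,
    so an iterate is certified by a set [r] of pairs in which each entry is the initial one or
    arises from another entry by one step. *)
Lemma trans_superset x : exists t, transitive t /\ sub x t.
Proof.
have [w [[w0 wS] ind]] := omega_exists.
pose R n T := exists r, rel r n T /\ forall m U, rel r m U ->
  (~ nonempty m /\ U = x) \/ exists m' U', rel r m' U' /\ m = sc m' /\ U = un U'.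
have dR : D (fun j e => R (e 0) (e 1)) by rewrite /R; df.
have exR n : n ∈ w -> exists T, R n T.
  move: n; apply: ind; first by df.
    move=> o ho; exists x, (upair (opair o x) (opair o x)); split.
      by rewrite relE in_sing.
    by move=> m U; rewrite relE in_sing => /opair_inj [-> ->]; left.
  move=> n hn [T [r [h hr]]].
  exists (un T), (cup r (upair (opair (sc n) (un T)) (opair (sc n) (un T)))); split.
    by rewrite relE in_cup in_sing; auto.
  move=> m U; rewrite relE in_cup in_sing => -[/relE /hr [?|[m' [U' [h1 h2]]]]|]; first by left.
    by right; exists m', U'; split=> //; rewrite relE in_cup; left; apply/relE.
  move=> /opair_inj [-> ->]; right; exists n, T; split=> //.
  by rewrite relE in_cup; left; apply/relE.
have unR n : n ∈ w -> forall T T', R n T -> R n T' -> T = T'.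
  move: n; apply: ind; first by df.
    move=> o ho T T' [r [h hr]] [r' [h' hr']].
    case: (hr _ _ h) => [[_ ->]|[m' [U' [_ [E _]]]]]; last first.
      by case: ho; rewrite E; exact: sc_nonempty.
    case: (hr' _ _ h') => [[_ ->]//|[m' [U' [_ [E _]]]]].
    by case: ho; rewrite E; exact: sc_nonempty.
  move=> n hn IH T T' [r [h hr]] [r' [h' hr']].
  case: (hr _ _ h) => [[[] ]|[m [U [h1 [/sc_inj Em ->]]]]]; first exact: sc_nonempty.
  case: (hr' _ _ h') => [[[] ]|[m' [U' [h1' [/sc_inj Em' ->]]]]]; first exact: sc_nonempty.
  subst m m'; congr un; apply: IH; by [exists r|exists r'].
have [b hb] : is_set (fun T => exists n, n ∈ w /\ R n T).
  by apply: is_set_repl => // n T T' hn; apply: unR.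
exists (un b); split=> [y /in_un [T [/hb [n [hn [r [h hr]]]] hy]] z hz|y hy]; apply/in_un.
  exists (un T); split; last by apply/in_un; exists y.
  apply/hb; exists (sc n); split; first exact: wS.
  exists (cup r (upair (opair (sc n) (un T)) (opair (sc n) (un T)))); split.
    by rewrite relE in_cup in_sing; auto.
  move=> m U; rewrite relE in_cup in_sing => -[/relE /hr [?|[m' [U' [h1 h2]]]]|]; first by left.
    by right; exists m', U'; split=> //; rewrite relE in_cup; left; apply/relE.
  move=> /opair_inj [-> ->]; right; exists n, T; split=> //.
  by rewrite relE in_cup; left; apply/relE.
exists x; split=> //; apply/hb; exists (emp x); split; first by apply: w0 => -[z /in_emp].
have ho : ~ nonempty (emp x) by move=> -[z /in_emp].
exists (upair (opair (emp x) x) (opair (emp x) x)); split; first by rewrite relE in_sing.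
by move=> m U; rewrite relE in_sing => /opair_inj [-> ->]; left.
Qed.

Definition tc x := mk x (fun z => forall t, transitive t -> sub x t -> z ∈ t).

Lemma set_tc x : is_set (fun z => forall t, transitive t -> sub x t -> z ∈ t).
Proof.
have [t [h1 h2]] := trans_superset x; apply: (is_set_sub t) => [z|]; [by auto|by df].
Qed.
Lemma in_tc x z : z ∈ tc x <-> forall t, transitive t -> sub x t -> z ∈ t.
Proof. exact: (in_mk _ _ (set_tc x)). Qed.
Lemma sub_tc x : sub x (tc x).
Proof. by move=> z hz; apply/in_tc => t _; apply. Qed.
Lemma tc_trans x : transitive (tc x).
Proof. move=> y /in_tc hy z hz; apply/in_tc => t ht hs; exact: (ht y (hy t ht hs)). Qed.
Lemma tc_min x t : transitive t -> sub x t -> sub (tc x) t.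
Proof. by move=> ht hs z /in_tc; apply. Qed.
Lemma tc_mono x y : x ∈ tc y -> sub (tc x) (tc y).
Proof. by move=> h; apply: tc_min; [exact: tc_trans|exact: (tc_trans y)]. Qed.
Lemma tc_inv x z : z ∈ tc x -> z ∈ x \/ exists y, y ∈ x /\ z ∈ tc y.
Proof.
have [b hb] : is_set (fun z => z ∈ tc x /\ (z ∈ x \/ exists y, y ∈ x /\ z ∈ tc y)).
  by apply: is_set_sep; rewrite /tc; df; apply: DT_mk => [j e|]; [exact: set_tc|df].
have H : sub (tc x) b.
  apply: tc_min => [y /hb [hy H] w hw|w hw]; apply/hb; split.
  - exact: (tc_trans x y).
  - right; case: H => [hx|[v [hv hy']]]; first by exists y; split=> //; exact: sub_tc.
    by exists v; split=> //; exact: (tc_trans v y).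
  - exact: sub_tc.
  - by left.
by move=> /H /hb [].
Qed.

(** The counterexamples inside a transitive closure form a set, so the axiom of foundation applies
    even to a structure that is ill founded from outside. *)
Lemma eps_ind (P : M -> Prop) : D (fun j e => P (e 0)) ->
  (forall x, (forall y, y ∈ x -> P y) -> P x) -> forall x, P x.
Proof.
move=> hP H x; apply: NNPP => nP.
have [b hb] : is_set (fun z => z ∈ tc (upair x x) /\ ~ P z) by apply: is_set_sep; df.
have [|y [/hb [hy nPy] hmin]] := zf_found _ HM b.
  by exists x; apply/hb; split=> //; apply: sub_tc; rewrite in_sing.
apply: nPy; apply: H => z hz; apply: NNPP => nPz; apply: (hmin z) => //.
by apply/hb; split=> //; exact: (tc_trans _ y).
Qed.

(** Subnames sit inside ordered pairs, hence in the transitive closure of a name but not among its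
    elements; recursion on names needs this stronger form. *)
Lemma tc_ind (P : M -> Prop) : D (fun j e => P (e 0)) ->
  (forall x, (forall y, y ∈ tc x -> P y) -> P x) -> forall x, P x.
Proof.
move=> hP H x; apply: (H); move: x; apply: eps_ind.
  rewrite /tc; df; apply: DT_mk => [j e|]; [exact: set_tc|df].
move=> x IH y /tc_inv [hy|[z [hz hy]]]; last exact: (IH z).
by apply: H; exact: (IH y).
Qed.

Lemma tc_irr x : x ∉ tc x.
Proof.
move: x; apply: eps_ind; first by rewrite /tc; df; apply: DT_mk => [j e|]; [exact: set_tc|df].
move=> x IH /tc_inv [/mem_irr//|[y [hy hx]]]; apply: (IH y hy); exact: (tc_trans y x).
Qed.

End Found.

Lemma DT_tc {F : fam} {HF : famZF F} t : DT F t -> DT F (fun j e => tc (t j e)).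
Proof.
move=> ht; apply: DT_mk => [j e|]; first by have := HF j => ?; exact: set_tc.
refine (Def_all _ _); cbv beta; apply: Def_imp; first by df.
apply: Def_imp; last by df.
rewrite /sub; refine (Def_all _ _); cbv beta; apply: Def_imp; last by df.
apply: Def_mem; first by df. exact: (DT_shift _ (DT_shift _ (DT_shift _ ht))).
Qed.
Ltac df_rec ::= lazymatch goal with |- DT _ (fun j e => tc _) => refine (DT_tc _ _) end.

Definition ap {M : structure} (f x : M) : M := un (mk f (fun y => rel f x y)).
Definition restr {M : structure} (f t : M) : M := mk f (fun z => z ∈ f /\ exists u v, z = opair u v /\ u ∈ t).
Definition lam {M : structure} (a : M) (G : M -> M) : M :=
  mk a (fun z => exists x, x ∈ a /\ z = opair x (G x)).

(* The unique [y] with [P y]; definable because the union of a singleton is. *)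
Definition the {M : structure} (s : M) (P : M -> Prop) : M := un (mk s P).

Lemma set_the {M : structure} {HM : ZF M} (P : M -> Prop) :
  (forall y y', P y -> P y' -> y = y') -> is_set P.
Proof.
move=> hu; case: (classic (exists y, P y)) => [[y hy]|hn].
  exists (upair y y) => x; rewrite in_sing; split=> [->//|hx]; exact: hu.
have [o ho] := @set_emp M HM; exists o => x; rewrite ho; split=> // hx; apply: hn; by exists x.
Qed.

Lemma the_eq {M : structure} {HM : ZF M} (s : M) (P : M -> Prop) y :
  P y -> (forall y', P y' -> y' = y) -> the s P = y.
Proof.
move=> hy hu; have hs : is_set P by apply: set_the => a b /hu -> /hu ->.
apply: ext => z; rewrite in_un; split=> [[w [/(in_mk _ _ hs) /hu ->]]//|hz].
by exists y; split=> //; apply/(in_mk _ _ hs).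
Qed.

Lemma DT_the {F : fam} {HF : famZF F} (s : forall j, ev F j -> st F j)
    (P : forall j, ev F j -> st F j -> Prop) :
  (forall j e y y', P j e y -> P j e y' -> y = y') ->
  Def F (fun j e => P j (fun k => e (S k)) (e 0)) -> DT F (fun j e => the (s j e) (P j e)).
Proof.
move=> hu hP; apply/DT_un/DT_mk => // j e; have := HF j => ?; exact/set_the/hu.
Qed.

Section FunDefs.
Context {M : structure} {HM : ZF M}.
Implicit Types x y z a b f r t w : M.
Notation D := (Def (single M)).
Lemma set_ap f x : is_set (fun y => rel f x y).
Proof. apply: (is_set_sub (un (un f))) => [y /rel_un2 []//|]; df. Qed.
Lemma ap_eq f x y : functional f -> rel f x y -> ap f x = y.
Proof.
move=> hf h; apply: ext => z; rewrite in_un; split=> [[w [/(in_mk _ _ (set_ap f x)) hw]]|hz].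
  by rewrite (hf _ _ _ h hw).
by exists y; split=> //; apply/(in_mk _ _ (set_ap f x)).
Qed.
Lemma set_restr f t : is_set (fun z => z ∈ f /\ exists u v, z = opair u v /\ u ∈ t).
Proof. by apply: is_set_sep; df. Qed.
Lemma in_restr f t z : z ∈ restr f t <-> z ∈ f /\ exists u v, z = opair u v /\ u ∈ t.
Proof. exact: (in_mk _ _ (set_restr f t)). Qed.
Lemma rel_restr f t x y : rel (restr f t) x y <-> rel f x y /\ x ∈ t.
Proof.
rewrite !relE in_restr; split=> [[h [u [v [/opair_inj [<- _] hu]]]]//|[h1 h2]].
by split=> //; exists x, y.
Qed.
Lemma is_restrictionE s f t : is_restriction s f t <-> s = restr f t.
Proof.
split=> [h|->].
  apply: ext => z; rewrite h in_restr; split=> -[h1 [x [y [h2 h3]]]]; split=> //; exists x, y.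
    by rewrite -is_opairE.
  by rewrite is_opairE.
move=> z; rewrite in_restr; split=> -[h1 [x [y [h2 h3]]]]; split=> //; exists x, y.
  by rewrite is_opairE.
by rewrite -is_opairE.
Qed.
Lemma set_lam a G : D (fun j e => e 0 = G (e 1)) -> is_set (fun z => exists x, x ∈ a /\ z = opair x (G x)).
Proof. move=> h; apply: (is_set_img a (fun x => opair x (G x))); df. Qed.
Lemma in_lam a G z : D (fun j e => e 0 = G (e 1)) ->
  z ∈ lam a G <-> exists x, x ∈ a /\ z = opair x (G x).
Proof. move=> h; exact: (in_mk _ _ (set_lam a G h)). Qed.
Lemma rel_lam a G x y : D (fun j e => e 0 = G (e 1)) -> rel (lam a G) x y <-> x ∈ a /\ y = G x.
Proof.
move=> h; rewrite relE in_lam //; split=> [[x' [hx /opair_inj [-> ->]]]//|[hx ->]].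
by exists x.
Qed.
Lemma lam_functional a G : D (fun j e => e 0 = G (e 1)) -> functional (lam a G).
Proof. by move=> h x y y'; rewrite !rel_lam // => -[_ ->] [_ ->]. Qed.
Lemma ap_lam a G x : D (fun j e => e 0 = G (e 1)) -> x ∈ a -> ap (lam a G) x = G x.
Proof. by move=> h hx; apply: ap_eq; [exact: lam_functional|rewrite rel_lam]. Qed.
End FunDefs.

Section FunDT.
Context {F : fam} {HF : famZF F}.
Implicit Types (t u v : forall j, ev F j -> st F j).
Lemma DT_ap t u : DT F t -> DT F u -> DT F (fun j e => ap (t j e) (u j e)).
Proof.
move=> ht hu; apply/DT_un/DT_mk => [j e|]; first by have := HF j => ?; exact: set_ap.
apply: Def_rel; [exact: DT_shift|exact: DT_shift|exact: DT_var].
Qed.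
Lemma DT_restr t u : DT F t -> DT F u -> DT F (fun j e => restr (t j e) (u j e)).
Proof.
move=> ht hu; apply: DT_mk => [j e|]; first by have := HF j => ?; exact: set_restr.
apply: Def_and; first by apply: Def_mem; [df|exact: DT_shift].
refine (Def_ex _ _); refine (Def_ex _ _); cbv beta; apply: Def_and; first by df.
apply: Def_mem; first by df. exact: (DT_shift _ (DT_shift _ (DT_shift _ hu))).
Qed.
End FunDT.
Ltac df_rec ::= lazymatch goal with
  | |- DT _ (fun j e => tc _) => refine (DT_tc _ _)
  | |- DT _ (fun j e => ap _ _) => refine (DT_ap _ _ _ _)
  | |- DT _ (fun j e => restr _ _) => refine (DT_restr _ _ _ _)
  end.

(** * Recursion along the membership relation *)

Section Rec.
Context {M : structure} {HM : ZF M}.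
Implicit Types x y z a b f g r t w : M.
Notation D := (Def (single M)).
Variable H : M -> M -> M.
Hypothesis dH : D (fun j e => e 0 = H (e 1) (e 2)).

(** The domain is closed under members, so it contains [tc x] together with [x], and the restriction
    handed to [H] is the complete history. *)
Definition attempt f := functional f /\ (forall z, z ∈ f -> exists u v, z = opair u v) /\
  forall x y, rel f x y -> (forall z, z ∈ x -> exists v, rel f z v) /\ y = H x (restr f (tc x)).

Lemma attempt_tc f x y : attempt f -> rel f x y -> forall z, z ∈ tc x -> exists v, rel f z v.
Proof.
move=> [_ [_ hf]] h.
have [b hb] : is_set (fun z => z ∈ un (un f) /\ exists v, rel f z v) by apply: is_set_sep; df.
suff: sub (tc x) b by move=> H' z /H' /hb [].
have aux u v : rel f u v -> sub u b.
  move=> huv w hw; apply/hb; have [h1 _] := hf _ _ huv; have [v' hv'] := h1 _ hw.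
  by split; [case: (rel_un2 _ _ _ hv')|exists v'].
by apply: tc_min => [u /hb [_ [v hv]]|]; apply: aux; eauto.
Qed.

Lemma restr_agree f g t : (forall z, z ∈ t -> forall v, rel f z v <-> rel g z v) ->
  restr f t = restr g t.
Proof.
move=> h; apply: ext => z; rewrite !in_restr; split=> -[h1 [u [v [E hu]]]];
 (split; last by exists u, v); move: h1; rewrite E -!relE; by apply h.
Qed.

Lemma attempt_unique x : forall f f' y y', attempt f -> attempt f' -> rel f x y -> rel f' x y' -> y = y'.
Proof.
move: x; apply: tc_ind; first by rewrite /attempt; df.
move=> u Hu f f' y y' hf hf' h h'.
have [_ [_ /(_ _ _ h) [_ ->]]] := hf; have [_ [_ /(_ _ _ h') [_ ->]]] := hf'.
congr H; apply: restr_agree => w hw v.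
have [v1 h1] := attempt_tc _ _ _ hf h _ hw; have [v2 h2] := attempt_tc _ _ _ hf' h' _ hw.
have E := Hu w hw _ _ _ _ hf hf' h1 h2; subst v2.
by split=> hv; [rewrite (proj1 hf _ _ _ hv h1)|rewrite (proj1 hf' _ _ _ hv h2)].
Qed.

(** By uniqueness, replacement glues the values of attempts on [tc x] into one function [f0]; adding
    the pair at [x] gives an attempt defined there. *)
Lemma attempt_exists x : exists f y, attempt f /\ rel f x y.
Proof.
move: x; apply: tc_ind; first by rewrite /attempt; df.
move=> x IH.
have [f0 hf0] : is_set (fun z => exists u, u ∈ tc x /\ exists v, z = opair u v /\ exists f, attempt f /\ rel f u v).
  apply: is_set_repl; first by rewrite /attempt; df.
  move=> u y y' hu [v [-> [f [hf h]]]] [v' [-> [f' [hf' h']]]].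
  by rewrite (attempt_unique _ _ _ _ _ hf hf' h h').
have rf0 u v : rel f0 u v <-> u ∈ tc x /\ exists f, attempt f /\ rel f u v.
  rewrite relE hf0; split=> [[u' [hu [v' [/opair_inj [-> ->] h]]]]//|[hu h]].
  by exists u; split=> //; exists v.
pose y := H x (restr f0 (tc x)).
have rf1 u v : rel (cup f0 (upair (opair x y) (opair x y))) u v <-> rel f0 u v \/ (u = x /\ v = y).
  rewrite relE in_cup in_sing relE; split=> -[h|h]; auto; first by right; apply: opair_inj.
  by right; case: h => -> ->.
have nx : forall v, ~ rel f0 x v by move=> v /rf0 [/tc_irr].
have ag u : u = x \/ u ∈ tc x -> restr (cup f0 (upair (opair x y) (opair x y))) (tc u) = restr f0 (tc u).
  move=> hu; apply: restr_agree => z hz v; rewrite rf1; split; last by auto.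
  case=> // -[E _]; subst z; case: hu hz => [->|hu hz]; first by move/tc_irr.
  by case: (tc_irr x); exact: (tc_mono u).
exists (cup f0 (upair (opair x y) (opair x y))), y; split; last by rewrite rf1; auto.
split=> [u v v'|]; last split=> [z|u v].
- rewrite !rf1 => -[h|[-> ->]] [h'|[E ->]] //.
  + move/rf0: h h' => [_ [f [hf h]]] /rf0 [_ [f' [hf' h']]].
    exact: (attempt_unique _ _ _ _ _ hf hf' h h').
  + by case: (nx v); rewrite -E.
  + by case: (nx v').
- rewrite in_cup in_sing => -[/hf0 [u [_ [v [-> _]]]]|->]; by eexists _, _.
rewrite rf1 => -[h|[-> ->]]; last first.
  rewrite ag; last by auto.
  split=> // z hz; have [f [v' h]] := IH z (sub_tc x z hz).
  by exists v'; rewrite rf1 rf0; left; split; [exact: sub_tc|exists f].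
move/rf0: (h) => [hu [f [hf hfu]]]; rewrite ag; last by auto.
have [_ [_ /(_ _ _ hfu) [h1 ->]]] := hf; split.
  move=> z hz; have [v' hv'] := h1 _ hz; exists v'; rewrite rf1 rf0; left; split; last by exists f.
  exact: (tc_trans _ u).
congr H; apply: restr_agree => w hw v'; rewrite rf0; split.
  by move=> hv'; split; [exact: (tc_mono u)|exists f].
move=> [_ [f' [hf' h']]]; have [v2 hv2] := attempt_tc _ _ _ hf hfu _ hw.
by rewrite (attempt_unique _ _ _ _ _ hf' hf h' hv2).
Qed.

Definition recF x := the x (fun y => exists f, attempt f /\ rel f x y).

Lemma recF_spec f x y : attempt f -> rel f x y -> recF x = y.
Proof.
move=> hf h; apply: the_eq; first by exists f.
by move=> y' [f' [hf' h']]; exact: (attempt_unique _ _ _ _ _ hf' hf h' h).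
Qed.

Lemma dRecF : D (fun j e => e 0 = recF (e 1)).
Proof.
apply: (Def_ext (F := single M) (fun j e => exists f, attempt f /\ rel f (e 1) (e 0))).
  move=> j e; split=> [[f [hf h]]|->]; first by rewrite (recF_spec _ _ _ hf h).
  have [f [y [hf h]]] := attempt_exists (e 1); exists f; split=> //.
  by rewrite (recF_spec _ _ _ hf h).
by rewrite /attempt; df.
Qed.

Lemma recF_eq x : recF x = H x (lam (tc x) recF).
Proof.
have [f [y [hf h]]] := attempt_exists x; rewrite (recF_spec _ _ _ hf h).
have [_ [_ /(_ _ _ h) [_ ->]]] := hf; congr H.
apply: ext => z; rewrite in_restr in_lam; last exact: dRecF.
split=> [[hz [u [v [E hu]]]]|[u [hu ->]]].
  by exists u; split=> //; rewrite E (recF_spec f u v) // relE -E.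
have [v hv] := attempt_tc _ _ _ hf h _ hu; rewrite (recF_spec _ _ _ hf hv) -relE; split=> //.
by exists u, v.
Qed.
End Rec.

(** * Ordinals, collection, injections *)

Section Ord.
Context {M : structure} {HM : ZF M}.
Implicit Types x y z a b c f g r s t w : M.
Notation D := (Def (single M)).

Lemma ord_in a x : is_ord a -> x ∈ a -> is_ord x.
Proof.
by move=> [ta ha] hx; split=> [|y hy]; [exact: ha|apply: ha; exact: (ta x)].
Qed.

Lemma ord_tri a b : is_ord a -> is_ord b -> a ∈ b \/ a = b \/ b ∈ a.
Proof.
move: a b; apply: eps_ind; first by df.
move=> a IHa; apply: eps_ind; first by df.
move=> b IHb oa ob; case: (classic (a ∈ b)) => [|nab]; first by auto.
case: (classic (b ∈ a)) => [|nba]; first by auto.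
right; left; apply: ext => x; split=> hx.
  case: (IHa x hx b (ord_in _ _ oa hx) ob) => [//|[E|h]]; first by case: nba; rewrite -E.
  by case: nba; exact: (proj1 oa x).
case: (IHb x hx oa (ord_in _ _ ob hx)) => [h|[E|//]]; last by case: nab; rewrite E.
by case: nab; exact: (proj1 ob x).
Qed.

Lemma ord_sub a b : is_ord a -> is_ord b -> a ∈ b \/ a = b -> sub a b.
Proof. by move=> oa ob [h|->] //; exact: (proj1 ob). Qed.

Lemma ord_not_in a b : is_ord a -> is_ord b -> ~ a ∈ b -> sub b a.
Proof.
move=> oa ob n; apply: ord_sub => //; case: (ord_tri a b oa ob) => [//|[->|]]; auto.
Qed.

Lemma ord_sc a : is_ord a -> is_ord (sc a).
Proof.
move=> [ta ha]; split=> x /in_sc [hx|->].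
- by move=> y hy; apply/in_sc; left; exact: (ta x).
- by move=> y hy; apply/in_sc; left.
- exact: ha.
- exact: ta.
Qed.

Lemma ord_un s : (forall x, x ∈ s -> is_ord x) -> is_ord (un s).
Proof.
move=> h; split=> x /in_un [y [hy hx]].
  by move=> z hz; apply/in_un; exists y; split=> //; exact: (proj1 (h y hy) x).
exact: (proj2 (h y hy)).
Qed.

Lemma ord_least (P : M -> Prop) a : D (fun j e => P (e 0)) -> is_ord a -> P a ->
  exists b, is_ord b /\ P b /\ forall c, c ∈ b -> ~ P c.
Proof.
move=> hP oa Pa; apply: NNPP => nE.
suff K : forall a, is_ord a -> ~ P a by exact: (K a).
apply: eps_ind; first by df.
move=> x IH ox Px; apply: nE; exists x; split=> //; split=> // c hc; apply: IH => //; exact: ord_in hc.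
Qed.

Lemma ord_ind (P : M -> Prop) : D (fun j e => P (e 0)) ->
  (forall a, is_ord a -> (forall b, b ∈ a -> P b) -> P a) -> forall a, is_ord a -> P a.
Proof.
move=> hP H; apply: eps_ind; first by df.
move=> a IH oa; apply: H => // b hb; apply: IH => //; exact: (ord_in a).
Qed.

Lemma ord_not_set s : ~ forall a, is_ord a -> a ∈ s.
Proof.
move=> h; have [o ho] : is_set (fun a => a ∈ s /\ is_ord a) by apply: is_set_sep; df.
have oo : is_ord o.
  split=> x /ho [hx ox]; last exact: (proj1 ox).
  move=> y hy; apply/ho; have oy := ord_in _ _ ox hy; by auto.
apply: (mem_irr o); apply/ho; by auto.
Qed.

Lemma ord_tc a : is_ord a -> tc a = a.
Proof.
move=> oa; apply: ext => z; split; last exact: sub_tc.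
by move=> h; apply: (tc_min a a _ _ z h) => //; exact: (proj1 oa).
Qed.

Lemma is_limit_sc a x : is_limit a -> x ∈ a -> sc x ∈ a.
Proof.
move=> [oa [_ h]] hx; have [y [hy hxy]] := h _ hx.
have oy := ord_in _ _ oa hy; have ox := ord_in _ _ oa hx.
case: (ord_tri (sc x) a (ord_sc _ ox) oa) => [//|[E|/in_sc [hax|E]]].
- subst a; move/in_sc: hy => [h'|E]; first by case: (mem_asym _ _ hxy h').
  by subst y; case: (mem_irr x).
- by case: (mem_asym _ _ hx hax).
- by subst a; case: (mem_irr x).
Qed.

(** The recursion step of the cumulative hierarchy: [Vr x] is the union of the power sets of [Vr u]
    for [u] in [x], which makes sense for every set. *)
Definition VrH x g := mk x (fun w => exists u v, u ∈ x /\ rel g u v /\ sub w v).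
Lemma set_VrH x g : is_set (fun w => exists u v, u ∈ x /\ rel g u v /\ sub w v).
Proof.
apply: (is_set_sub (pw (un (un (un g))))); last by df.
move=> w [u [v [_ [/rel_un2 [_ hv] hs]]]]; apply/in_pw => z /hs hz; apply/in_un; by exists v.
Qed.
Lemma dVrH : D (fun j e => e 0 = VrH (e 1) (e 2)).
Proof.
refine (Def_eq _ _ _ _); first by df.
apply: DT_mk => [j e|]; [exact: set_VrH|by df].
Qed.
Definition Vr := recF VrH.

Lemma in_Vr x w : w ∈ Vr x <-> exists u, u ∈ x /\ sub w (Vr u).
Proof.
rewrite /Vr (recF_eq _ dVrH) (in_mk _ _ (set_VrH _ _)).
pose proof (dRecF _ dVrH) as dV.
split=> [[u [v [hu [/(rel_lam _ _ _ _ dV) [_ ->] hs]]]]|[u [hu hs]]]; first by exists u.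
by exists u, (Vr u); rewrite rel_lam //; split=> //; split=> //; split=> //; exact: sub_tc.
Qed.

Lemma Vr_mono x y : sub x y -> sub (Vr x) (Vr y).
Proof. by move=> h w /in_Vr [u [hu hs]]; apply/in_Vr; exists u; auto. Qed.

(** Least ordinal witnesses are unique, so replacement collects them, and their union bounds
    them. *)
Lemma ord_bound (R : M -> M -> Prop) s : D (fun j e => R (e 0) (e 1)) ->
  exists c, is_ord c /\ forall x, x ∈ s -> (exists a, is_ord a /\ R x a) ->
    exists a, is_ord a /\ R x a /\ sub a c.
Proof.
move=> dR.
have [o ho] : is_set (fun a => exists x, x ∈ s /\ (is_ord a /\ R x a /\ forall c, c ∈ a -> ~ R x c)).
  apply: is_set_repl; first by df.
  move=> x a a' _ [oa [ha la]] [oa' [ha' la']].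
  case: (ord_tri a a' oa oa') => [h|[//|h]]; [by case: (la' _ h)|by case: (la _ h)].
exists (un o); split; first by apply: ord_un => a /ho [x [_ []]].
move=> x hx [a [oa ha]].
have [|b [ob [hb lb]]] := ord_least (R x) a _ oa ha; first by df.
exists b; split=> //; split=> // z hz; apply/in_un; exists b; split=> //; apply/ho; by exists x.
Qed.

Lemma in_some_Vr x : exists a, is_ord a /\ x ∈ Vr a.
Proof.
pose proof (dRecF _ dVrH) as dV; rewrite -/Vr in dV.
move: x; apply: eps_ind; first by df.
move=> x IH; have [|c [oc hc]] := ord_bound (fun y a => y ∈ Vr a) x; first by df.
exists (sc c); split; first exact: ord_sc.
apply/in_Vr; exists c; split; first by apply/in_sc; auto.
move=> y hy; have [a [oa [ha hs]]] := hc y hy (IH y hy); exact: (Vr_mono a).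
Qed.

(** Scott's trick: the witnesses are replaced by the least level of the hierarchy containing one, to
    which replacement applies. *)
Lemma collection (R : M -> M -> Prop) s : D (fun j e => R (e 0) (e 1)) ->
  exists Y, forall x, x ∈ s -> (exists y, R x y) -> exists y, y ∈ Y /\ R x y.
Proof.
pose proof (dRecF _ dVrH) as dV; rewrite -/Vr in dV; move=> dR.
have [|c [oc hc]] := ord_bound (fun x a => exists y, y ∈ Vr a /\ R x y) s; first by df.
exists (Vr c) => x hx [y hy]; have [a [oa ha]] := in_some_Vr y.
have [|b [ob [[z [hz hR]] hs]]] := hc x hx; first by exists a; split=> //; exists y.
by exists z; split=> //; exact: (Vr_mono b).
Qed.

Lemma set_prod a b : is_set (fun z => exists x y, z = opair x y /\ x ∈ a /\ y ∈ b).
Proof.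
apply: (is_set_sub (pw (pw (cup a b)))) => [z [x [y [-> [hx hy]]]]|]; last by df.
apply/in_pw => w /in_upair [->|->]; apply/in_pw => v; rewrite in_upair in_cup; case=> ->; auto.
Qed.
Definition prod a b := mk a (fun z => exists x y, z = opair x y /\ x ∈ a /\ y ∈ b).
Lemma in_prod a b z : z ∈ prod a b <-> exists x y, z = opair x y /\ x ∈ a /\ y ∈ b.
Proof. exact: (in_mk _ _ (set_prod a b)). Qed.
Lemma opair_prod a b x y : opair x y ∈ prod a b <-> x ∈ a /\ y ∈ b.
Proof. by rewrite in_prod; split=> [[x' [y' [/opair_inj [-> ->]]]]//|h]; exists x, y. Qed.
Lemma rel_prod a b x y : rel (prod a b) x y <-> x ∈ a /\ y ∈ b.
Proof. by rewrite relE opair_prod. Qed.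
Lemma rel_onE f a b : rel_on f a b <-> sub f (prod a b).
Proof.
split=> h z /h; first by move=> [x [y [/is_opairE -> ?]]]; apply/opair_prod.
by move/in_prod=> [x [y [-> ?]]]; exists x, y; rewrite is_opairE.
Qed.

Lemma relset (R : M -> M -> Prop) a b : D (fun j e => R (e 0) (e 1)) ->
  exists f, rel_on f a b /\ forall x y, rel f x y <-> x ∈ a /\ y ∈ b /\ R x y.
Proof.
move=> dR; have [f hf] : is_set (fun z => z ∈ prod a b /\ exists x y, z = opair x y /\ R x y).
  by apply: is_set_sep; df.
exists f; split=> [|x y]; first by apply/rel_onE => z /hf [].
rewrite relE hf opair_prod; split=> [[[hx hy] [x' [y' [/opair_inj [<- <-]]]]]//|[hx [hy h]]].
by split=> //; exists x, y.
Qed.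

(** [R] may be many-valued; taking the least related element of the ordinal [b] turns it into a
    function. *)
Lemma injects_rel (R : M -> M -> Prop) a b : is_ord b -> D (fun j e => R (e 0) (e 1)) ->
  (forall x, x ∈ a -> exists y, y ∈ b /\ R x y) ->
  (forall x x' y, x ∈ a -> x' ∈ a -> R x y -> R x' y -> x = x') -> injects a b.
Proof.
move=> ob dR ht hi.
have [|f [hf rf]] := relset (fun x y => R x y /\ forall y', y' ∈ y -> ~ R x y') a b; first by df.
exists f; split; last by move=> x x' y /rf [hx [_ [h _]]] /rf [hx' [_ [h' _]]]; exact: hi h h'.
split=> //; split=> [x y y' /rf [_ [hy [h l]]] /rf [_ [hy' [h' l']]]|x hx].
  case: (ord_tri y y' (ord_in _ _ ob hy) (ord_in _ _ ob hy')) => [k|[//|k]].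
    by case: (l' _ k). by case: (l _ k).
have [y [hy h]] := ht x hx.
have [|c [oc [hc lc]]] := ord_least (fun y => y ∈ b /\ R x y) y _ (ord_in _ _ ob hy) (conj hy h).
  by df.
exists c; apply/rf; case: hc => hc hR; split=> //; split=> //; split=> // y' hy' hR'.
by apply: (lc y' hy'); split=> //; exact: (proj1 ob c).
Qed.

Lemma injects_trans a b c : injects a b -> injects b c -> injects a c.
Proof.
move=> [f [[onf [ff tf]] jf]] [g [[og [fg tg]] jg]].
have [|h [oh rh]] := relset (fun x y => exists z, rel f x z /\ rel g z y) a c; first by df.
exists h; split; last first.
  by move=> x x' y /rh [_ [_ [z [h1 h2]]]] /rh [_ [_ [z' [h1' h2']]]];
    have E := jg _ _ _ h2 h2'; subst z'; exact: jf h1 h1'.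
split=> //; split=> [x y y' /rh [_ [_ [z [h1 h2]]]] /rh [_ [_ [z' [h1' h2']]]]|x hx].
  by have E := ff _ _ _ h1 h1'; subst z'; exact: fg h2 h2'.
have [z hz] := tf x hx.
move/relE: (hz) => /onf [x' [z' [/is_opairE /opair_inj [_ <-] [_ hzb]]]].
have [y hy] := tg z hzb.
move/relE: (hy) => /og [z'' [y' [/is_opairE /opair_inj [_ <-] [_ hyc]]]].
by exists y; apply/rh; split=> //; split=> //; exists z.
Qed.

Lemma injects_sub a b : sub a b -> injects a b.
Proof.
move=> h; have [|f [onf rf]] := relset (fun x y => x = y) a b; first by df.
exists f; split; last by move=> x x' y /rf [_ [_ ->]] /rf [_ [_ ->]].
split=> //; split=> [x y y' /rf [_ [_ <-]] /rf [_ [_ <-]]//|x hx].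
by exists x; apply/rf; auto.
Qed.

Lemma card_lt_sub a b k : sub a b -> card_lt b k -> card_lt a k.
Proof. by move=> /injects_sub h [c [hc h']]; exists c; split=> //; exact: injects_trans h'. Qed.

Lemma rel_onP f a b x y : rel_on f a b -> rel f x y -> x ∈ a /\ y ∈ b.
Proof. by move=> /rel_onE h /relE /h /opair_prod. Qed.

Lemma card_lt_rel (R : M -> M -> Prop) c a k : is_ord k -> card_lt a k -> D (fun j e => R (e 0) (e 1)) ->
  (forall x, x ∈ c -> exists y, y ∈ a /\ R x y) ->
  (forall x x' y, x ∈ c -> x' ∈ c -> R x y -> R x' y -> x = x') -> card_lt c k.
Proof.
move=> ok [b [hb [f [[onf [ff tf]] jf]]]] dR ht hi; exists b; split=> //.
apply: (injects_rel (fun x z => exists y, y ∈ a /\ R x y /\ rel f y z)).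
- exact: ord_in hb.
- by df.
- move=> x /ht [y [hy h]]; have [z hz] := tf y hy; exists z; split; last by exists y.
  by case: (rel_onP _ _ _ _ _ onf hz).
- move=> x x' z hx hx' [y [hy [h1 h2]]] [y' [hy' [h1' h2']]].
  by have E := jf _ _ _ h2 h2'; subst y'; exact: hi h1 h1'.
Qed.

Lemma card_lt_img a k (G : M -> M) c : is_ord k -> card_lt a k -> D (fun j e => e 0 = G (e 1)) ->
  (forall y, y ∈ c -> exists x, x ∈ a /\ y = G x) -> card_lt c k.
Proof.
move=> ok ha dG h; apply: (card_lt_rel (fun y x => y = G x) c a k) => //.
by move=> x x' y _ _ -> ->.
Qed.

End Ord.

Lemma DT_prod {F : fam} {HF : famZF F} t u : DT F t -> DT F u -> DT F (fun j e => prod (t j e) (u j e)).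
Proof.
move=> ht hu; apply: DT_mk => [j e|]; first by have := HF j => ?; exact: set_prod.
refine (Def_ex _ _); refine (Def_ex _ _); cbv beta; apply: Def_and; first by df.
apply: Def_and; apply: Def_mem; (try by df); exact: (DT_shift _ (DT_shift _ (DT_shift _ _))).
Qed.
Ltac df_prod ::= lazymatch goal with |- DT _ (fun j e => prod _ _) => refine (DT_prod _ _ _ _) end.

(** * Choice functions, well-orderings, comparison of cardinals *)

Section Choice.
Context {M : structure} {HM : ZFC M}.
Implicit Types x y z a b c f g r s t w k X : M.
Notation D := (Def (single M)).

(** The axiom concerns disjoint families, so each [x] is replaced by the product of its singleton
    with [x]; a selector for these is already the graph of a choice function. *)
Lemma choice_fun X : exists c, functional c /\
  forall x, x ∈ X -> nonempty x -> exists y, rel c x y /\ y ∈ x.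
Proof.
have [a ha] : is_set (fun p => exists x, x ∈ X /\ (nonempty x /\ p = prod (upair x x) x)).
  apply: is_set_repl; first by df.
  by move=> x y y' _ [_ ->] [_ ->].
have [||c hc] := zfc_choice _ HM a.
- move=> p /ha [x [_ [[y hy] ->]]]; exists (opair x y); apply/opair_prod; by rewrite in_sing.
- move=> p p' z /ha [x [_ [_ ->]]] /ha [x' [_ [_ ->]]] /in_prod [u [v [-> [/in_sing -> _]]]].
  by move=> /opair_prod [/in_sing ->].
(* The selector may contain stray elements outside the family, which could spoil functionality; they
   are removed. *)
have [d hd] := is_set_sep c (fun z => z ∈ un a) ltac:(df).
exists d; split.
  move=> x y y' /relE /hd [h1 /in_un [p [hp hz]]] /relE /hd [h1' /in_un [p' [hp' hz']]].
  have [z [_ Hz]] := hc p hp.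
  move/ha: (hp) (hz) => [u [_ [_ E]]]; rewrite E => /opair_prod [/in_sing Eu _]; subst u.
  move/ha: (hp') (hz') => [u' [_ [_ E']]]; rewrite E' => /opair_prod [/in_sing Eu' _]; subst u'.
  have Ep : p = p' by rewrite E E'.
  rewrite -Ep in hz'.
  have E1 := Hz _ (conj hz h1); have E2 := Hz _ (conj hz' h1').
  by move: (eq_trans (eq_sym E1) E2) => /opair_inj [].
move=> x hx nx.
have hp : prod (upair x x) x ∈ a by apply/ha; exists x.
have [z [[h1 h2] _]] := hc _ hp.
move/in_prod: (h1) => [u [y [E [/in_sing Eu hy]]]]; subst u z.
exists y; split=> //; apply/relE/hd; split=> //; apply/in_un; by exists (prod (upair x x) x).
Qed.

Lemma choose (R : M -> M -> Prop) a : D (fun j e => R (e 0) (e 1)) ->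
  exists c, functional c /\ forall x, x ∈ a -> (exists y, R x y) -> exists y, rel c x y /\ R x y.
Proof.
move=> dR; have [Y hY] := collection R a dR.
have [c [fc hc]] := choice_fun (pw Y).
have [|d [od rd]] := relset (fun x y => exists s, (forall z, z ∈ s <-> z ∈ Y /\ R x z) /\ rel c s y) a Y.
  by df.
exists d; split=> [x y y' /rd [_ [_ [s [h1 h2]]]] /rd [_ [_ [s' [h1' h2']]]]|x hx [y hy]].
  have E : s = s' by apply: ext => z; rewrite h1 h1'.
  by subst s'; exact: fc h2 h2'.
have [s hs] := is_set_sep Y (R x) ltac:(df).
have [y' [hy' hR']] := hY x hx (ex_intro _ y hy).
have [||z [hz /hs [hz1 hz2]]] := hc s; first by apply/in_pw => z /hs [].
  by exists y'; apply/hs.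
by exists z; split=> //; apply/rd; split=> //; split=> //; exists s.
Qed.

(** Recursion picks an element not yet listed, and returns [X] itself when nothing is left. As [X]
    is not a member of [X], this end marker cannot be mistaken for an element. *)
Lemma well_order X : exists a f, is_ord a /\ is_fun f a X /\
  (forall x x' y, rel f x y -> rel f x' y -> x = x') /\ forall y, y ∈ X -> exists x, rel f x y.
Proof.
have [ch [fch hch]] := choice_fun (pw X).
pose Ph g y := exists r, (forall z, z ∈ r <-> z ∈ X /\ ~ exists u, rel g u z) /\
  ((nonempty r /\ y = ap ch r) \/ (~ nonempty r /\ y = X)).
have uPh g y y' : Ph g y -> Ph g y' -> y = y'.
  move=> [r [hr h]] [r' [hr' h']]; have E : r = r' by apply: ext => z; rewrite hr hr'.
  by subst r'; case: h h' => -[h ->] [[h' ->]|[h' ->]].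
pose H x g := the x (Ph g).
have dH : D (fun j e => e 0 = H (e 1) (e 2)).
  refine (Def_eq _ _ _ _); first by df.
  apply: DT_the => [j e y y'|]; [exact: uPh|rewrite /Ph; df].
pose F := recF H; have dF : D (fun j e => e 0 = F (e 1)) by exact: dRecF.
have PF a : is_ord a -> Ph (lam a F) (F a).
  move=> oa; rewrite {2}/F (recF_eq _ dH) ord_tc // -/F.
  have [r hr] := is_set_sep X (fun z => ~ exists u, rel (lam a F) u z) ltac:(df).
  have [y hy] : exists y, Ph (lam a F) y.
    case: (classic (nonempty r)) => h; [exists (ap ch r)|exists X]; exists r; auto.
  by rewrite /H (the_eq a (Ph (lam a F)) y hy) // => y'; move/uPh; apply.
have FX a : is_ord a -> F a ∈ X -> forall b, b ∈ a -> F b <> F a.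
  move=> oa hX b hb E; have [r [hr [[ne Ea]|[_ Ea]]]] := PF a oa; last first.
    by move: hX; rewrite Ea => /mem_irr.
  have [|y [hy hyr]] := hch r _ ne; first by apply/in_pw => z /hr [].
  move: hyr; rewrite -(ap_eq _ _ _ fch hy) -Ea => /hr [_ []]; exists b.
  by rewrite rel_lam // E.
(* If the recursion never stopped, replacement along the inverse of [F] would produce a set
   containing all ordinals. *)
have [a [oa ha]] : exists a, is_ord a /\ F a ∉ X.
  apply: NNPP => nE; have al a : is_ord a -> F a ∈ X by move=> oa; apply: NNPP => h; apply: nE; exists a.
  have [o ho] : is_set (fun a => exists y, y ∈ X /\ (is_ord a /\ F a = y)).
    apply: is_set_repl; first by df.
    move=> y a a' _ [oa <-] [oa' E]; case: (ord_tri a a' oa oa') => [h|[//|h]].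
      by case: (FX a' oa' (al _ oa') a h).
    by case: (FX a oa (al _ oa) a' h).
  apply: (ord_not_set o) => a oa; apply/ho; exists (F a); auto.
have [|b [ob [hb lb]]] := ord_least (fun a => F a ∉ X) a _ oa ha; first by df.
have al c : c ∈ b -> F c ∈ X by move=> hc; apply: NNPP; exact: lb.
exists b, (lam b F); split=> //; split; last split.
- split; last split.
  + by apply/rel_onE => z /in_lam - /(_ dF) [x [hx ->]]; apply/opair_prod; auto.
  + exact: lam_functional.
  + by move=> x hx; exists (F x); rewrite rel_lam.
- move=> x x' y; rewrite !rel_lam // => -[hx ->] [hx' E].
  have ox := ord_in _ _ ob hx; have ox' := ord_in _ _ ob hx'.
  case: (ord_tri x x' ox ox') => [h|[//|h]].
    by case: (FX x' ox' (al _ hx') x h).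
  by case: (FX x ox (al _ hx) x' h).
have [r [hr [[ne Eb]|[ne Eb]]]] := PF b ob.
  have [|y [hy hyr]] := hch r _ ne; first by apply/in_pw => z /hr [].
  by case: hb; rewrite Eb (ap_eq _ _ _ fch hy); case/hr: hyr.
move=> y hy; apply: NNPP => n; apply: ne; exists y; apply/hr; by split.
Qed.

Lemma card_compare k X : is_card k -> card_lt X k \/ injects k X.
Proof.
move=> [ok ck]; have [a [f [oa [[onf [ff tf]] [jf sf]]]]] := well_order X.
case: (classic (a ∈ k)) => [h|/(ord_not_in _ _ oa ok) h].
  left; exists a; split=> //; apply: (injects_rel (fun y x => rel f x y)) => //; first by df.
    by move=> y hy; have [x hx] := sf y hy; exists x; case: (rel_onP _ _ _ _ _ onf hx).
  by move=> x x' y _ _; exact: ff.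
right; apply: injects_trans (injects_sub _ _ h) _; by exists f.
Qed.

Lemma not_both k X : is_card k -> card_lt X k -> injects k X -> False.
Proof. by move=> [_ ck] [b [hb h]] h'; apply: (ck b hb); exact: injects_trans h. Qed.

End Choice.

(** * The forcing relation *)

Lemma rel_tc {M : structure} {HM : ZF M} (x z r : M) : rel x z r -> z ∈ tc x /\ r ∈ tc x.
Proof.
move/relE => h; have h1 : opair z r ∈ tc x by exact: sub_tc.
have h2 : upair z r ∈ tc x by apply: (tc_trans x _ h1); rewrite in_upair; auto.
by split; apply: (tc_trans x _ h2); rewrite in_upair; auto.
Qed.

Section Forcing.
Context {M : structure} {HM : ZFC M} (p l : M).
Hypothesis hp : is_poset p l.
Implicit Types a b c d x y z w r s t : M.
Notation D := (Def (single M)).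
Notation le a b := (rel l a b).

Lemma le_p a b : le a b -> a ∈ p /\ b ∈ p.
Proof. by case: hp => _ [h _]; exact: rel_onP. Qed.
Lemma le_refl a : a ∈ p -> le a a.
Proof. by case: hp => _ [_ [h _]]; exact: h. Qed.
Lemma le_trans a b c : le a b -> le b c -> le a c.
Proof. by case: hp => _ [_ [_ h]]; exact: h. Qed.

(** One round of a back-and-forth between two names: densely below [a], each active element of one
    has an [E]-related active element of the other. *)
Definition fcl (E : M -> M -> M -> Prop) a x y : Prop :=
  (forall z r b, rel x z r -> le b a -> le b r ->
     exists c z' r', le c b /\ rel y z' r' /\ le c r' /\ E c z z') /\
  (forall z' r' b, rel y z' r' -> le b a -> le b r' ->
     exists c z r, le c b /\ rel x z r /\ le c r /\ E c z z').

(* Forced equality of names as a greatest fixed point: no recursion on names is needed. *)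
Definition feq a x y : Prop :=
  exists e, rel e a (opair x y) /\ forall b z w, rel e b (opair z w) ->
    b ∈ p /\ fcl (fun b z w => rel e b (opair z w)) b z w.

Definition fmem a x y : Prop :=
  a ∈ p /\ forall b, le b a -> exists c z r, le c b /\ rel y z r /\ le c r /\ feq c x z.

Lemma dfeq : D (fun j e => feq (e 0) (e 1) (e 2)).
Proof. rewrite /feq /fcl; df. Qed.
Lemma dfmem : D (fun j e => fmem (e 0) (e 1) (e 2)).
Proof. pose proof dfeq; rewrite /fmem; df. Qed.

Lemma fcl_sub (E E' : M -> M -> M -> Prop) a x y :
  (forall a x y, E a x y -> E' a x y) -> fcl E a x y -> fcl E' a x y.
Proof.
move=> h [h1 h2]; split=> z r b k1 k2 k3.
  by have [c [z' [r' [? [? [? ?]]]]]] := h1 z r b k1 k2 k3; exists c, z', r'; auto.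
by have [c [z' [r' [? [? [? ?]]]]]] := h2 z r b k1 k2 k3; exists c, z', r'; auto.
Qed.

(** The back-and-forth never leaves the transitive closures of the two names, so a definable
    relation closed under it can be cut down to the set that [feq] asks for. *)
Lemma feq_coind (R : M -> M -> M -> Prop) : D (fun j e => R (e 0) (e 1) (e 2)) ->
  (forall a x y, R a x y -> a ∈ p /\ fcl R a x y) -> forall a x y, R a x y -> feq a x y.
Proof.
move=> dR H a x y h.
have [|e [_ re]] := relset (fun b q => exists z w, q = opair z w /\ R b z w) p
  (prod (tc (upair x x)) (tc (upair y y))); first by df.
have re' b z w : rel e b (opair z w) <-> z ∈ tc (upair x x) /\ w ∈ tc (upair y y) /\ R b z w.
  rewrite re opair_prod; split=> [[hb [[hz hw] [z' [w' [/opair_inj [<- <-]]]]]]//|[hz [hw hR]]].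
  have [hb _] := H _ _ _ hR; split=> //; split=> //; by exists z, w.
have self (u : M) : u ∈ tc (upair u u) by apply: sub_tc; rewrite in_sing.
exists e; split; first by apply/re'.
move=> b z w /re' [hz [hw /H [hb [h1 h2]]]]; split=> //; split=> u r c k1 k2 k3.
  have [d [z' [r' [? [hz' [? ?]]]]]] := h1 u r c k1 k2 k3; exists d, z', r'; do ! split=> //.
  apply/re'; split; last split=> //.
    by apply: (tc_mono z) => //; case: (rel_tc _ _ _ k1).
  by apply: (tc_mono w) => //; case: (rel_tc _ _ _ hz').
have [d [z' [r' [? [hz' [? ?]]]]]] := h2 u r c k1 k2 k3; exists d, z', r'; do ! split=> //.
apply/re'; split; last split=> //.
  by apply: (tc_mono z) => //; case: (rel_tc _ _ _ hz').
by apply: (tc_mono w) => //; case: (rel_tc _ _ _ k1).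
Qed.

Lemma feqE a x y : feq a x y <-> a ∈ p /\ fcl feq a x y.
Proof.
have U b z w : feq b z w -> b ∈ p /\ fcl feq b z w.
  move=> [e [he H]]; have [hb h] := H _ _ _ he; split=> //.
  by apply: fcl_sub h => ? ? ? h; exists e.
split=> [|h]; first exact: U.
apply: (feq_coind (fun b z w => feq b z w \/ b = a /\ z = x /\ w = y)); last by right.
  by pose proof dfeq; df.
move=> b z w [/U [hb k]|[-> [-> ->]]]; [split=> //; apply: fcl_sub k; auto|].
by case: h => ha k; split=> //; apply: fcl_sub k; auto.
Qed.

Lemma feq_p a x y : feq a x y -> a ∈ p.
Proof. by case/feqE. Qed.
Lemma feq_mono a b x y : le b a -> feq a x y -> feq b x y.
Proof.
move=> hb /feqE [ha [h1 h2]]; apply/feqE; split; first by case: (le_p _ _ hb).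
by split=> z r c k1 k2 k3; [apply: (h1 z r)|apply: (h2 z r)] => //; exact: le_trans hb.
Qed.
Lemma feq_refl a x : a ∈ p -> feq a x x.
Proof.
move=> ha; apply: (feq_coind (fun a x y => a ∈ p /\ x = y)) => //; first by df.
move=> {ha}a y z [ha ->]; split=> //; split=> u r b k1 k2 k3; exists b, u, r;
  have [hb _] := le_p _ _ k2; do ! split=> //; exact: le_refl.
Qed.
Lemma feq_sym a x y : feq a x y -> feq a y x.
Proof.
apply: (feq_coind (fun a x y => feq a y x)); first by pose proof dfeq; df.
by move=> {}a {}x {}y /feqE [ha [h1 h2]]; split.
Qed.
Lemma feq_trans a x y z : feq a x y -> feq a y z -> feq a x z.
Proof.
move=> h h'; apply: (feq_coind (fun a x z => exists y, feq a x y /\ feq a y z)); last by exists y.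
  by pose proof dfeq; df.
move=> {h h'}a {}x {}z [{}y [/feqE [ha [h1 h2]] /feqE [_ [k1 k2]]]]; split=> //; split=> u r b i1 i2 i3.
  have [c [v [s [j1 [j2 [j3 j4]]]]]] := h1 u r b i1 i2 i3.
  have [d [w [t [m1 [m2 [m3 m4]]]]]] := k1 v s c j2 (le_trans _ _ _ j1 i2) j3.
  exists d, w, t; do ! split=> //; first exact: le_trans j1.
  by exists v; split=> //; exact: feq_mono j4.
have [c [v [s [j1 [j2 [j3 j4]]]]]] := k2 u r b i1 i2 i3.
have [d [w [t [m1 [m2 [m3 m4]]]]]] := h2 v s c j2 (le_trans _ _ _ j1 i2) j3.
exists d, w, t; do ! split=> //; first exact: le_trans j1.
by exists v; split=> //; exact: feq_mono j4.
Qed.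
Lemma feq_dense a x y : a ∈ p -> (forall b, le b a -> exists c, le c b /\ feq c x y) -> feq a x y.
Proof.
move=> ha H; apply/feqE; split=> //; split=> z r b k1 k2 k3.
  have [c [hc /feqE [_ [h _]]]] := H b k2; have [c_p _] := le_p _ _ hc.
  have [d [z' [r' [? [? [? ?]]]]]] := h z r c k1 (le_refl _ c_p) (le_trans _ _ _ hc k3).
  by exists d, z', r'; do ! split=> //; exact: le_trans hc.
have [c [hc /feqE [_ [_ h]]]] := H b k2; have [c_p _] := le_p _ _ hc.
have [d [z' [r' [? [? [? ?]]]]]] := h z r c k1 (le_refl _ c_p) (le_trans _ _ _ hc k3).
by exists d, z', r'; do ! split=> //; exact: le_trans hc.
Qed.

Lemma fmem_mono a b x y : le b a -> fmem a x y -> fmem b x y.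
Proof.
move=> hb [ha h]; split; first by case: (le_p _ _ hb).
by move=> c hc; apply: h; exact: le_trans hb.
Qed.
Lemma fmem_dense a x y : a ∈ p -> (forall b, le b a -> exists c, le c b /\ fmem c x y) -> fmem a x y.
Proof.
move=> ha H; split=> // b hb; have [c [hc [c_p h]]] := H b hb.
have [d [z [r [? ?]]]] := h c (le_refl _ c_p); exists d, z, r; split=> //; exact: le_trans hc.
Qed.
Lemma fmem_eql a x x' y : feq a x x' -> fmem a x y -> fmem a x' y.
Proof.
move=> E [ha h]; split=> // b hb; have [c [z [r [h1 [h2 [h3 h4]]]]]] := h b hb.
exists c, z, r; do ! split=> //; apply: feq_trans h4; apply: feq_sym.
by apply: feq_mono E; exact: le_trans hb.
Qed.
Lemma fmem_eqr a x y y' : feq a y y' -> fmem a x y -> fmem a x y'.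
Proof.
move=> /feqE [_ [E _]] [ha h]; split=> // b hb; have [c [z [r [h1 [h2 [h3 h4]]]]]] := h b hb.
have [d [z' [r' [k1 [k2 [k3 k4]]]]]] := E z r c h2 (le_trans _ _ _ h1 hb) h3.
exists d, z', r'; do ! split=> //; first exact: le_trans h1.
by apply: feq_trans k4; exact: feq_mono h4.
Qed.
Lemma fmem_intro a x y z r : rel y z r -> le a r -> feq a x z -> fmem a x y.
Proof.
move=> h1 h2 h3; split; first exact: feq_p h3.
move=> b hb; have [b_p _] := le_p _ _ hb; exists b, z, r; do ! split=> //; [exact: le_refl| |].
  exact: le_trans h2.
exact: feq_mono h3.
Qed.

Fixpoint Forc (f : formula) (a : M) (e : nat -> M) : Prop :=
  match f with
  | FMem m n => fmem a (e m) (e n)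
  | FEq m n => feq a (e m) (e n)
  | FNot g => a ∈ p /\ forall b, le b a -> ~ Forc g b e
  | FAnd g h => Forc g a e /\ Forc h a e
  | FAll g => a ∈ p /\ forall x, Forc g a (scons x e)
  end.

Lemma forc_p f : forall a e, Forc f a e -> a ∈ p.
Proof.
by elim: f => [m n|m n|g _|g IH h _|g _] a e //=; [case|exact: feq_p|case|case=> /IH|case].
Qed.

Lemma forc_mono f : forall a b e, le b a -> Forc f a e -> Forc f b e.
Proof.
elim: f => [m n|m n|g IH|g IH h IH'|g IH] a b e hb /=.
- exact: fmem_mono.
- exact: feq_mono.
- move=> [_ H]; split; [by case: (le_p _ _ hb)|by move=> c hc; apply: H; exact: le_trans hb].
- by move=> [h1 h2]; split; [exact: IH h1|exact: IH' h2].
- move=> [_ H]; split; [by case: (le_p _ _ hb)|by move=> x; exact: (IH a)].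
Qed.

Lemma forc_dense f : forall a e, a ∈ p -> (forall b, le b a -> exists c, le c b /\ Forc f c e) -> Forc f a e.
Proof.
elim: f => [m n|m n|g IH|g IH h IH'|g IH] a e ha H /=.
- exact: fmem_dense.
- exact: feq_dense.
- split=> // b hb hg; have [c [hc [c_p k]]] := H b hb.
  by apply: (k c (le_refl _ c_p)); exact: forc_mono hg.
- split; [apply: IH|apply: IH'] => // b /H [c [hc [k1 k2]]]; by exists c.
- split=> // x; apply: IH => // b /H [c [hc [_ k]]]; exists c; split=> //; exact: k.
Qed.

(** Induction on the formula in the metatheory. Condition and environment are arbitrary definable
    terms, so that the quantifier case can shift the environment. *)
Lemma dForc f : forall (A : forall j, ev (single M) j -> M) (T : nat -> forall j, ev (single M) j -> M),
  DT (single M) A -> (forall n, DT (single M) (T n)) -> D (fun j e => Forc f (A j e) (fun n => T n j e)).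
Proof.
elim: f => [m n|m n|g IH|g IH h IH'|g IH] A T hA hT /=.
- exact: (Def_app3 _ _ _ _ dfmem).
- exact: (Def_app3 _ _ _ _ dfeq).
- apply: Def_and; first by apply: Def_mem; last by df.
  refine (Def_all _ _); cbv beta; apply: Def_imp.
    apply: Def_rel; [by df|by df|exact: DT_shift].
  apply: Def_not.
  apply: (IH (fun j e => e 0) (fun n j e => T n j (fun k => e (S k)))) => [|n]; first by df.
  exact: DT_shift.
- by apply: Def_and; [exact: IH|exact: IH'].
- apply: Def_and; first by apply: Def_mem; last by df.
  refine (Def_all _ _); cbv beta.
  apply: (Def_ext (F := single M) (fun j e => Forc g (A j (fun k => e (S k)))
    (fun n => match n with O => e 0 | S m => T m j (fun k => e (S k)) end))).
    move=> j e; rewrite (_ : (fun n => match n with O => e 0 | S m => T m j (fun k => e (S k)) end)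
      = scons (e 0) (fun n => T n j (fun k => e (S k)))) //.
  apply: (IH (fun j e => A j (fun k => e (S k)))
    (fun n j e => match n with O => e 0 | S m => T m j (fun k => e (S k)) end)).
    exact: DT_shift.
  by case=> [|n]; [df|exact: DT_shift].
Qed.

Record gfilter (G : M -> Prop) : Prop := {
  g_sub : forall a, G a -> a ∈ p;
  g_ne : exists a, G a;
  g_up : forall a b, G a -> le a b -> G b;
  g_dir : forall a b, G a -> G b -> exists c, G c /\ le c a /\ le c b;
  g_dense : forall d, is_dense p l d -> exists a, a ∈ d /\ G a
}.

(** Adding the conditions incompatible with [a] turns density below [a] into density; a filter
    containing [a] avoids the added ones. *)
Lemma gfilter_below G (Dn : M -> Prop) a : gfilter G -> D (fun j e => Dn (e 0)) -> G a ->
  (forall b, le b a -> exists c, le c b /\ Dn c) -> exists c, G c /\ le c a /\ Dn c.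
Proof.
move=> hG dD Ga H.
have [d hd] : is_set (fun c => c ∈ p /\ ((Dn c /\ le c a) \/ ~ compatible p l c a)).
  by apply: is_set_sep; rewrite /compatible; df.
have [|c [/hd [c_p hc] Gc]] := g_dense _ hG d.
  split=> [b /hd []//|b hb].
  case: (classic (compatible p l b a)) => [[c [hc [h1 h2]]]|h]; last first.
    by exists b; split; [apply/hd; auto|exact: le_refl].
  have [c' [h3 h4]] := H c h2; exists c'; split; last exact: le_trans h1.
  apply/hd; split; first by case: (le_p _ _ h3).
  by left; split=> //; exact: le_trans h2.
case: hc => [[h1 h2]|h]; first by exists c.
by have [b [Gb [h1 h2]]] := g_dir _ hG _ _ Gc Ga; case: h; exists b; split=> //; exact: (g_sub _ hG).
Qed.

(** The Rasiowa-Sikorski construction: run through an enumeration of the whole structure and enter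
    those elements that happen to be dense sets. *)
Lemma gfilter_exists a : countable M -> a ∈ p -> exists G, gfilter G /\ G a.
Proof.
move=> [en hen] ha.
pose next d b := epsilon (inhabits a) (fun c => c ∈ d /\ le c b).
pose fix s n := match n with O => a | S m =>
  match excluded_middle_informative (is_dense p l (en m)) with left _ => next (en m) (s m) | right _ => s m end end.
have sp n : s n ∈ p.
  elim: n => [//|n IH] /=; case: excluded_middle_informative => // [[hs hd]].
  by have [] := epsilon_spec (inhabits a) (fun c => c ∈ en n /\ le c (s n)) (hd _ IH); move/hs.
have sS n : le (s (S n)) (s n).
  move=> /=; case: excluded_middle_informative => [[hs hd]|_]; last exact: le_refl.
  by have [] := epsilon_spec (inhabits a) (fun c => c ∈ en n /\ le c (s n)) (hd _ (sp n)).
have sle n m : le (s (m + n)) (s n).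
  elim: m => [|m IH]; first exact: le_refl. exact: (le_trans _ _ _ (sS _) IH).
exists (fun b => exists n, le (s n) b); split; last by exists 0; exact: le_refl.
split.
- by move=> b [n /le_p []].
- by exists a, 0; exact: le_refl.
- by move=> b c [n h] h'; exists n; exact: le_trans h'.
- move=> b c [n h] [m h']; exists (s (n + m)); split; first by exists (n + m); exact: le_refl.
  split; last exact: le_trans h'. apply: le_trans h; rewrite Nat.add_comm; exact: sle.
- move=> d hd; have [n En] := hen d; exists (s (S n)); split; last by exists (S n); exact: le_refl.
  move=> /=; rewrite En; case: excluded_middle_informative => // [[hs hd']].
  by have [] := epsilon_spec (inhabits a) (fun c => c ∈ d /\ le c (s n)) (hd' _ (sp n)).
Qed.

Section Truth.
Variables (G : M -> Prop) (N : structure) (v : M -> N).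
Hypothesis hG : gfilter G.
Hypothesis vsurj : forall y : N, exists x, y = v x.
Hypothesis veq : forall x y, v x = v y <-> exists a, G a /\ feq a x y.
Hypothesis vmem : forall x y, v x ∈ v y <-> exists a, G a /\ fmem a x y.

Lemma scons_v x e : scons (v x) (fun n => v (e n)) = (fun n => v (scons x e n)).
Proof. by apply: functional_extensionality; case. Qed.

(** Only the behaviour of [v] on atomic formulas is assumed, so the result serves both the quotient
    by a filter and any extension given in advance. *)
Lemma truth f : forall e, sat (fun n => v (e n)) f <-> exists a, G a /\ Forc f a e.
Proof.
have dF g e := dForc g (fun j e => e 0) (fun n j _ => e n) (DT_var 0) (fun n => DT_one _).
elim: f => [m n|m n|g IH|g IH h IH'|g IH] e /=.
- exact: vmem.
- exact: veq.
- rewrite IH; split=> [H|[a [Ga [a_p H]]] [b [Gb hb]]]; last first.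
    by have [c [Gc [h1 h2]]] := g_dir _ hG _ _ Ga Gb; apply: (H c h1); exact: forc_mono hb.
  have [a Ga] := g_ne _ hG.
  have [||c [Gc [_ [h|h]]]] := gfilter_below G (fun c => Forc g c e \/ Forc (FNot g) c e) a hG _ Ga.
  + by apply: Def_or; [exact: (dF g e)|exact: (dF (FNot g) e)].
  + move=> b hb; have [b_p _] := le_p _ _ hb.
    case: (classic (exists c, le c b /\ Forc g c e)) => [[c [h1 h2]]|h]; first by exists c; auto.
    exists b; split; first exact: le_refl.
    by right; split=> // c hc hg; apply: h; exists c.
  + by case: H; exists c.
  + by exists c.
- rewrite IH IH'; split=> [[[a [Ga ha]] [b [Gb hb]]]|[a [Ga [h1 h2]]]]; last by split; exists a.
  have [c [Gc [h1 h2]]] := g_dir _ hG _ _ Ga Gb; exists c; split=> //; split; [exact: forc_mono ha|exact: forc_mono hb].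
- split=> [H|[a [Ga [a_p h]]] y]; last first.
    by have [x ->] := vsurj y; rewrite scons_v IH; exists a.
  have [a Ga] := g_ne _ hG.
  have [||c [Gc [_ [h|[x h]]]]] := gfilter_below G
     (fun c => Forc (FAll g) c e \/ exists x, Forc (FNot g) c (scons x e)) a hG _ Ga.
  + apply: Def_or; first exact: (dF (FAll g) e).
    refine (Def_ex _ _); cbv beta.
    apply: (Def_ext (F := single M) (fun j e' => Forc (FNot g) (e' 1)
      (fun n => match n with O => e' 0 | S m => e m end))).
      move=> j e'; rewrite (_ : (fun n => match n with O => e' 0 | S m => e m end) = scons (e' 0) e) //.
    apply: (dForc (FNot g) (fun j e' => e' 1) (fun n j e' => match n with O => e' 0 | S m => e m end)).
      by df.
    by case=> [|n]; df.
  + move=> b hb; have [b_p _] := le_p _ _ hb.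
    case: (classic (exists c x, le c b /\ Forc (FNot g) c (scons x e))) => [[c [x [h1 h2]]]|h].
      by exists c; split=> //; right; exists x.
    exists b; split; first exact: le_refl.
    left; split=> // x; apply: forc_dense => // c hc.
    apply: NNPP => n; apply: h; exists c, x; split=> //; have [c_p _] := le_p _ _ hc; split=> // d hd hg.
    by apply: n; exists d.
  + by exists c.
  + have := H (v x); rewrite scons_v IH => -[b [Gb hb]].
    have [d [Gd [h1 h2]]] := g_dir _ hG _ _ Gc Gb.
    by case: h => _ /(_ d h1) []; exact: forc_mono hb.
Qed.
End Truth.

End Forcing.

(** * Transitive embeddings *)

Record tr_emb {M N : structure} (k : M -> N) : Prop := {
  emb_inj : forall x y, k x = k y -> x = y;
  emb_mem : forall x y, k x ∈ k y <-> x ∈ y;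
  emb_tr : forall x y, y ∈ k x -> exists x', y = k x'
}.

Section Emb.
Context {M N : structure} {HM : ZF M} {HN : ZF N} (k : M -> N) (hk : tr_emb k).
Implicit Types x y z a b f r s : M.

Lemma emb_in x (y : N) : y ∈ k x <-> exists x', x' ∈ x /\ y = k x'.
Proof.
split=> [h|[x' [h ->]]]; last exact/(emb_mem _ hk).
by have [x' E] := emb_tr _ hk _ _ h; subst y; exists x'; split=> //; apply/(emb_mem _ hk).
Qed.
Lemma emb_upair x y : k (upair x y) = upair (k x) (k y).
Proof.
apply: ext => z; rewrite emb_in in_upair; split=> [[w [/in_upair [->|->] ->]]|[->|->]]; auto.
  by exists x; rewrite in_upair; auto.
by exists y; rewrite in_upair; auto.
Qed.
Lemma emb_opair x y : k (opair x y) = opair (k x) (k y).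
Proof. by rewrite /opair !emb_upair. Qed.
Lemma emb_opair_inv z (u w : N) : k z = opair u w -> exists x y, z = opair x y /\ u = k x /\ w = k y.
Proof.
move=> E.
have h1 : upair u w ∈ k z by rewrite E in_upair; auto.
have [q Eq] := emb_tr _ hk _ _ h1.
have [x Ex] : exists x, u = k x by apply: (emb_tr _ hk q); rewrite -Eq in_upair; auto.
have [y Ey] : exists y, w = k y by apply: (emb_tr _ hk q); rewrite -Eq in_upair; auto.
exists x, y; split=> //; apply: (emb_inj _ hk); by rewrite emb_opair E Ex Ey.
Qed.
Lemma emb_rel r x y : rel (k r) (k x) (k y) <-> rel r x y.
Proof. by rewrite !relE -emb_opair (emb_mem _ hk). Qed.
Lemma emb_rel_inv r (u w : N) : rel (k r) u w -> exists x y, u = k x /\ w = k y /\ rel r x y.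
Proof.
move/relE/emb_in => [z [hz Ez]].
have [x [y [E [-> ->]]]] := emb_opair_inv _ _ _ (eq_sym Ez).
by exists x, y; rewrite relE -E.
Qed.
Lemma emb_sub x y : sub (k x) (k y) <-> sub x y.
Proof.
split=> h z; last by move/emb_in => [w [/h hw ->]]; apply/(emb_mem _ hk).
by move/(emb_mem _ hk)/h/(emb_mem _ hk).
Qed.
Lemma emb_sc x : k (sc x) = sc (k x).
Proof.
apply: ext => z; rewrite emb_in in_sc emb_in; split=> [[w [/in_sc [h|->] ->]]|[[w [h ->]]|->]].
- by left; exists w.
- by right.
- by exists w; rewrite in_sc; auto.
- by exists x; rewrite in_sc; auto.
Qed.
Lemma emb_nonempty x : nonempty (k x) <-> nonempty x.
Proof.
split=> [[z /emb_in [w [h _]]]|[z h]]; first by exists w.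
by exists (k z); apply/(emb_mem _ hk).
Qed.
Lemma emb_transitive x : transitive (k x) <-> transitive x.
Proof.
split=> h z.
  by move/(emb_mem _ hk)/h/emb_sub.
by move/emb_in=> [w [/h hw ->]]; apply/emb_sub.
Qed.
Lemma emb_ord x : is_ord (k x) <-> is_ord x.
Proof.
rewrite /is_ord emb_transitive; split=> -[h1 h2]; split=> // z.
  by move/(emb_mem _ hk)/h2/emb_transitive.
by move/emb_in=> [w [/h2 hw ->]]; apply/emb_transitive.
Qed.
Lemma emb_limit x : is_limit (k x) <-> is_limit x.
Proof.
rewrite /is_limit emb_ord emb_nonempty; split=> -[h1 [h2 h3]]; split=> //; split=> // z.
  move/(emb_mem _ hk)/h3 => [y [/emb_in [w [hw ->]] /(emb_mem _ hk) h]]; by exists w.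
move/emb_in=> [w [/h3 [y [hy hw]] ->]]; exists (k y); by split; apply/(emb_mem _ hk).
Qed.
Lemma emb_functional f : functional (k f) <-> functional f.
Proof.
split=> h x y y'.
  by move=> /emb_rel h1 /emb_rel h2; apply: (emb_inj _ hk); exact: h h1 h2.
move=> /emb_rel_inv [u [w [-> [-> h1]]]] /emb_rel_inv [u' [w' [/(emb_inj _ hk) <- [-> h2]]]].
by rewrite (h _ _ _ h1 h2).
Qed.
Lemma emb_rel_on f a b : rel_on (k f) (k a) (k b) <-> rel_on f a b.
Proof.
rewrite /rel_on; split=> h z.
  move/(emb_mem _ hk)/h => [x [y [/is_opairE /emb_opair_inv [u [w [-> [-> ->]]]] [h1 h2]]]].
  by exists u, w; rewrite is_opairE; split=> //; split; apply/(emb_mem _ hk).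
move/emb_in => [q [/h [x [y [/is_opairE -> [h1 h2]]]] ->]]; exists (k x), (k y).
by rewrite is_opairE emb_opair; split=> //; split; apply/(emb_mem _ hk).
Qed.
Lemma emb_is_fun f a b : is_fun (k f) (k a) (k b) <-> is_fun f a b.
Proof.
rewrite /is_fun emb_functional emb_rel_on; split=> -[h1 [h2 h3]]; split=> //; split=> // x.
  move/(emb_mem _ hk)/h3 => [y /emb_rel_inv [u [w [/(emb_inj _ hk) -> [_ h]]]]]; by exists w.
move/emb_in=> [u [/h3 [y hy] ->]]; exists (k y); exact/emb_rel.
Qed.
Lemma emb_injects a b : injects a b -> injects (k a) (k b).
Proof.
move=> [f [hf ji]]; exists (k f); split; first exact/emb_is_fun.
move=> x x' y /emb_rel_inv [u [w [-> [-> h1]]]] /emb_rel_inv [u' [w' [-> [/(emb_inj _ hk) E h2]]]].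
by subst w'; rewrite (ji _ _ _ h1 h2).
Qed.
Lemma emb_card_lt a b : card_lt a b -> card_lt (k a) (k b).
Proof.
by move=> [c [hc h]]; exists (k c); split; [apply/(emb_mem _ hk)|exact: emb_injects].
Qed.
(** Injections persist to the larger structure, so cardinals pass downwards; the larger one may have
    new injections. *)
Lemma emb_card a : is_card (k a) -> is_card a.
Proof.
move=> [/emb_ord oa h]; split=> // b hb hi; apply: (h (k b)); [exact/(emb_mem _ hk)|exact: emb_injects].
Qed.
End Emb.

Lemma emb_comp {M N K : structure} (i : M -> N) (j : N -> K) :
  tr_emb i -> tr_emb j -> tr_emb (fun x => j (i x)).
Proof.
move=> hi hj; split.
- by move=> x y /(emb_inj _ hj) /(emb_inj _ hi).
- by move=> x y; rewrite (emb_mem _ hj) (emb_mem _ hi).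
- move=> x y h; have [z E] := emb_tr _ hj _ _ h; subst y.
  by move/(emb_mem _ hj): h => /(emb_tr _ hi) [x' ->]; exists x'.
Qed.

Lemma gen_emb {V : structure} {p l : V} {N i G} : generic_extension V p l N i G -> tr_emb i.
Proof. by case=> *; split. Qed.

(** * The generic extension *)

Lemma Def_sat {M : structure} f : forall T : nat -> forall j, ev (single M) j -> M,
  (forall n, DT (single M) (T n)) -> Def (single M) (fun j e => sat (fun n => T n j e) f).
Proof.
elim: f => [m n|m n|g IH|g IH h IH'|g IH] T hT /=.
- exact: Def_mem.
- exact: Def_eq.
- exact/Def_not/IH.
- by apply: Def_and; [exact: IH|exact: IH'].
refine (Def_all _ _); cbv beta.
apply: (IH (fun n j e => match n with O => e 0 | S m => T m j (fun k => e (S k)) end)).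
by case=> [|n]; [df|exact: DT_shift].
Qed.

Section Check.
Context {M : structure} {HM : ZF M} (p : M).
Implicit Types x y z g n r : M.
Notation D := (Def (single M)).

Definition chkH x g := mk x (fun z => exists u v r, u ∈ x /\ rel g u v /\ r ∈ p /\ z = opair v r).
Lemma set_chkH x g : is_set (fun z => exists u v r, u ∈ x /\ rel g u v /\ r ∈ p /\ z = opair v r).
Proof.
apply: (is_set_sub (prod (un (un g)) p)); last by df.
by move=> z [u [v [r [_ [/rel_un2 [_ h] [hr ->]]]]]]; apply/opair_prod.
Qed.
Lemma dchkH : D (fun j e => e 0 = chkH (e 1) (e 2)).
Proof.
refine (Def_eq _ _ _ _); first by df.
apply: DT_mk => [j e|]; [exact: set_chkH|by df].
Qed.
Definition chk := recF chkH.
Lemma dchk : D (fun j e => e 0 = chk (e 1)).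
Proof. exact: dRecF dchkH. Qed.
Lemma rel_chk x n r : rel (chk x) n r <-> r ∈ p /\ exists y, y ∈ x /\ n = chk y.
Proof.
rewrite relE /chk (recF_eq _ dchkH) (in_mk _ _ (set_chkH _ _)) -/chk.
split=> [[u [v [s [hu [h [hs /opair_inj [-> ->]]]]]]]|[hr [y [hy ->]]]].
  split=> //; exists u; split=> //; by case/(rel_lam _ _ _ _ dchk): h.
exists y, (chk y), r; split=> //; split=> //; apply/(rel_lam _ _ _ _ dchk); split=> //; exact: sub_tc.
Qed.

Definition upn x y := prod (upair x y) p.
Definition onm x y := upn (upn x x) (upn x y).
End Check.

(** * The quotient of the names by a generic filter *)

Section Quotient.
Context {M : structure} {HM : ZFC M} (p l : M).
Hypothesis hp : is_poset p l.
Variable G : M -> Prop.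
Hypothesis hG : gfilter p l G.
Implicit Types x y z a b : M.

Definition eqv x y := exists a, G a /\ feq p l a x y.
(** Classes are represented by predicates, so that names forced equal by the filter become equal
    elements. *)
Definition quot : structure := Structure {S : M -> Prop | exists x, S = eqv x}
  (fun X Y => exists x y a, proj1_sig X x /\ proj1_sig Y y /\ G a /\ fmem p l a x y).
Definition qv x : quot := exist _ (eqv x) (ex_intro _ x eq_refl).

Lemma eqv_refl x : eqv x x.
Proof. by have [a Ga] := g_ne _ _ _ hG; exists a; split=> //; apply: feq_refl => //; exact: (g_sub _ _ _ hG). Qed.
Lemma eqv_sym x y : eqv x y -> eqv y x.
Proof. by move=> [a [Ga h]]; exists a; split=> //; exact: feq_sym. Qed.
Lemma eqv_trans x y z : eqv x y -> eqv y z -> eqv x z.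
Proof.
move=> [a [Ga h]] [b [Gb h']]; have [c [Gc [h1 h2]]] := g_dir _ _ _ hG _ _ Ga Gb; exists c; split=> //.
by apply: (feq_trans _ _ hp _ _ y); [exact: (feq_mono _ _ hp a)|exact: (feq_mono _ _ hp b)].
Qed.
Lemma qsurj (y : quot) : exists x, y = qv x.
Proof.
case: y => S [x E]; exists x; subst S; congr exist; exact: proof_irrelevance.
Qed.
Lemma qeq x y : qv x = qv y <-> exists a, G a /\ feq p l a x y.
Proof.
split=> [E|h].
  have: proj1_sig (qv x) y by rewrite E; exact: eqv_refl.
  by [].
have E : eqv x = eqv y.
  apply: functional_extensionality => z; apply: propositional_extensionality; split.
    by apply: eqv_trans; exact: eqv_sym.
  exact: eqv_trans.
rewrite /qv; move: (ex_intro _ x _) (ex_intro _ y _); rewrite E => h1 h2.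
congr exist; exact: proof_irrelevance.
Qed.
Lemma qmem x y : qv x ∈ qv y <-> exists a, G a /\ fmem p l a x y.
Proof.
split=> [[x' [y' [a [[b [Gb h1]] [[c [Gc h2]] [Ga h3]]]]]]|[a [Ga h]]]; last first.
  by exists x, y, a; split; [exact: eqv_refl|split; [exact: eqv_refl|]].
have [d [Gd [k1 k2]]] := g_dir _ _ _ hG _ _ Gb Gc.
have [e [Ge [k3 k4]]] := g_dir _ _ _ hG _ _ Ga Gd.
exists e; split=> //.
apply: (fmem_eqr _ _ hp e x y' y).
  by apply: feq_sym => //; apply: (feq_mono _ _ hp c) => //; exact: (le_trans _ _ hp _ d).
apply: (fmem_eql _ _ hp e x').
  by apply: feq_sym => //; apply: (feq_mono _ _ hp b) => //; exact: (le_trans _ _ hp _ d).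
exact: (fmem_mono _ _ hp a).
Qed.
End Quotient.

(** * Values of names and the axioms in the extension *)

Section Extension.
Context {M : structure} {HM : ZFC M} (p l : M).
Hypothesis hp : is_poset p l.
Hypothesis hc : countable M.
Implicit Types a b c d x y z w r s t n m : M.
Notation D := (Def (single M)).
Notation le a b := (rel l a b).

Section Values.
Variables (G : M -> Prop) (N : structure) (v : M -> N).
Hypothesis hG : gfilter p l G.
Hypothesis vsurj : forall y : N, exists x, y = v x.
Hypothesis veq : forall x y, v x = v y <-> exists a, G a /\ feq p l a x y.
Hypothesis vmem : forall x y, v x ∈ v y <-> exists a, G a /\ fmem p l a x y.
Implicit Types X Y Z : N.

Let tru := truth p l hp G N v hG vsurj veq vmem.

Lemma G_p a : G a -> a ∈ p. Proof. exact: (g_sub _ _ _ hG). Qed.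

Lemma vE y Z : Z ∈ v y <-> exists n r, rel y n r /\ G r /\ Z = v n.
Proof.
pose proof (dfeq p l) as dq.
have [x ->] := vsurj Z; split=> [/vmem [a [Ga [a_p h]]]|[n [r [h [Gr ->]]]]]; last first.
  apply/vmem; exists r; split=> //; apply: (fmem_intro _ _ hp r n y n r) => //.
    exact/(le_refl _ _ hp)/G_p.
  exact/(feq_refl _ _ hp)/G_p.
have [||c [Gc [_ [n [r [h1 [h2 h3]]]]]]] := gfilter_below p l hp G
  (fun c => exists n r, rel y n r /\ le c r /\ feq p l c x n) a hG _ Ga; first by df.
  move=> b /h [c [n [r [h1 [h2 [h3 h4]]]]]]; exists c; split=> //; by exists n, r.
exists n, r; split=> //; split; first exact: (g_up _ _ _ hG c).
by apply/veq; exists c.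
Qed.

Lemma vfull s Z : Z ∈ v (prod s p) <-> exists n, n ∈ s /\ Z = v n.
Proof.
rewrite vE; split=> [[n [r [/rel_prod [h _] [_ ->]]]]|[n [h ->]]]; first by exists n.
have [r Gr] := g_ne _ _ _ hG; exists n, r; rewrite rel_prod; split=> //; split=> //; exact: G_p.
Qed.

(** If no condition of the filter forces the names equal, genericity yields [c] in it and an active
    element of one name that no extension of [c] forces into the other; its value separates the two
    sets. *)
Lemma vext X Y : (forall Z, Z ∈ X <-> Z ∈ Y) -> X = Y.
Proof.
pose proof (dfeq p l) as dq; pose proof (dfmem p l) as dm.
have [x ->] := vsurj X; have [y ->] := vsurj Y => H.
pose S x y c := exists z r, rel x z r /\ le c r /\ forall b, le b c -> ~ fmem p l b z y.
have dS : D (fun j e => S (e 0) (e 1) (e 2)) by rewrite /S; df.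
have nS u w c : G c -> S u w c -> (forall Z, Z ∈ v u -> Z ∈ v w) -> False.
  move=> Gc [z [r [h1 [h2 h3]]]] K.
  have: v z ∈ v u by apply/vE; exists z, r; split=> //; split=> //; exact: (g_up _ _ _ hG c).
  move/K/vmem => [b [Gb h]]; have [d [Gd [k1 k2]]] := g_dir _ _ _ hG _ _ Gc Gb.
  by apply: (h3 d k1); exact: (fmem_mono _ _ hp b).
have [a Ga] := g_ne _ _ _ hG.
have [||c [Gc [_ [h|[h|h]]]]] := gfilter_below p l hp G
  (fun c => feq p l c x y \/ S x y c \/ S y x c) a hG _ Ga; first by df.
- move=> b hb; have [b_p _] := le_p _ _ hp _ _ hb.
  case: (classic (exists c, le c b /\ (S x y c \/ S y x c))) => [[c [h1 h2]]|n]; first by exists c; auto.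
  exists b; split; first exact: (le_refl _ _ hp).
  left; apply/(feqE _ _); split=> //; split=> z r c h1 h2 h3; apply: NNPP => K; apply: n; exists c; split=> //.
    left; exists z, r; split=> //; split=> // d hd [d_p /(_ d (le_refl _ _ hp _ d_p))].
    move=> [e [z' [r' [k1 [k2 [k3 k4]]]]]]; apply: K; exists e, z', r'; split=> //.
    by apply: (le_trans _ _ hp _ d) => //; exact: (le_trans _ _ hp _ d).
  right; exists z, r; split=> //; split=> // d hd [d_p /(_ d (le_refl _ _ hp _ d_p))].
  move=> [e [z' [r' [k1 [k2 [k3 k4]]]]]]; apply: K; exists e, z', r'; split.
    by apply: (le_trans _ _ hp _ d) => //; exact: (le_trans _ _ hp _ d).
  by split=> //; split=> //; exact: feq_sym.
- by apply/veq; exists c.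
- by case: (nS _ _ _ Gc h) => Z /H.
- by case: (nS _ _ _ Gc h) => Z /H.
Qed.

(** By the truth lemma the subset is named by the pairs [(n, r)] such that [r] forces both [n] into
    [a] and the formula. *)
Lemma vsep (f : formula) (e : nat -> N) (A : N) :
  exists B, forall X, X ∈ B <-> X ∈ A /\ sat (scons X e) f.
Proof.
have [a ->] := vsurj A.
have [e0 He] : exists e0, e = fun k : nat => v (e0 k).
  exists (fun k : nat => epsilon (inhabits a) (fun x => e k = v x)); apply: functional_extensionality => n.
  exact: (epsilon_spec (inhabits a) _ (vsurj (e n))).
pose proof (dfmem p l) as dm.
have dF : D (fun j e => Forc p l f (e 1) (scons (e 0) e0)).
  apply: (dForc _ _ f (fun j e => e 1) (fun (n : nat) j e => match n with O => e 0 | S m => e0 m end)).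
    by df.
  by case=> [|n]; df.
have [|b [_ rb]] := relset (fun n r => fmem p l r n a /\ Forc p l f r (scons n e0)) (tc a) p; first by df.
exists (v b) => X; rewrite vE; split=> [[n [r [/rb [_ [_ [h1 h2]]] [Gr ->]]]]|[/vE [n [r [h1 [Gr ->]]]]]].
  split; first by apply/vmem; exists r.
  by rewrite He scons_v tru; exists r.
rewrite He scons_v tru => -[c [Gc hc1]].
have [d [Gd [k1 k2]]] := g_dir _ _ _ hG _ _ Gc Gr.
exists n, d; split=> //; apply/rb; split; first by case: (rel_tc _ _ _ h1).
split; first exact: G_p.
split; last exact: (forc_mono _ _ hp f c).
apply: (fmem_intro _ _ hp d n a n r) => //; exact/(feq_refl _ _ hp)/G_p.
Qed.

Lemma vset_sub A (P : N -> Prop) : (forall X, P X -> X ∈ A) ->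
  Def (single N) (fun j e => P (e 0)) -> is_set P.
Proof. exact: (sep_is_set N vsep). Qed.

(** Ill-foundedness of the ground model rules out arguing with ranks of values from outside. If [a]
    forces that the set named by [x] has no minimal element, then induction on names inside the
    ground model shows that no [b] below [a] forces any [z] into [x]. *)
Lemma vfound X : nonempty X -> exists Y, Y ∈ X /\ forall Z, Z ∈ X -> Z ∉ Y.
Proof.
have [x ->] := vsurj X => -[Y hY]; apply: NNPP => nmin.
pose f := FAll (FNot (FAnd (FMem 0 1) (FAll (FNot (FAnd (FMem 0 2) (FMem 0 1)))))).
have fE (K : structure) (e : nat -> K) :
    sat e f <-> forall Y : K, Y ∈ e 0 -> exists Z : K, Z ∈ e 0 /\ Z ∈ Y.
  split=> [H Y' hY'|H Y' /= [h1 h2]].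
    apply: NNPP => n; apply: (H Y'); split=> // Z [h1 h2]; apply: n; by exists Z.
  by have [Z hZ] := H Y' h1; apply: (h2 Z).
have [a [Ga ha]] : exists a, G a /\ Forc p l f a (fun _ => x).
  apply/tru/fE => Y' hY'; apply: NNPP => n; apply: nmin; exists Y'; split=> // Z h1 h2.
  by apply: n; exists Z.
have K : forall z b, le b a -> ~ fmem p l b z x.
  pose proof (dfmem p l) as dm.
  apply: tc_ind; first by df.
  move=> z IH b hb h; have [b_p _] := le_p _ _ hp _ _ hb.
  (* The induction ranges over all [b] below [a], and the given filter need not contain [b]; an
     auxiliary quotient by a filter through [b] is used. *)
  have [G' [hG' Gb]] := gfilter_exists p l hp b hc b_p.
  have tr' := truth p l hp G' (quot p l G') (qv p l G') hG' (qsurj p l G')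
    (qeq p l hp G' hG') (qmem p l hp G' hG').
  have: sat (fun _ => qv p l G' x) f.
    by apply/tr'; exists a; split=> //; exact: (g_up _ _ _ hG' b).
  move/fE/(_ (qv p l G' z)) => [|Z [h1 h2]]; first by apply/(qmem _ _ hp _ hG'); exists b.
  have [w EZ] := qsurj p l G' Z; subst Z.
  move/(qmem _ _ hp _ hG'): h2 => [c [Gc [c_p hcm]]].
  pose proof (dfeq p l) as dq.
  have [||d [Gd [_ [n [r [k1 [k2 k3]]]]]]] := gfilter_below p l hp G'
    (fun c => exists n r, rel z n r /\ le c r /\ feq p l c w n) c hG' _ Gc; first by df.
    by move=> d /hcm [d' [n [r [? [? [? ?]]]]]]; exists d'; split=> //; exists n, r.
  move/(qmem _ _ hp _ hG'): h1 => [g [Gg hg]].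
  have [g1 [Gg1 [i1 i2]]] := g_dir _ _ _ hG' _ _ Gd Gg.
  have [g2 [Gg2 [i3 i4]]] := g_dir _ _ _ hG' _ _ Gg1 Gb.
  apply: (IH n _ g2); first by case: (rel_tc _ _ _ k1).
    exact: (le_trans _ _ hp _ b).
  apply: (fmem_eql _ _ hp g2 w); last by apply: (fmem_mono _ _ hp g) => //; exact: (le_trans _ _ hp _ g1).
  by apply: (feq_mono _ _ hp d) => //; exact: (le_trans _ _ hp _ g1).
have [y Ey] := vsurj Y; move: hY; rewrite Ey => /vmem [b [Gb hb]].
have [c [Gc [h1 h2]]] := g_dir _ _ _ hG _ _ Ga Gb.
by apply: (K y c h1); exact: (fmem_mono _ _ hp b).
Qed.

Definition ck x := v (chk p x).
Lemma in_ck x Z : Z ∈ ck x <-> exists y, y ∈ x /\ Z = ck y.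
Proof.
rewrite vE; split=> [[n [r [/rel_chk [hr [y [hy ->]]] [_ ->]]]]|[y [hy ->]]]; first by exists y.
have [r Gr] := g_ne _ _ _ hG; exists (chk p y), r; split=> //.
by apply/rel_chk; split; [exact: G_p|exists y].
Qed.

Lemma chk_feq x : forall y a, feq p l a (chk p x) (chk p y) -> x = y.
Proof.
pose proof (dfeq p l) as dq; pose proof (dchk p) as dk.
move: x; apply: eps_ind; first by df.
move=> x IH y a /(feqE _ _) [a_p [h1 h2]]; have ra := le_refl _ _ hp _ a_p.
apply: ext => z; split=> hz.
  have [|c [z' [r' [k1 [k2 [k3 k4]]]]]] := h1 (chk p z) a a _ ra ra.
    by apply/rel_chk; split=> //; exists z.
  by move/rel_chk: k2 => [_ [w [hw E]]]; subst z'; rewrite (IH z hz _ _ k4).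
have [|c [z' [r' [k1 [k2 [k3 k4]]]]]] := h2 (chk p z) a a _ ra ra.
  by apply/rel_chk; split=> //; exists z.
by move/rel_chk: k2 => [_ [w [hw E]]]; subst z'; rewrite -(IH w hw _ _ k4).
Qed.
Lemma ck_inj x y : ck x = ck y -> x = y.
Proof. by move/veq => [a [_ h]]; exact: chk_feq h. Qed.

Lemma ck_emb : tr_emb ck.
Proof.
split; first exact: ck_inj.
- move=> x y; rewrite in_ck; split=> [[z [hz /ck_inj ->]]//|h]; by exists x.
- by move=> x Y /in_ck [z [_ ->]]; exists z.
Qed.

(** Union, power set and replacement only require a bounding set, from which [vset_sub] cuts out the
    right one. Subsets of a set named by [x] have names inside [prod (tc x) p]; for replacement,
    collection in the ground model bounds the names of the values. *)
Lemma vZF : ZF N.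
Proof.
constructor.
- exact: vext.
- exact: vfound.
- move=> X Y; have [x ->] := vsurj X; have [y ->] := vsurj Y.
  exists (v (prod (upair x y) p)) => W; rewrite vfull; split=> [[n [/in_upair [->|->] ->]]|[->|->]]; auto.
    by exists x; rewrite in_upair; auto.
  by exists y; rewrite in_upair; auto.
- move=> X; have [x Ex] := vsurj X; apply: (vset_sub (v (prod (tc x) p))); last by df.
  move=> Z [Y [hY hZ]]; subst X; move/vE: hY => [n [r [h1 [_ E]]]]; subst Y.
  move/vE: hZ => [m [s [h2 [_ ->]]]]; apply/vfull; exists m; split=> //.
  apply: (tc_mono n); [by case: (rel_tc _ _ _ h1)|by case: (rel_tc _ _ _ h2)].
- move=> X; have [x Ex] := vsurj X; apply: (vset_sub (v (prod (pw (prod (tc x) p)) p))); last by df.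
  move=> Z hZ; have [z Ez] := vsurj Z.
  pose proof (dfmem p l) as dm.
  have [|s [os rs]] := relset (fun n r => fmem p l r n z) (tc x) p; first by df.
  apply/vfull; exists s; split; first by apply/in_pw; exact/rel_onE.
  apply: vext => W; rewrite [in X in _ <-> X]vE; split=> [hW|[n [r [/rs [_ [_ h]] [Gr ->]]]]]; last first.
    by rewrite Ez; apply/vmem; exists r.
  move: (hZ _ hW); rewrite Ex => /vE [n [r [h1 [_ E]]]]; subst W.
  move: hW; rewrite Ez => /vmem [a [Ga h]].
  exists n, a; split=> //; apply/rs; split; first by case: (rel_tc _ _ _ h1).
  by split=> //; exact: G_p.
- have [w [[o [ho no]] hs]] := zf_inf M (ZFC_ZF M HM).
  exists (ck w); split; first exists (ck o).
    split; first by apply/in_ck; exists o.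
    by move=> [Z /in_ck [y [hy _]]]; apply: no; exists y.
  move=> X /in_ck [x [/hs [y [hy hsu]] ->]]; exists (ck y); split; first by apply/in_ck; exists y.
  move=> W; rewrite !in_ck; split=> [[z [/hsu [h|->] ->]]|[[z [h ->]]|->]]; [|by right| |].
  + by left; exists z.
  + by exists z; split=> //; apply/hsu; auto.
  + by exists x; split=> //; apply/hsu; auto.
- exact: vsep.
- move=> f e A hfun; have [a Ea] := vsurj A.
  have [e0 He] : exists e0, e = fun k : nat => v (e0 k).
    exists (fun k : nat => epsilon (inhabits a) (fun x => e k = v x)); apply: functional_extensionality => n.
    exact: (epsilon_spec (inhabits a) _ (vsurj (e n))).
  have [|Y hY] := collection (fun q y => exists n r, q = opair n r /\ Forc p l f r (scons n (scons y e0)))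
    (prod (tc a) p).
    df; apply: (dForc _ _ f (fun j e => e 0)
      (fun (n : nat) j e => match n with O => e 1 | S O => e 3 | S (S m) => e0 m end)).
      by df.
    by case=> [|[|n]]; df.
  apply: (vset_sub (v (prod Y p))).
    move=> Z [X [hX hs]]; have [z Ez] := vsurj Z; move: (hX); rewrite Ea => /vE [n [r [h1 [Gr Ex]]]].
    move: (hs); rewrite Ez Ex He !scons_v => /tru [b [Gb hb]].
    have [||y [hy [n' [b' [/opair_inj [En Eb] hF]]]]] := hY (opair n b).
    + by apply/opair_prod; split; [case: (rel_tc _ _ _ h1)|exact: G_p].
    + by exists z, n, b.
    apply/vfull; exists y; split=> //; subst n' b'; rewrite -Ez; apply: (hfun X _ _ hX hs).
    by rewrite Ex He !scons_v; apply/tru; exists b.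
  df; refine (Def_sat (M := N) f (fun (n : nat) j e' => scons (e' 0) (scons (e' 1) e) n) _).
  by case=> [|[|n]] /=; df.
Qed.

Lemma v_upn x y : v (upn p x y) = @upair N (v x) (v y).
Proof.
have HN := vZF; apply: ext => Z; rewrite vfull in_upair; split=> [[n [/in_upair [->|->] ->]]|[->|->]]; auto.
  by exists x; rewrite in_upair; auto.
by exists y; rewrite in_upair; auto.
Qed.
Lemma v_onm x y : v (onm p x y) = @opair N (v x) (v y).
Proof. by rewrite /onm !v_upn. Qed.

(** Brings the evaluation of a set of names into the extension, as a relation between ground-model
    elements and values. *)
Lemma v_graph (R : M -> M -> Prop) s t : D (fun j e => R (e 0) (e 1)) ->
  exists W : N, forall U Y, rel W U Y <-> exists x y, x ∈ s /\ y ∈ t /\ R x y /\ U = ck x /\ Y = v y.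
Proof.
have HN := vZF => dR; pose proof (dchk p) as dk.
have [b hb] : is_set (fun z => exists q, q ∈ prod s t /\ exists x y, q = opair x y /\ R x y /\ z = onm p (chk p x) y).
  apply: is_set_repl; first by rewrite /onm /upn; df.
  by move=> q z z' _ [x [y [-> [_ ->]]]] [x' [y' [/opair_inj [<- <-] [_ ->]]]].
exists (v (prod b p)) => U Y; rewrite relE vfull; split=> [[n [/hb [q [hq [x [y [E [hR ->]]]]]] ]]|].
  rewrite v_onm => /opair_inj [-> ->]; subst q; move/opair_prod: hq => [hx hy].
  by exists x, y.
move=> [x [y [hx [hy [hR [-> ->]]]]]]; exists (onm p (chk p x) y); rewrite v_onm; split=> //.
by apply/hb; exists (opair x y); rewrite opair_prod; split=> //; exists x, y.
Qed.

(** A well-ordering of the names in [tc a] indexes all elements of members of [A] by ordinals; the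
    selector takes from each member its element of least index. *)
Lemma vZFC : ZFC N.
Proof.
have HN := vZF; case: (HN) => *; constructor=> //.
move=> A hne hdis; have [a Ea] := vsurj A.
have [al [f [oal [[onf [ff tf]] [jf sf]]]]] := well_order (tc a).
have [|W hW] := v_graph (fun x y => rel f x y) al (tc a); first by df.
have Wf : functional W.
  move=> U Y Y' /hW [x [y [_ [_ [h [-> ->]]]]]] /hW [x' [y' [_ [_ [h' [/ck_inj E ->]]]]]].
  by subst x'; rewrite (ff _ _ _ h h').
have oA : is_ord (ck al) by apply/(emb_ord _ ck_emb).
have ex X Y : X ∈ A -> Y ∈ X -> exists U, U ∈ ck al /\ rel W U Y.
  rewrite Ea => /vE [n [r [h1 [_ ->]]]] /vE [m [s [h2 [_ ->]]]].
  have hm : m ∈ tc a by apply: (tc_mono n); [case: (rel_tc _ _ _ h1)|case: (rel_tc _ _ _ h2)].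
  have [x hx] := sf m hm; have [hx1 _] := rel_onP _ _ _ _ _ onf hx.
  by exists (ck x); split; [apply/in_ck; exists x|apply/hW; exists x, m].
pose Q X Y := X ∈ A /\ Y ∈ X /\ exists U, U ∈ ck al /\ rel W U Y /\
  forall U' Y', U' ∈ U -> rel W U' Y' -> Y' ∉ X.
have [C hC] : is_set (fun Y => Y ∈ un A /\ exists X, Q X Y) by apply: is_set_sep; rewrite /Q; df.
exists C => X hX; have [Y0 hY0] := hne X hX.
have [U0 [hU0 hW0]] := ex X Y0 hX hY0.
have [|U [oU [[hU [Y [hY hWY]]] lU]]] := ord_least (fun U => U ∈ ck al /\ exists Y, Y ∈ X /\ rel W U Y) U0 _
  (ord_in _ _ oA hU0) (conj hU0 (ex_intro _ Y0 (conj hY0 hW0))); first by df.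
exists Y; split.
  split=> //; apply/hC; split; first by apply/in_un; exists X.
  exists X; split=> //; split=> //; exists U; split=> //; split=> // U' Y' h1 h2 h3.
  by apply: (lU U' h1); split; [exact: (proj1 oA U)|exists Y'].
move=> Y' [hY' /hC [_ [X' [hX' [hYX' [U' [hU' [hWU' lU']]]]]]]].
have E := hdis X X' Y' hX hX' hY' hYX'; subst X'.
have oU' := ord_in _ _ oA hU'.
case: (ord_tri U U' oU oU') => [h|[E|h]].
- by case: (lU' U Y h hWY).
- by subst U'; exact: Wf hWY hWU'.
- by case: (lU U' h); split=> //; exists Y'.
Qed.

Lemma v_generic : exists Gn : N, (forall a, ck a ∈ Gn <-> G a) /\
  generic_extension M p l N ck Gn /\ forall t, is_val Gn (ck t) (v t).
Proof.
have HN := vZF; pose proof (dchk p) as dk.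
have [g0 hg0] : is_set (fun z => exists a, a ∈ p /\ z = opair (chk p a) a).
  by apply: (is_set_img p (fun a => opair (chk p a) a)); df.
have hGn Z : Z ∈ v g0 <-> exists a, G a /\ Z = ck a.
  rewrite vE; split=> [[n [r [/relE /hg0 [a [_ /opair_inj [-> ->]]] [Gr ->]]]]|[a [Ga ->]]].
    by exists a.
  exists (chk p a), a; split=> //; apply/relE/hg0; exists a; split=> //; exact: G_p.
have ckG a : ck a ∈ v g0 <-> G a.
  rewrite hGn; split=> [[b [Gb /ck_inj ->]]//|Ga]; by exists a.
have val t : is_val (v g0) (ck t) (v t).
  have [|f hf] := v_graph (fun x y => x = y) (tc (upair t t)) (tc (upair t t)); first by df.
  have hf' U Y : rel f U Y <-> exists n, n ∈ tc (upair t t) /\ U = ck n /\ Y = v n.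
    rewrite hf; split=> [[x [y [hx [hy [<- h]]]]]|[n [h1 h2]]]; first by exists x.
    by exists n, n.
  exists f; split; last split.
  - by move=> U Y Y' /hf' [n [_ [-> ->]]] /hf' [n' [_ [/ck_inj -> ->]]].
  - by apply/hf'; exists t; split=> //; apply: sub_tc; rewrite in_sing.
  move=> U Y /hf' [n [hn [-> ->]]]; split.
    move=> m' a' _ /(emb_rel_inv _ ck_emb) [m [a [-> [_ h]]]]; exists (v m); apply/hf'; exists m; split=> //.
    by apply: (tc_mono n) => //; case: (rel_tc _ _ _ h).
  move=> Z; rewrite vE; split=> [[m [r [h1 [Gr ->]]]]|[m' [a' [/hGn [a [Ga ->]] [h1 /hf' [m [hm [E ->]]]]]]]].
    exists (ck m), (ck r); split; first exact/ckG.
    split; first exact/(emb_rel _ ck_emb).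
    apply/hf'; exists m; split=> //; by apply: (tc_mono n) => //; case: (rel_tc _ _ _ h1).
  by subst m'; exists m, a; split=> //; apply/(emb_rel _ ck_emb).
exists (v g0); split=> //; split=> //; have E := ck_emb; split.
- exact: vZFC.
- exact: ck_inj.
- exact: (emb_mem _ E).
- exact: (emb_tr _ E).
- by move=> Z /hGn [a [Ga ->]]; apply/(emb_mem _ E); exact: G_p.
- by have [a Ga] := g_ne _ _ _ hG; exists (ck a); apply/ckG.
- by move=> a b /ckG Ga h; apply/ckG; exact: (g_up _ _ _ hG a).
- move=> a b /ckG Ga /ckG Gb; have [c [Gc h]] := g_dir _ _ _ hG _ _ Ga Gb; exists c; split=> //; exact/ckG.
- move=> d /(g_dense _ _ _ hG) [a [h Ga]]; exists a; split=> //; exact/ckG.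
- by move=> Y; have [t ->] := vsurj Y; exists t.
Qed.
End Values.

Theorem generic_extension_of_filter G : gfilter p l G -> exists N i Gn,
  generic_extension M p l N i Gn /\ forall a, i a ∈ Gn <-> G a.
Proof.
move=> hG; have [Gn [h1 [h2 _]]] := v_generic G (quot p l G) (qv p l G) hG (qsurj p l G)
  (qeq p l hp G hG) (qmem p l hp G hG).
by exists (quot p l G), (ck (quot p l G) (qv p l G)), Gn.
Qed.

Corollary generic_extension_exists a : a ∈ p -> exists N i Gn,
  generic_extension M p l N i Gn /\ i a ∈ Gn.
Proof.
move=> ha; have [G [hG Ga]] := gfilter_exists p l hp a hc ha.
have [N [i [Gn [h1 h2]]]] := generic_extension_of_filter G hG.
by exists N, i, Gn; split=> //; apply/h2.
Qed.

End Extension.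

(** * Values of names in an arbitrary generic extension *)

Section Val.
Context {N : structure} {HN : ZF N} (g : N).
Implicit Types x y z n a r f t : N.
Notation D := (Def (single N)).

Definition vlH x r := mk x (fun y => exists n a, a ∈ g /\ rel x n a /\ rel r n y).
Lemma set_vlH x r : is_set (fun y => exists n a, a ∈ g /\ rel x n a /\ rel r n y).
Proof.
by apply: (is_set_sub (un (un r))) => [y [n [a [_ [_ /rel_un2 []]]]]|] //; df.
Qed.
Lemma dvlH : D (fun j e => e 0 = vlH (e 1) (e 2)).
Proof.
refine (Def_eq _ _ _ _); first by df.
apply: DT_mk => [j e|]; [exact: set_vlH|by df].
Qed.
Definition vl := recF vlH.
Lemma dvl : D (fun j e => e 0 = vl (e 1)).
Proof. exact: dRecF dvlH. Qed.
Lemma in_vl x z : z ∈ vl x <-> exists n a, a ∈ g /\ rel x n a /\ z = vl n.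
Proof.
rewrite /vl (recF_eq _ dvlH) (in_mk _ _ (set_vlH _ _)) -/vl.
split=> -[n [a [h1 [h2 h3]]]]; exists n, a; split=> //; split=> //.
  by case/(rel_lam _ _ _ _ dvl): h3.
by apply/(rel_lam _ _ _ _ dvl); split=> //; case: (rel_tc _ _ _ h2).
Qed.
(** Any witness for [is_val] agrees with the total recursion by induction inside [N]; from here on a
    value is the term [vl]. *)
Lemma is_valE t y : is_val g t y <-> y = vl t.
Proof.
split=> [[f [ff [h hf]]]|->].
  suff K : forall x w, rel f x w -> w = vl x by exact: K.
  pose proof dvl as dv; apply: tc_ind; first by df.
  move=> x IH w hw; have [h1 h2] := hf _ _ hw; apply: ext => z; rewrite h2 in_vl.
  split=> -[n [a [k1 [k2 k3]]]]; exists n, a; split=> //; split=> //; have [hn _] := rel_tc _ _ _ k2.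
    exact: IH.
  by have [z' hz'] := h1 n a k1 k2; rewrite k3 -(IH n hn z').
exists (lam (tc (upair t t)) vl); pose proof dvl as dv; split; first exact: lam_functional.
split; first by apply/rel_lam => //; split=> //; apply: sub_tc; rewrite in_sing.
move=> x w /rel_lam - /(_ dv) [hx ->].
have cl n a : rel x n a -> rel (lam (tc (upair t t)) vl) n (vl n).
  move=> h; apply/rel_lam => //; split=> //; apply: (tc_mono x) => //; by case: (rel_tc _ _ _ h).
split=> [n a _ /cl h|z]; first by exists (vl n).
rewrite in_vl; split=> -[n [a [k1 [k2 k3]]]]; exists n, a; split=> //; split=> //.
  by rewrite k3; exact: cl k2.
by case/rel_lam: k3.
Qed.
End Val.

(** * The truth lemma in an arbitrary given extension *)

Section ExtTruth.
Context {V : structure} {HV : ZFC V} (p l : V) (hp : is_poset p l).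
Context (N : structure) (i : V -> N) (G : N) (hN : generic_extension V p l N i G).
Implicit Types a b c x y z w n r s t : V.
Implicit Types X Y Z U W : N.
#[local] Instance ext_zfc : ZFC N := gen_zfc _ _ _ _ _ _ hN.
Let hi : tr_emb i := gen_emb hN.
Notation le a b := (rel l a b).

Definition inG a := i a ∈ G.
Definition nv t := vl G (i t).

Lemma inG_filter : gfilter p l inG.
Proof.
case: (hN) => ? ? ? ? hs hne hup hdir hgen ?; split.
- by move=> a /hs /(emb_mem _ hi).
- by case: hne => Z hZ; have [a Ea] := emb_tr _ hi _ _ (hs _ hZ); exists a; rewrite /inG -Ea.
- exact: hup.
- exact: hdir.
- exact: hgen.
Qed.
Let hG := inG_filter.

Lemma in_nv y Z : Z ∈ nv y <-> exists n r, rel y n r /\ inG r /\ Z = nv n.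
Proof.
rewrite in_vl; split=> [[n' [a' [ha [/(emb_rel_inv _ hi) [n [a [E1 [E2 h]]]] ->]]]]|[n [r [h [hr ->]]]]].
  by subst n' a'; exists n, a.
by exists (i n), (i r); split=> //; split=> //; apply/(emb_rel _ hi).
Qed.

Lemma nv_surj Y : exists t, Y = nv t.
Proof. by have [t /is_valE h] := gen_names _ _ _ _ _ _ hN Y; exists t. Qed.

(** A condition forcing neither difference, nor having an extension that does, forces equality by
    the back-and-forth; hence the alternatives are dense. *)
Lemma inG_decide x y : let S x y c := exists z r, rel x z r /\ le c r /\ forall b, le b c -> ~ fmem p l b z y in
  exists c, inG c /\ (feq p l c x y \/ S x y c \/ S y x c).
Proof.
move=> S; pose proof (dfeq p l) as dq; pose proof (dfmem p l) as dm.
have dS : Def (single V) (fun j e => S (e 0) (e 1) (e 2)) by rewrite /S; df.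
have [a Ga] := g_ne _ _ _ hG.
have [||c [Gc [_ h]]] := gfilter_below p l hp inG
  (fun c => feq p l c x y \/ S x y c \/ S y x c) a hG _ Ga; first by df.
  move=> b hb; have [b_p _] := le_p _ _ hp _ _ hb.
  case: (classic (exists c, le c b /\ (S x y c \/ S y x c))) => [[c [h1 h2]]|n]; first by exists c; auto.
  exists b; split; first exact: (le_refl _ _ hp).
  left; apply/(feqE _ _); split=> //; split=> z r c h1 h2 h3; apply: NNPP => K; apply: n; exists c; split=> //.
    left; exists z, r; split=> //; split=> // d hd [d_p /(_ d (le_refl _ _ hp _ d_p))].
    move=> [e [z' [r' [k1 [k2 [k3 k4]]]]]]; apply: K; exists e, z', r'; split=> //.
    by apply: (le_trans _ _ hp _ d) => //; exact: (le_trans _ _ hp _ d).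
  right; exists z, r; split=> //; split=> // d hd [d_p /(_ d (le_refl _ _ hp _ d_p))].
  move=> [e [z' [r' [k1 [k2 [k3 k4]]]]]]; apply: K; exists e, z', r'; split.
    by apply: (le_trans _ _ hp _ d) => //; exact: (le_trans _ _ hp _ d).
  by split=> //; split=> //; exact: feq_sym.
by exists c.
Qed.

Lemma nv_eq x y : nv x = nv y <-> exists a, inG a /\ feq p l a x y.
Proof.
pose proof (dfeq p l) as dq; pose proof (dvl G) as dv.
pose T := tc (upair x x); pose T' := tc (upair y y).
have [|e0 [_ re]] := relset (fun a q => exists z w, q = opair z w /\ feq p l a z w) p (prod T T'); first by df.
have re' a z w : z ∈ T -> w ∈ T' -> rel e0 a (opair z w) <-> feq p l a z w.
  move=> hz hw; rewrite re opair_prod; split=> [[_ [_ [z' [w' [/opair_inj [<- <-]]]]]]//|h].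
  split; first exact: feq_p h. by split=> //; exists z, w.
suff K : forall U, U ∈ i T -> forall W, W ∈ i T' ->
    (vl G U = vl G W <-> exists A, A ∈ G /\ rel (i e0) A (opair U W)).
  have hx : x ∈ T by apply: sub_tc; rewrite in_sing.
  have hy : y ∈ T' by apply: sub_tc; rewrite in_sing.
  rewrite /nv K; try exact/(emb_mem _ hi).
  split=> [[A [hA]]|[a [Ga h]]]; last first.
    exists (i a); split=> //; rewrite -(emb_opair _ hi); apply/(emb_rel _ hi); exact/re'.
  rewrite -(emb_opair _ hi) => /(emb_rel_inv _ hi) [a [q [E [/(emb_inj _ hi) <- /(re' _ _ _ hx hy) h]]]].
  by exists a; rewrite /inG -E.
apply: tc_ind; first by df.
move=> U IH hU W hW.
have [z Ez] := emb_tr _ hi _ _ hU; have [w Ew] := emb_tr _ hi _ _ hW; subst U W.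
move/(emb_mem _ hi): (hU) => hz; move/(emb_mem _ hi): (hW) => hw.
have IH' n n' r r' : rel z n r -> rel w n' r' -> nv n = nv n' <-> exists a, inG a /\ feq p l a n n'.
  move=> h h'; have hn : n ∈ T by apply: (tc_mono z) => //; case: (rel_tc _ _ _ h).
  have hn' : n' ∈ T' by apply: (tc_mono w) => //; case: (rel_tc _ _ _ h').
  rewrite /nv IH; try exact/(emb_mem _ hi); last first.
    by move/(emb_rel _ hi): h => /rel_tc [].
  split=> [[A [hA]]|[a [Ga k]]]; last first.
    exists (i a); split=> //; rewrite -(emb_opair _ hi); apply/(emb_rel _ hi); exact/re'.
  rewrite -(emb_opair _ hi) => /(emb_rel_inv _ hi) [a [q [E [/(emb_inj _ hi) <- /(re' _ _ _ hn hn') k]]]].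
  by exists a; rewrite /inG -E.
suff: nv z = nv w <-> exists a, inG a /\ feq p l a z w.
  move=> ->; split=> [[a [Ga h]]|[A [hA]]].
    exists (i a); split=> //; rewrite -(emb_opair _ hi); apply/(emb_rel _ hi); exact/re'.
  rewrite -(emb_opair _ hi) => /(emb_rel_inv _ hi) [a [q [E [/(emb_inj _ hi) <- /(re' _ _ _ hz hw) h]]]].
  by exists a; rewrite /inG -E.
split=> [E|[a [Ga /(feqE _ _) [_ [h1 h2]]]]].
  have [c [Gc [h|[[n [r [h1 [h2 h3]]]]|[n [r [h1 [h2 h3]]]]]]]] := inG_decide z w; first by exists c.
    have : nv n ∈ nv w by rewrite -E; apply/in_nv; exists n, r; split=> //; split=> //; exact: (g_up _ _ _ hG c).
    move/in_nv=> [n' [r' [k1 [Gr' /(IH' _ _ _ _ h1 k1) [a [Ga k2]]]]]].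
    have [d [Gd [i1 i2]]] := g_dir _ _ _ hG _ _ Gc Ga; have [d' [Gd' [i3 i4]]] := g_dir _ _ _ hG _ _ Gd Gr'.
    case: (h3 d'); first exact: (le_trans _ _ hp _ d).
    apply: (fmem_intro _ _ hp d' n w n' r') => //.
    by apply: (feq_mono _ _ hp a) => //; exact: (le_trans _ _ hp _ d).
  have : nv n ∈ nv z by rewrite E; apply/in_nv; exists n, r; split=> //; split=> //; exact: (g_up _ _ _ hG c).
  move/in_nv=> [n' [r' [k1 [Gr' En]]]]; have [a [Ga k2]] := proj1 (IH' _ _ _ _ k1 h1) (eq_sym En).
  have [d [Gd [i1 i2]]] := g_dir _ _ _ hG _ _ Gc Ga; have [d' [Gd' [i3 i4]]] := g_dir _ _ _ hG _ _ Gd Gr'.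
  case: (h3 d'); first exact: (le_trans _ _ hp _ d).
  apply: (fmem_intro _ _ hp d' n z n' r') => //.
  by apply: feq_sym; apply: (feq_mono _ _ hp a) => //; exact: (le_trans _ _ hp _ d).
apply: ext => Z; rewrite !in_nv; split=> -[n [r [k1 [Gr ->]]]].
  have [b [Gb [j1 j2]]] := g_dir _ _ _ hG _ _ Ga Gr.
  have [||c [Gc [_ [n' [r' [k2 [k3 k4]]]]]]] := gfilter_below p l hp inG
    (fun c => exists n' r', rel w n' r' /\ le c r' /\ feq p l c n n') b hG _ Gb; first by df.
    move=> b' hb'; have [c [n' [r' [? [? [? ?]]]]]] := h1 n r b' k1 (le_trans _ _ hp _ _ _ hb' j1)
      (le_trans _ _ hp _ _ _ hb' j2); exists c; split=> //; by exists n', r'.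
  exists n', r'; split=> //; split; first exact: (g_up _ _ _ hG c).
  by apply/(IH' _ _ _ _ k1 k2); exists c.
have [b [Gb [j1 j2]]] := g_dir _ _ _ hG _ _ Ga Gr.
have [||c [Gc [_ [n' [r' [k2 [k3 k4]]]]]]] := gfilter_below p l hp inG
  (fun c => exists n' r', rel z n' r' /\ le c r' /\ feq p l c n' n) b hG _ Gb; first by df.
  move=> b' hb'; have [c [n' [r' [? [? [? ?]]]]]] := h2 n r b' k1 (le_trans _ _ hp _ _ _ hb' j1)
    (le_trans _ _ hp _ _ _ hb' j2); exists c; split=> //; by exists n', r'.
exists n', r'; split=> //; split; first exact: (g_up _ _ _ hG c).
by symmetry; apply/(IH' _ _ _ _ k2 k1); exists c.
Qed.

Lemma nv_mem x y : nv x ∈ nv y <-> exists a, inG a /\ fmem p l a x y.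
Proof.
pose proof (dfeq p l) as dq.
rewrite in_nv; split=> [[n [r [h [Gr /nv_eq [a [Ga k]]]]]]|[a [Ga [a_p h]]]].
  have [b [Gb [j1 j2]]] := g_dir _ _ _ hG _ _ Ga Gr; exists b; split=> //.
  apply: (fmem_intro _ _ hp b x y n r) => //; exact: (feq_mono _ _ hp a).
have [||c [Gc [_ [n' [r' [k2 [k3 k4]]]]]]] := gfilter_below p l hp inG
  (fun c => exists n' r', rel y n' r' /\ le c r' /\ feq p l c x n') a hG _ Ga; first by df.
  by move=> b /h [c [n' [r' [? [? [? ?]]]]]]; exists c; split=> //; exists n', r'.
exists n', r'; split=> //; split; first exact: (g_up _ _ _ hG c).
by apply/nv_eq; exists c.
Qed.

Lemma nv_truth f e : sat (fun k : nat => nv (e k)) f <-> exists a, inG a /\ Forc p l f a e.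
Proof. exact: (truth p l hp inG N nv hG nv_surj nv_eq nv_mem). Qed.

(** As for equality, the map to check names enters [N] through a set of [V], its graph [C] on a
    transitive closure. *)
Lemma nv_chk x : nv (chk p x) = i x.
Proof.
pose proof (dchk p) as dk; pose proof (dvl G) as dv.
pose T := tc (upair x x); pose C := lam T (chk p).
have hC z : z ∈ T -> rel (i C) (i z) (i (chk p z)) by move=> hz; apply/(emb_rel _ hi)/rel_lam.
suff K : forall U, U ∈ i T -> forall W, rel (i C) U W -> vl G W = U.
  have hx : x ∈ T by apply: sub_tc; rewrite in_sing.
  by apply: K; [apply/(emb_mem _ hi)|exact: hC].
apply: eps_ind; first by df.
move=> U IH hU W /(emb_rel_inv _ hi) [z [w [EU [-> /rel_lam - /(_ dk) [hz ->]]]]]; subst U.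
apply: ext => Z; rewrite -/(nv _) in_nv (emb_in _ hi).
have sub_z y : y ∈ z -> y ∈ T by exact: (tc_trans _ z).
split=> [[n [r [/rel_chk [_ [y [hy ->]]] [_ ->]]]]|[y [hy ->]]].
  by exists y; split=> //; apply: IH; [exact/(emb_mem _ hi)|exact/(emb_mem _ hi)/sub_z|exact/hC/sub_z].
have [a Ga] := g_ne _ _ _ hG; exists (chk p y), a; split; last split=> //.
  by apply/rel_chk; split; [exact: (g_sub _ _ _ hG)|exists y].
by symmetry; apply: IH; [exact/(emb_mem _ hi)|exact/(emb_mem _ hi)/sub_z|exact/hC/sub_z].
Qed.

(** Names are translated by replacing each condition [a] with all [y] such that [rel R y a]; the new
    filter then evaluates the translation as the old one evaluates the original. *)
Lemma change_forcing (p' l' R : V) (G' : N) : sub G' (i p') -> nonempty G' ->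
  (forall a b, i a ∈ G' -> rel l' a b -> i b ∈ G') ->
  (forall a b, i a ∈ G' -> i b ∈ G' -> exists c, i c ∈ G' /\ rel l' c a /\ rel l' c b) ->
  (forall d, is_dense p' l' d -> exists a, a ∈ d /\ i a ∈ G') ->
  (forall a, i a ∈ G <-> exists y, i y ∈ G' /\ rel R y a) ->
  generic_extension V p' l' N i G'.
Proof.
move=> h1 h2 h3 h4 h5 hR; split=> //; [exact: ext_zfc|exact: (emb_inj _ hi)|exact: (emb_mem _ hi)|exact: (emb_tr _ hi)|].
move=> Y; have [t ->] := nv_surj Y.
pose H x g := mk x (fun z => exists n a v y, rel x n a /\ rel g n v /\ rel R y a /\ z = opair v y).
have sH x g : is_set (fun z => exists n a v y, rel x n a /\ rel g n v /\ rel R y a /\ z = opair v y).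
  apply: (is_set_sub (prod (un (un g)) (un (un R)))); last by df.
  by move=> z [n [a [v [y [_ [/rel_un2 [_ k1] [/rel_un2 [k2 _] ->]]]]]]]; apply/opair_prod.
have dH : Def (single V) (fun j e => e 0 = H (e 1) (e 2)).
  refine (Def_eq _ _ _ _); first by df.
  by apply: DT_mk => [j e|]; [exact: sH|df].
pose tr := recF H; pose proof (dRecF _ dH : Def (single V) (fun j e => e 0 = tr (e 1))) as dtr.
have rel_tr x m y : rel (tr x) m y <-> exists n a, rel x n a /\ rel R y a /\ m = tr n.
  rewrite relE /tr (recF_eq _ dH) (in_mk _ _ (sH _ _)) -/tr.
  split=> [[n [a [v [y' [k1 [/(rel_lam _ _ _ _ dtr) [_ ->] [k3 /opair_inj [-> ->]]]]]]]]|[n [a [k1 [k2 ->]]]]].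
    by exists n, a.
  exists n, a, (tr n), y; split=> //; split=> //; apply/(rel_lam _ _ _ _ dtr); split=> //.
  by case: (rel_tc _ _ _ k1).
exists (tr t); apply/is_valE; symmetry.
pose T := tc (upair t t); pose C := lam T tr.
pose proof (dvl G) as dv; pose proof (dvl G') as dv'.
have hC z : z ∈ T -> rel (i C) (i z) (i (tr z)) by move=> hz; apply/(emb_rel _ hi)/rel_lam.
suff K : forall U, U ∈ i T -> forall W, rel (i C) U W -> vl G' W = vl G U.
  have ht : t ∈ T by apply: sub_tc; rewrite in_sing.
  by apply: K; [apply/(emb_mem _ hi)|exact: hC].
apply: tc_ind; first by df.
move=> U IH hU W /(emb_rel_inv _ hi) [z [w [EU [-> /rel_lam - /(_ dtr) [hz ->]]]]]; subst U.
have IH' n a : rel z n a -> vl G' (i (tr n)) = nv n.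
  move=> k; have hn : n ∈ T by apply: (tc_mono z) => //; case: (rel_tc _ _ _ k).
  by apply: IH; [move/(emb_rel _ hi): k => /rel_tc []|exact/(emb_mem _ hi)|exact: hC].
apply: ext => Z; rewrite -/(nv _) in_nv in_vl; split.
  move=> [m' [y' [hy' [/(emb_rel_inv _ hi) [m [y [E1 [E2 /rel_tr [n [a [k1 [k2 k3]]]]]]]] ->]]]]; subst m' y' m.
  exists n, a; split=> //; split; first by apply/hR; exists y.
  exact: IH' k1.
move=> [n [a [k1 [/hR [y [hy k2]] ->]]]]; exists (i (tr n)), (i y); split=> //.
split; last by rewrite (IH' n a).
by apply/(emb_rel _ hi)/rel_tr; exists n, a.
Qed.

End ExtTruth.

(** * Definability of forcing *)

Record gext (V : structure) (p l : V) := Gext {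
  gN : structure; gi : V -> gN; gG : gN; gH : generic_extension V p l gN gi gG }.
Arguments gN {V p l} _. Arguments gi {V p l} _ _. Arguments gG {V p l} _. Arguments gH {V p l} _.

(** An admissible parameter is a section with one ground-model name throughout, so a formula
    expresses one statement about all generic extensions. *)
Definition gfam (V : structure) (p l : V) : fam :=
  Fam (gext V p l) gN (fun c => exists t : V, forall j, is_val (gG j) (gi j t) (c j)).
Arguments gfam : simpl never.

#[export] Instance gfam_zf (V p l : _) : famZF (gfam V p l).
Proof. move=> j; exact: (ZFC_ZF _ (gen_zfc _ _ _ _ _ _ (gH j))). Qed.

Section Transfer.
Context {V : structure} {HV : ZFC V} (hcV : countable V) (p l : V) (hp : is_poset p l).
Implicit Types a b c x y z t : V.
Notation F := (gfam V p l).

Lemma gext_zfc (j : gext V p l) : ZFC (gN j).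
Proof. exact: (gen_zfc _ _ _ _ _ _ (gH j)). Qed.

Lemma ok_gi x : ok F (fun j => gi j x).
Proof.
exists (chk p x) => j; have HN := gext_zfc j; apply/is_valE.
by rewrite -/(nv _ _ _ _) (nv_chk p l _ _ _ (gH j)).
Qed.
Lemma ok_gG : ok F (fun j => gG j).
Proof.
pose proof (dchk p) as dk.
have [g0 hg0] : is_set (fun z => exists a, a ∈ p /\ z = opair (chk p a) a).
  by apply: (is_set_img p (fun a => opair (chk p a) a)); df.
exists g0 => j; have HN := gext_zfc j; apply/is_valE.
apply: ext => Z; rewrite -/(nv _ _ _ _) (in_nv _ _ _ _ _ (gH j)); split=> [hZ|].
  have [a Ea] := emb_tr _ (gen_emb (gH j)) _ _ (gen_sub _ _ _ _ _ _ (gH j) _ hZ); subst Z.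
  exists (chk p a), a; rewrite (nv_chk p l _ _ _ (gH j)); split=> //; apply/relE/hg0; exists a; split=> //.
  exact: (g_sub _ _ _ (inG_filter _ _ _ _ _ (gH j)) a).
move=> [n [r [/relE /hg0 [a [_ /opair_inj [-> ->]]] [h ->]]]].
by rewrite (nv_chk p l _ _ _ (gH j)).
Qed.

Lemma gforce_aux P : Def F P -> exists f (E : (nat -> V) -> nat -> V),
  (forall j e, P j (fun k => gi j (e k)) <-> exists a, gi j a ∈ gG j /\ Forc p l f a (E e)) /\
  Def (single V) (fun j e => Forc p l f (e 0) (E (fun k => e (S k)))).
Proof.
case/(_ (ex_intro _ _ ok_gG)) => f [q [hq hf]].
pose t k := epsilon (inhabits p) (fun t => forall j, is_val (gG j) (gi j t) (q k j)).
have ht k j : q k j = nv _ (gi j) (gG j) (t k).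
  by have HN := gext_zfc j; apply/is_valE; exact: (epsilon_spec (inhabits p) _ (hq k)).
exists f, (fun e => mix (fun k => chk p (e k)) t); split.
  move=> j e; rewrite -(hf j) -(nv_truth p l hp _ _ _ (gH j)).
  rewrite (_ : mix _ _ = fun n => nv _ (gi j) (gG j) (mix (fun k => chk p (e k)) t n)) //.
  apply: functional_extensionality => n; rewrite /mix; case: (Nat.even n); last exact: ht.
  by rewrite (nv_chk p l _ _ _ (gH j)).
pose proof (dchk p) as dk.
apply: (dForc _ _ f (fun j e => e 0) (fun n j e => mix (fun k => chk p (e (S k))) t n)); first by df.
by move=> n; rewrite /mix; case: (Nat.even n); df.
Qed.

Definition gforces (P : forall j, ev F j -> Prop) a (e : nat -> V) : Prop :=
  forall j, gi j a ∈ gG j -> P j (fun k => gi j (e k)).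

Lemma gext_exists a : a ∈ p -> exists j : gext V p l, gi j a ∈ gG j.
Proof.
move=> ha; have [N [i [G [h1 h2]]]] := generic_extension_exists p l hp hcV a ha.
by exists (Gext _ _ _ N i G h1).
Qed.

(** Countability enters here: every condition lies in the filter of some extension, so a statement
    true in all extensions whose filter contains [a] is forced densely below [a], hence by [a]. *)
Lemma gforcesE P : Def F P -> exists f (E : (nat -> V) -> nat -> V),
  (forall j e, P j (fun k => gi j (e k)) <-> exists a, gi j a ∈ gG j /\ Forc p l f a (E e)) /\
  (forall a e, a ∈ p -> gforces P a e <-> Forc p l f a (E e)) /\
  Def (single V) (fun j e => Forc p l f (e 0) (E (fun k => e (S k)))).
Proof.
move=> /gforce_aux [f [E [h1 h2]]]; exists f, E; split=> //; split=> // a e ha; split=> [H|h j hj]; last first.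
  by apply/h1; exists a.
apply: (forc_dense _ _ hp) => // b hb; have [b_p _] := le_p _ _ hp _ _ hb.
have [j hj] := gext_exists b b_p.
have hG := inG_filter _ _ _ _ _ (gH j).
have [c [Gc hc]] := proj1 (h1 j e) (H j (g_up _ _ _ hG b a hj hb)).
have [d [Gd [k1 k2]]] := g_dir _ _ _ hG b c hj Gc.
by exists d; split=> //; exact: (forc_mono _ _ hp f c).
Qed.

(** The purpose of families of models: a quantification over all generic extensions becomes
    definable in the ground model. *)
Lemma dgforces P : Def F P -> Def (single V) (fun j e => gforces P (e 0) (fun k => e (S k))).
Proof.
move=> /gforcesE [f [E [h1 [h2 h3]]]].
apply: (Def_ext (F := single V) (fun j e => e 0 ∈ p -> Forc p l f (e 0) (E (fun k => e (S k))))).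
  move=> j e; split=> [h j' hj'|h hp']; last exact/h2.
  have ha : e 0 ∈ p by exact: (g_sub _ _ _ (inG_filter _ _ _ _ _ (gH j')) (e 0)).
  by apply: (proj2 (h2 _ _ ha)) => //; exact: h.
by apply: Def_imp => //; df.
Qed.

Lemma gforces_truth P (j : gext V p l) e : Def F P -> P j (fun k => gi j (e k)) ->
  exists a, gi j a ∈ gG j /\ gforces P a e.
Proof.
move=> /gforcesE [f [E [h1 [h2 h3]]]] /h1 [a [Ga h]]; exists a; split=> //.
by apply/h2 => //; exact: forc_p h.
Qed.
End Transfer.

#[export] Existing Instance gext_zfc.

(** Reduced evaluation, meant for names of subsets of a ground-model set: first coordinates are
    taken as they are instead of being evaluated in turn. *)
Definition sval {N : structure} (g T : N) : N := mk g (fun Z => exists R, R ∈ g /\ rel T Z R).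
Lemma set_sval {N : structure} {HN : ZF N} (g T : N) : is_set (fun Z => exists R, R ∈ g /\ rel T Z R).
Proof. by apply: (is_set_sub (un (un T))) => [Z [R [_ /rel_un2 []]]|] //; df. Qed.
Lemma in_sval {N : structure} {HN : ZF N} (g T Z : N) : Z ∈ sval g T <-> exists R, R ∈ g /\ rel T Z R.
Proof. exact: (in_mk _ _ (set_sval g T)). Qed.

Lemma DT_vl {F : fam} {HF : famZF F} t u : DT F t -> DT F u -> DT F (fun j e => vl (t j e) (u j e)).
Proof.
apply: (DT_app2 (fun j x y => vl x y)).
apply: (Def_ext (fun j e => is_val (e 1) (e 2) (e 0))); last by df.
by move=> j e; have := HF j => ?; rewrite is_valE.
Qed.
Lemma DT_sval {F : fam} {HF : famZF F} t u : DT F t -> DT F u -> DT F (fun j e => sval (t j e) (u j e)).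
Proof.
apply: (DT_app2 (fun j x y => sval x y)); refine (Def_eq _ _ _ _); first by df.
by apply: DT_mk => [j e|]; [have := HF j => ?; exact: set_sval|df].
Qed.
Lemma DT_gG {V : structure} {HV : ZFC V} {p l : V} : DT (gfam V p l) (fun j e => gG j).
Proof. exact: (DT_ok _ (ok_gG p l)). Qed.
Lemma DT_gi {V : structure} {HV : ZFC V} {p l : V} (x : V) : DT (gfam V p l) (fun j e => gi j x).
Proof. exact: (DT_ok _ (ok_gi p l x)). Qed.

Ltac df_names ::= lazymatch goal with
  | |- DT _ (fun j e => vl _ _) => refine (DT_vl _ _ _ _)
  | |- DT _ (fun j e => sval _ _) => refine (DT_sval _ _ _ _)
  | |- DT (gfam _ _ _) (fun j e => gG j) => exact DT_gG
  | |- DT (gfam _ _ _) (fun j e => gi j ?x) => exact (DT_gi x)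
  end.

(** * Strategically closed posets *)

Section Stages.
Context {M : structure} {HM : ZF M}.
Implicit Types a b c d s x y z g : M.

Lemma ord_cases a : is_ord a -> ~ nonempty a \/ (exists b, a = sc b) \/ is_limit a.
Proof.
move=> oa; case: (classic (nonempty a)) => [ne|]; last by auto.
right; case: (classic (is_limit a)) => [|nl]; first by auto.
left; apply: NNPP => ns; apply: nl; split=> //; split=> // x hx; apply: NNPP => n; apply: ns; exists x.
apply: ext => y; rewrite in_sc; split=> [hy|[hy|->]//]; last exact: (proj1 oa x).
case: (ord_tri y x (ord_in _ _ oa hy) (ord_in _ _ oa hx)) => [|[|h]]; auto.
by case: n; exists y.
Qed.

Lemma limit_not_sc b : ~ is_limit (sc b).
Proof.
move=> [_ [_ /(_ b)]]; case; first by rewrite in_sc; auto.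
by move=> y [/in_sc [h|->] h']; [case: (mem_asym _ _ h h')|case: (mem_irr _ h')].
Qed.

Lemma ord_mem_sc_or a b : is_ord b -> a ∈ b -> sc a ∈ b \/ sc a = b.
Proof.
move=> ob hab; have oa := ord_in _ _ ob hab.
case: (ord_tri (sc a) b (ord_sc _ oa) ob) => [|[|/in_sc [h|E]]]; auto.
  by case: (mem_asym _ _ hab h).
by subst b; case: (mem_irr _ hab).
Qed.

(** The membership condition refers to the set being defined, at earlier stages only; it is resolved
    by a recursion that codes truth values as nonempty and empty sets. *)
Lemma stages_exist d : is_ord d -> exists s, second_player_stages s d.
Proof.
move=> od.
pose H x g := mk x (fun z => z = x /\ (is_limit x \/ exists c, is_succ x c /\ ~ nonempty (ap g c))).
have sH x g : is_set (fun z => z = x /\ (is_limit x \/ exists c, is_succ x c /\ ~ nonempty (ap g c))).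
  by apply: set_the => y y' [-> _] [-> _].
have dH : Def (single M) (fun j e => e 0 = H (e 1) (e 2)).
  refine (Def_eq _ _ _ _); first by df.
  by apply: DT_mk => [j e|]; [exact: sH|df].
pose F := recF H; pose proof (dRecF _ dH : Def (single M) (fun j e => e 0 = F (e 1))) as dF.
have HF x : nonempty (F x) <-> is_limit x \/ exists c, is_succ x c /\ ~ nonempty (F c).
  have K c : is_succ x c -> ap (lam (tc x) F) c = F c.
    by move=> hc; apply: ap_lam => //; apply: sub_tc; apply/hc; auto.
  rewrite {1}/F (recF_eq _ dH) -/F; split=> [[z /(in_mk _ _ (sH _ _)) [_ [h|[c [h1 h2]]]]]|h]; auto.
    by right; exists c; split=> //; rewrite -K.
  exists x; apply/(in_mk _ _ (sH _ _)); split=> //; case: h => [|[c [h1 h2]]]; auto.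
  by right; exists c; split=> //; rewrite K.
have [s hs] : is_set (fun b => b ∈ sc d /\ nonempty (F b)) by apply: is_set_sep; df.
exists s => b; rewrite hs HF in_sc; split=> -[h1 [h2|[c [h2 h3]]]]; split=> //; auto; right; exists c; split=> //.
  by move/hs => [_ /h3].
move=> h4; apply: h3; apply/hs; split=> //; rewrite in_sc; left.
have hcb : c ∈ b by apply/h2; auto.
by case: h1 => [h1|<-//]; exact: (proj1 od b).
Qed.

Lemma stages_unique s s' d : is_ord d -> second_player_stages s d -> second_player_stages s' d -> s = s'.
Proof.
move=> od h h'; apply: ext; apply: eps_ind; first by df.
move=> b IH; rewrite h h'; split=> -[h1 [h2|[c [h2 h3]]]]; split=> //; auto; right; exists c; split=> //.
  by rewrite -IH //; apply/h2; auto.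
by rewrite IH //; apply/h2; auto.
Qed.
End Stages.

Lemma emb_stages {M N : structure} {HM : ZF M} {HN : ZF N} (k : M -> N) (hk : tr_emb k) (s d : M) :
  second_player_stages s d -> second_player_stages (k s) (k d).
Proof.
move=> h B; split=> [/(emb_in _ hk) [b [/h [h1 h2] ->]]|[h1 h2]].
  split; first by case: h1 => [h1|->]; [left; apply/(emb_mem _ hk)|right].
  case: h2 => [h2|[c [/is_succE h2 h3]]]; first by left; apply/(emb_limit _ hk).
  right; exists (k c); split; first by apply/is_succE; rewrite h2 (emb_sc _ hk).
  by move/(emb_mem _ hk).
have [b Eb] : exists b, B = k b by case: h1 => [/(emb_tr _ hk)//|->]; exists d.
subst B; apply/(emb_mem _ hk)/h; split.
  by case: h1 => [/(emb_mem _ hk) h1|/(emb_inj _ hk) h1]; auto.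
case: h2 => [/(emb_limit _ hk)|[C [h2 h3]]]; first by auto.
have [c Ec] : exists c, C = k c by apply: (emb_tr _ hk b); apply/h2; auto.
subst C; right; exists c; split; last by move/(emb_mem _ hk).
by apply/is_succE; apply: (emb_inj _ hk); rewrite (emb_sc _ hk); apply/is_succE.
Qed.

(** * Distributivity from a strategy *)

Section Distributive.
Context {M : structure} {HM : ZFC M}.
Implicit Types a b c d f g x y z u v p q : M.
Variables (P l s h d : M).
Hypothesis hP : is_poset P l.
Hypothesis od : is_ord d.
Hypothesis hs : second_player_stages s d.
Hypothesis fh : functional h.
Hypothesis hh : forall a f, a ∈ s -> play_following P l s h f a ->
  exists x, rel h f x /\ x ∈ P /\ forall b y, rel f b y -> rel l x y.
Variables (Q b0 e : M) (T : M -> M -> Prop).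
Hypothesis hb0 : b0 ∈ d.
Hypothesis he : is_fun e Q b0.
Hypothesis je : forall x x' y, rel e x y -> rel e x' y -> x = x'.
Hypothesis dT : Def (single M) (fun j e => T (e 0) (e 1)).
Hypothesis Tdense : forall p x, p ∈ Q -> x ∈ P -> exists y, rel l y x /\ T p y.
Hypothesis Topen : forall p x y, T p x -> rel l y x -> T p y.

Let leP := le_p P l hP.
Let leR := le_refl P l hP.
Let leT := le_trans P l hP.

(* The task with index [v] is carried out at stage [v] if the first player moves
   there, and at the next stage otherwise. *)
Definition at_stage v p := p ∈ Q /\ (rel e p v \/ exists u, is_succ v u /\ rel e p u).

Lemma task v x : x ∈ P -> exists y, rel l y x /\ forall p, p ∈ Q -> rel e p v -> T p y.
Proof.
move=> hx; case: (classic (exists p, p ∈ Q /\ rel e p v)) => [[p [hp hv]]|n].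
  have [y [h1 h2]] := Tdense p x hp hx; exists y; split=> // p' _ hv'.
  by rewrite (je _ _ _ hv' hv).
exists x; split; first exact: leR.
by move=> p hp hv; case: n; exists p.
Qed.

(** Recursion builds a play with last stage [b0]: [h] answers at the stages in [s], and elsewhere a
    choice function picks a lower bound of the play so far that performs the tasks due. As [b0] is
    in [d], the strategy covers the whole play, and openness carries all tasks down to the last move
    [F b0]. *)
Theorem strategic_distributive : exists x, x ∈ P /\ forall p, p ∈ Q -> T p x.
Proof.
have [x0 hx0] : nonempty P by case: hP.
have [ch [fch hch]] := choice_fun (pw P).
have ob0 := ord_in _ _ od hb0.
pose A v g x := x ∈ P /\ (forall u y, rel g u y -> rel l x y) /\ forall p, at_stage v p -> T p x.
pose Ph v g y := (v ∈ s /\ y = ap h g) \/ (v ∉ s /\ exists r, (forall x, x ∈ r <-> A v g x) /\ y = ap ch r).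
have uPh v g y y' : Ph v g y -> Ph v g y' -> y = y'.
  move=> [[h1 ->]|[h1 [r [hr ->]]]] [[h1' ->]|[h1' [r' [hr' ->]]]] //.
  by congr ap; apply: ext => x; rewrite hr hr'.
pose H v g := the v (Ph v g).
have dH : Def (single M) (fun j e => e 0 = H (e 1) (e 2)).
  refine (Def_eq _ _ _ _); first by df.
  by apply: DT_the => [j e' y y'|]; [exact: uPh|rewrite /Ph /A /at_stage; df].
pose F := recF H; pose proof (dRecF _ dH : Def (single M) (fun j e => e 0 = F (e 1))) as dF.
have FE v y : is_ord v -> Ph v (lam v F) y -> F v = y.
  move=> ov hy; rewrite /F (recF_eq _ dH) ord_tc // -/F.
  by apply: the_eq => // y' hy'; exact: uPh hy' hy.
pose good v := F v ∈ P /\ (forall u, u ∈ v -> rel l (F v) (F u)) /\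
  (v ∉ s -> forall p, at_stage v p -> T p (F v)) /\ (v ∈ s -> rel h (lam v F) (F v)).
have dlam : Def (single M) (fun j e => e 0 = lam (e 1) F).
  refine (Def_eq _ _ _ _); first by df.
  by apply: DT_mk => [j e'|]; [exact: set_lam|df].
have G v : v ∈ sc b0 -> good v.
  move=> hv; have ov : is_ord v by apply: (ord_in (sc b0)) => //; exact: ord_sc.
  move: v ov hv.
  apply: (ord_ind (fun v => v ∈ sc b0 -> good v)); first by rewrite /good /at_stage; df.
  move=> v ov IH hv; have ind u : u ∈ v -> good u.
    by move=> hu; apply: IH => //; exact: (proj1 (ord_sc _ ob0) v).
  have hvd : v ∈ d by move/in_sc: hv => [hv|->//]; exact: (proj1 od b0).
  have rl u y : rel (lam v F) u y <-> u ∈ v /\ y = F u by exact: rel_lam.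
  have pl : play_following P l s h (lam v F) v.
    split; last split.
    - split; last split.
      + by apply/rel_onE => z /(in_lam _ _ _ dF) [u [hu ->]]; apply/opair_prod; split=> //; case: (ind u hu).
      + exact: lam_functional.
      + by move=> u hu; exists (F u); apply/rl.
    - by move=> b c x y hbc /rl [hb ->] /rl [hc ->]; case: (ind c hc) => _ [k _]; exact: k.
    - move=> b hb hbs; exists (lam b F), (F b); split; last split.
      + apply/is_restrictionE; apply: ext => z; rewrite in_restr !in_lam //; split.
          move=> [u [hu ->]]; have huv : u ∈ v by exact: (proj1 ov b).
          by split; [exists u|exists u, (F u)].
        by move=> [[u [hu ->]] [u' [y [/opair_inj [<- _] hub]]]]; exists u.
      + by case: (ind b hb) => _ [_ [_ k]]; exact: k.
      + exact/rl.
  case: (classic (v ∈ s)) => hvs.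
    have [x [k1 [k2 k3]]] := hh v (lam v F) hvs pl.
    have E : F v = x by apply: FE => //; left; split=> //; rewrite (ap_eq _ _ _ fh k1).
    rewrite /good E; split=> //; split=> [u hu|]; last by split.
    by apply: (k3 u); apply/rl.
  have [r hr] : is_set (A v (lam v F)) by apply: (is_set_sub P) => [x []//|]; rewrite /A /at_stage; df.
  have ner : nonempty r.
    (* Limits lie in [s], so the stage is zero or a successor, and in the latter case the previous
       move bounds the whole play. *)
    have [x1 [hx1 [below sv]]] : exists x1, x1 ∈ P /\ (forall u, u ∈ v -> rel l x1 (F u)) /\
        ((exists u, is_succ v u) -> exists u, v = sc u).
      case: (ord_cases v ov) => [n|[[u Eu]|lv]].
      - by exists x0; split=> //; split; [move=> u hu; case: n; exists u|move=> [u /is_succE ->]; exists u].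
      - have hu : u ∈ v by rewrite Eu in_sc; auto.
        have [k1 [k2 _]] := ind u hu.
        exists (F u); split=> //; split=> [u'|_]; last by exists u.
        by rewrite Eu in_sc => -[hu'|->]; [exact: k2|exact: leR].
      - by case: hvs; apply/hs; split; auto.
    have [y1 [k1 k2]] := task v x1 hx1.
    have [hy1 _] := leP _ _ k1.
    have [y2 [k3 k4]] : exists y2, rel l y2 y1 /\ forall u p, is_succ v u -> p ∈ Q -> rel e p u -> T p y2.
      case: (classic (exists u, is_succ v u)) => [[u /is_succE Eu]|n].
        have [y2 [k3 k4]] := task u y1 hy1; exists y2; split=> // u' p /is_succE Eu' hp hpu.
        by apply: k4 => //; rewrite (sc_inj u u') // -Eu.
      by exists y1; split; [exact: leR|move=> u p hu; case: n; exists u].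
    exists y2; apply/hr; split; first by case: (leP _ _ k3).
    split=> [u y /rl [hu ->]|p [hp [h1|[u [h1 h2]]]]].
    - by apply: leT k3 _; apply: leT k1 _; exact: below.
    - by apply: Topen k3; exact: k2.
    - exact: k4 h1 hp h2.
  have [|y [hy /hr [k1 [k2 k3]]]] := hch r _ ner; first by apply/in_pw => x /hr [].
  have E : F v = y by apply: FE => //; right; split=> //; exists r; rewrite (ap_eq _ _ _ fch hy).
  rewrite /good E; split=> //; split=> [u hu|]; first by apply: (k2 u); apply/rl.
  by split.
have hb : b0 ∈ sc b0 by rewrite in_sc; auto.
have [k1 [k2 _]] := G b0 hb.
exists (F b0); split=> // p hp.
have [_ [_ /(_ p hp) [v hv]]] := he.
have [_ hvb] := rel_onP _ _ _ _ _ (proj1 he) hv.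
have le_b u : u ∈ sc b0 -> rel l (F b0) (F u) by rewrite in_sc => -[/k2//|->]; exact: leR.
case: (classic (v ∈ s)) => hvs; last first.
  have hv' : v ∈ sc b0 by rewrite in_sc; auto.
  have [_ [_ [k3 _]]] := G v hv'.
  by apply: (Topen p (F v)); [apply: k3 => //; split; auto|exact: le_b].
(* A task whose index [v] is a stage of the second player is due at [sc v], which is still at most
   [b0] because [v] is below [b0]. *)
have hv' : sc v ∈ sc b0 by rewrite [sc v ∈ _]in_sc; exact: ord_mem_sc_or.
have [_ [_ [k3 _]]] := G (sc v) hv'.
apply: (Topen p (F (sc v))); last exact: le_b.
apply: k3.
  move/hs => [_ [/limit_not_sc//|[c [/is_succE /sc_inj E hc]]]]; by subst c.
by split=> //; right; exists v; rewrite is_succE.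
Qed.
End Distributive.

(** * Two-step iterations with a small first factor *)

Section GextFacts.
Context {V : structure} {HV : ZFC V} {p l : V} (hp : is_poset p l) (j : gext V p l).
Implicit Types a b c r : V.
Lemma j_emb : tr_emb (gi j). Proof. exact: gen_emb (gH j). Qed.
Lemma j_up a b : gi j a ∈ gG j -> rel l a b -> gi j b ∈ gG j.
Proof. exact: gen_upward (gH j) a b. Qed.
Lemma j_dir a b : gi j a ∈ gG j -> gi j b ∈ gG j -> exists c, gi j c ∈ gG j /\ rel l c a /\ rel l c b.
Proof. exact: gen_directed (gH j) a b. Qed.
Lemma j_p a : gi j a ∈ gG j -> a ∈ p.
Proof. by move=> h; exact: (g_sub _ _ _ (inG_filter _ _ _ _ _ (gH j)) a). Qed.
Lemma j_ne : exists a, gi j a ∈ gG j.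
Proof. exact: (g_ne _ _ _ (inG_filter _ _ _ _ _ (gH j))). Qed.
Lemma j_below (Dn : V -> Prop) a : Def (single V) (fun j e => Dn (e 0)) -> gi j a ∈ gG j ->
  (forall b, rel l b a -> exists c, rel l c b /\ Dn c) -> exists c, gi j c ∈ gG j /\ rel l c a /\ Dn c.
Proof.
by move=> dD h H; exact: (gfilter_below p l hp _ Dn a (inG_filter _ _ _ _ _ (gH j)) dD h H).
Qed.
Lemma j_vl (y : V) Z : Z ∈ vl (gG j) (gi j y) <-> exists n r, rel y n r /\ gi j r ∈ gG j /\ Z = vl (gG j) (gi j n).
Proof. exact: (in_nv _ _ _ _ _ (gH j) y Z). Qed.
Lemma j_name (Z : gN j) : exists t, Z = vl (gG j) (gi j t).
Proof. exact: (nv_surj _ _ _ _ _ (gH j)). Qed.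
Lemma j_sval (T : V) Z : Z ∈ sval (gG j) (gi j T) <-> exists z r, rel T z r /\ gi j r ∈ gG j /\ Z = gi j z.
Proof.
rewrite in_sval; split=> [[R [hR /(emb_rel_inv _ j_emb) [z [r [-> [E h]]]]]]|[z [r [h [hr ->]]]]].
  by subst R; exists z, r.
by exists (gi j r); split=> //; apply/(emb_rel _ j_emb).
Qed.
End GextFacts.

(** All elements of [c] come from [Y], so the pairs [(z, r)] with [r] forcing [z] into [c] form a
    reduced name. Its being a subset of [prod Y p] is what later makes the term forcing a set. *)
Lemma subset_name {V : structure} {HV : ZFC V} (hcV : countable V) (p l : V) (hp : is_poset p l)
    (j : gext V p l) (Y : V) (c : gN j) : sub c (gi j Y) ->
  exists S, sub S (prod Y p) /\ c = sval (gG j) (gi j S).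
Proof.
move=> hc; have E := j_emb j; have [t Et] := j_name j c; subst c.
pose Fz r z := forall j : gext V p l, gi j r ∈ gG j -> gi j z ∈ vl (gG j) (gi j t).
have dF : Def (single V) (fun j e => Fz (e 0) (e 1)).
  exact: (dgforces hcV p l hp (fun j e => e 0 ∈ vl (gG j) (gi j t)) ltac:(df)).
have [S [onS hS]] := relset (fun z r => Fz r z) Y p ltac:(df).
exists S; split; first exact/rel_onE.
apply: ext => Z; rewrite j_sval; split=> [hZ|[z [r [/hS [_ [_ h]] [hr ->]]]]]; last exact: h.
move/(emb_in _ E): (hc _ hZ) => [z [hz Ez]]; subst Z.
have [||r [hr h]] := gforces_truth hcV p l hp (fun j e => e 0 ∈ vl (gG j) (gi j t)) j (fun _ => z).
- by df.
- exact: hZ.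
- exists z, r; split=> //; apply/hS; split=> //; split=> //; exact: j_p hr.
Qed.

Section Iteration.
Context {V : structure} {HV : ZFC V} (hcV : countable V).
Variables p1 l1 p2 l2 q m d : V.
Hypothesis hp1 : is_poset p1 l1.
Hypothesis hfc : forall a, a ∈ p1 -> forces p1 l1 a (name_closed_poset p2 l2 d).
Hypothesis hit : is_iteration p1 l1 p2 l2 q m.
Hypothesis qne : nonempty q.
Implicit Types a b c t r x y z : V.
Notation nvl j t := (vl (gG j) (gi j t)).

Lemma closed_j (j : gext V p1 l1) : is_poset (nvl j p2) (nvl j l2) /\
  strategically_closed (nvl j p2) (nvl j l2) (gi j d).
Proof.
have [a ha] := j_ne j; have := hfc a (j_p j a ha) (gN j) (gi j) (gG j) (gH j) ha.
by move=> [P [L [/is_valE -> [/is_valE -> h]]]].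
Qed.

Lemma forces_mem a t : forces p1 l1 a (name_mem t p2) <->
  forall j : gext V p1 l1, gi j a ∈ gG j -> nvl j t ∈ nvl j p2.
Proof.
split=> [H j ha|H N i G hN ha].
  by have [x [y [/is_valE -> [/is_valE -> h]]]] := H _ _ _ (gH j) ha.
have HN := gen_zfc _ _ _ _ _ _ hN; have := H (Gext _ _ _ _ _ _ hN) ha => /= h.
by exists (vl G (i t)), (vl G (i p2)); rewrite !is_valE.
Qed.

Lemma forces_rel a t t' : forces p1 l1 a (name_rel l2 t t') <->
  forall j : gext V p1 l1, gi j a ∈ gG j -> rel (nvl j l2) (nvl j t) (nvl j t').
Proof.
split=> [H j ha|H N i G hN ha].
  by have [r [x [y [/is_valE -> [/is_valE -> [/is_valE -> h]]]]]] := H _ _ _ (gH j) ha.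
have HN := gen_zfc _ _ _ _ _ _ hN; have := H (Gext _ _ _ _ _ _ hN) ha => /= h.
by exists (vl G (i l2)), (vl G (i t)), (vl G (i t')); rewrite !is_valE.
Qed.

Lemma q_pair x : x ∈ q -> exists a t, x = opair a t.
Proof. by move/(proj1 hit) => [a [t [/is_opairE -> _]]]; exists a, t. Qed.

Lemma inq a t : opair a t ∈ q <-> a ∈ p1 /\ (exists b, rel p2 t b) /\
  forall j : gext V p1 l1, gi j a ∈ gG j -> nvl j t ∈ nvl j p2.
Proof.
rewrite (proj1 hit); split.
  by move=> [a' [t' [/is_opairE /opair_inj [<- <-] [h1 [h2 /forces_mem h3]]]]].
by move=> [h1 [h2 h3]]; exists a, t; rewrite is_opairE forces_mem.
Qed.

Lemma relm a t a' t' : rel m (opair a t) (opair a' t') <->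
  opair a t ∈ q /\ opair a' t' ∈ q /\ rel l1 a a' /\
  forall j : gext V p1 l1, gi j a ∈ gG j -> rel (nvl j l2) (nvl j t) (nvl j t').
Proof.
rewrite relE (proj2 hit); split.
  move=> [x [x' [b [s [b' [s' [/is_opairE /opair_inj [<- <-] [h1 [h2 [/is_opairE /opair_inj [<- <-]]]]]]]]]]].
  by move=> [/is_opairE /opair_inj [<- <-] [h3 /forces_rel h4]].
move=> [h1 [h2 [h3 h4]]]; exists (opair a t), (opair a' t'), a, t, a', t'.
by rewrite !is_opairE forces_rel.
Qed.

Lemma relm_pair x y : rel m x y -> exists a t a' t', x = opair a t /\ y = opair a' t'.
Proof.
move/relE/(proj2 hit) => [u [u' [b [s [b' [s' [/is_opairE /opair_inj [-> ->] [_ [_ [/is_opairE -> [/is_opairE -> _]]]]]]]]]]].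
by exists b, s, b', s'.
Qed.

Lemma nv_refl (j : gext V p1 l1) t : nvl j t ∈ nvl j p2 -> rel (nvl j l2) (nvl j t) (nvl j t).
Proof. by move=> h; have [[_ [_ [k _]]] _] := closed_j j; exact: k. Qed.
Lemma nv_trans (j : gext V p1 l1) (x y z : gN j) : rel (nvl j l2) x y -> rel (nvl j l2) y z -> rel (nvl j l2) x z.
Proof. by have [[_ [_ [_ k]]] _] := closed_j j; exact: k. Qed.

Lemma q_down a b t : opair a t ∈ q -> rel l1 b a -> opair b t ∈ q /\ rel m (opair b t) (opair a t).
Proof.
move=> h hb; case/inq: (h) => ha [k1 k2]; have [hb1 _] := le_p _ _ hp1 _ _ hb.
have K : opair b t ∈ q by apply/inq; split=> //; split=> // j hj; apply: k2; exact: j_up hb.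
split=> //; apply/relm; split=> //; split=> //; split=> // j hj; apply: nv_refl.
by apply: k2; exact: j_up hb.
Qed.

Lemma m_restrict a t a' t' b : rel m (opair a t) (opair a' t') -> rel l1 b a ->
  rel m (opair b t) (opair b t').
Proof.
move=> /relm [h1 [h2 [h3 h4]]] hb; apply/relm.
have [k1 _] := q_down _ _ _ h1 hb; have [k2 _] := q_down _ _ _ h2 (le_trans _ _ hp1 _ _ _ hb h3).
split=> //; split=> //; split; first by apply: (le_refl _ _ hp1); case: (le_p _ _ hp1 _ _ hb).
by move=> j hj; apply: h4; exact: j_up hb.
Qed.

Lemma hq : is_poset q m.
Proof.
split=> //; split; last split.
- move=> z /(proj2 hit) [x [x' [a [t [a' [t' [h [h1 [h2 _]]]]]]]]]; by exists x, x'.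
- move=> x hx; have [a [t E]] := q_pair x hx; subst x.
  by case/inq: (hx) => ha _; apply: (proj2 (q_down _ _ _ hx _)); exact: (le_refl _ _ hp1).
move=> x y z hxy hyz.
have [a [t [a' [t' [E1 E2]]]]] := relm_pair _ _ hxy; subst x y.
have [_ [_ [a2 [t2 [_ E3]]]]] := relm_pair _ _ hyz; subst z.
move/relm: hxy => [h1 [h2 [h3 h4]]]; move/relm: hyz => [k1 [k2 [k3 k4]]].
apply/relm; split=> //; split=> //; split; first exact: (le_trans _ _ hp1 _ _ _ h3 k3).
by move=> j hj; apply: nv_trans (h4 j hj) _; apply: k4; exact: j_up h3.
Qed.

End Iteration.

(** * The term forcing and the approximation property *)

(* [C] is a poset of subsets of [Y] under reverse inclusion, [Dp] and [Dm] are
   the relations "c forces x into A" and "c forces x out of A"; below [c0], the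
   trace of A on each member of [SM] is in the ground model and A is not. *)
Definition core {N : structure} (Y X SM PX dd C Dp Dm c0 : N) : Prop :=
  (forall c, c ∈ C -> sub c Y) /\ c0 ∈ C /\
  (forall c c' x, c ∈ C -> c' ∈ C -> sub c c' -> rel Dp c x -> rel Dp c' x) /\
  (forall c c' x, c ∈ C -> c' ∈ C -> sub c c' -> rel Dm c x -> rel Dm c' x) /\
  (forall c x, rel Dp c x -> ~ rel Dm c x) /\
  (forall c x, c ∈ C -> x ∈ X -> ~ rel Dp c x -> exists c', c' ∈ C /\ sub c c' /\ rel Dm c' x) /\
  (forall c x, c ∈ C -> x ∈ X -> ~ rel Dm c x -> exists c', c' ∈ C /\ sub c c' /\ rel Dp c' x) /\
  (forall a c, a ∈ SM -> c ∈ C -> sub c0 c -> exists c' b, c' ∈ C /\ sub c c' /\ b ∈ PX /\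
     forall x, x ∈ a -> (x ∈ b -> rel Dp c' x) /\ (x ∉ b -> rel Dm c' x)) /\
  (forall c b, c ∈ C -> sub c0 c -> b ∈ PX ->
     ~ forall x, x ∈ X -> (x ∈ b -> rel Dp c x) /\ (x ∉ b -> rel Dm c x)) /\
  (forall a f u, a ∈ dd -> nonempty a -> functional f -> (forall b, b ∈ a -> exists c, rel f b c) ->
     (forall b c, rel f b c -> b ∈ a /\ c ∈ C) ->
     (forall b b' c c', b ∈ b' -> rel f b c -> rel f b' c' -> sub c c') ->
     (forall z, z ∈ u <-> exists b c, rel f b c /\ z ∈ c) -> u ∈ C).

(* [w] is the play in the extension by [g] obtained by evaluating the first
   coordinates of the play [f] of the term forcing. *)
Definition is_fv {N : structure} (g f w : N) : Prop :=
  forall Z, Z ∈ w <-> exists b F S a t, rel f b (opair F S) /\ a ∈ g /\ rel F a t /\ Z = opair b (vl g t).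

Lemma rel_on_in {M : structure} {HM : ZF M} (f a b z : M) : rel_on f a b -> z ∈ f ->
  exists x y, z = opair x y /\ rel f x y.
Proof. by move=> h hz; have [x [y [/is_opairE E _]]] := h z hz; exists x, y; rewrite relE -E. Qed.

Section Terms.
Context {V : structure} {HV : ZFC V} (hcV : countable V).
Variables p1 l1 p2 l2 q m d : V.
Hypothesis hp1 : is_poset p1 l1.
Hypothesis hfc : forall a, a ∈ p1 -> forces p1 l1 a (name_closed_poset p2 l2 d).
Hypothesis hit : is_iteration p1 l1 p2 l2 q m.
Variables p0 t0 th tC tDp tDm S0 Y X SM PX s : V.
Hypothesis hr0 : opair p0 t0 ∈ q.
Hypothesis od : is_ord d.
Hypothesis hs : second_player_stages s d.
Hypothesis hS0 : sub S0 (prod Y q).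
Notation nvl j t := (vl (gG j) (gi j t)).
Notation svl j t := (sval (gG j) (gi j t)).
Notation Jq := (gext V q m).
Notation J1 := (gext V p1 l1).
Hypothesis H1 : forall j : Jq, gi j (opair p0 t0) ∈ gG j ->
  core (gi j Y) (gi j X) (gi j SM) (gi j PX) (gi j (sc d)) (nvl j tC) (nvl j tDp) (nvl j tDm) (svl j S0).
Hypothesis H2 : forall j : J1, gi j p0 ∈ gG j -> functional (nvl j th) /\
  forall a f, a ∈ gi j s -> play_following (nvl j p2) (nvl j l2) (gi j s) (nvl j th) f a ->
  exists x, rel (nvl j th) f x /\ x ∈ nvl j p2 /\ forall b y, rel f b y -> rel (nvl j l2) x y.
Implicit Types a b c t r x y z u F S : V.
Notation D := (Def (single V)).

Let qne : nonempty q := ex_intro _ (opair p0 t0) hr0.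
Let inq := inq p1 l1 p2 l2 q m hit.
Let relm := relm p1 l1 p2 l2 q m hit.
Let q_down := q_down p1 l1 p2 l2 q m d hp1 hfc hit.
Let m_restrict := m_restrict p1 l1 p2 l2 q m d hp1 hfc hit.
Let hq : is_poset q m := hq p1 l1 p2 l2 q m d hp1 hfc hit qne.
Let nv_refl := nv_refl p1 l1 p2 l2 d hfc.
Let nv_trans := nv_trans p1 l1 p2 l2 d hfc.
Let p1R := le_refl p1 l1 hp1.
Let p1T := le_trans p1 l1 hp1.
Let qT := le_trans q m hq.

Definition EQ a t t' := forall j : J1, gi j a ∈ gG j -> nvl j t = nvl j t'.
Lemma dEQ : D (fun j e => EQ (e 0) (e 1) (e 2)).
Proof.
exact: (dgforces hcV p1 l1 hp1 (fun j e => vl (gG j) (e 0) = vl (gG j) (e 1)) ltac:(df)).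
Qed.
Definition inC r S := forall j : Jq, gi j r ∈ gG j -> svl j S ∈ nvl j tC /\ sub (svl j S0) (svl j S).
Lemma dinC : D (fun j e => inC (e 0) (e 1)).
Proof.
exact: (dgforces hcV q m hq (fun j e => sval (gG j) (e 0) ∈ vl (gG j) (gi j tC) /\
  sub (sval (gG j) (gi j S0)) (sval (gG j) (e 0))) ltac:(df)).
Qed.
Definition subS r S S' := forall j : Jq, gi j r ∈ gG j -> sub (svl j S) (svl j S').
Lemma dsubS : D (fun j e => subS (e 0) (e 1) (e 2)).
Proof.
exact: (dgforces hcV q m hq (fun j e => sub (sval (gG j) (e 0)) (sval (gG j) (e 1))) ltac:(df)).
Qed.
Definition holds tD r S x := forall j : Jq, gi j r ∈ gG j -> rel (nvl j tD) (svl j S) (gi j x).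
Lemma dholds tD : D (fun j e => holds tD (e 0) (e 1) (e 2)).
Proof.
exact: (dgforces hcV q m hq (fun j e => rel (vl (gG j) (gi j tD)) (sval (gG j) (e 0)) (e 1)) ltac:(df)).
Qed.

Definition resp a t u := forall j : J1, gi j a ∈ gG j ->
  exists w, is_fv (gG j) (gi j u) w /\ rel (nvl j th) w (nvl j t).
Lemma dresp : D (fun j e => resp (e 0) (e 1) (e 2)).
Proof.
apply: (dgforces hcV p1 l1 hp1 (fun j e => exists w, is_fv (gG j) (e 1) w /\
  rel (vl (gG j) (gi j th)) w (vl (gG j) (e 0)))).
by rewrite /is_fv; df.
Qed.

(** A term stands for a name of a condition of the second factor below [t0]. Conditions of [q] admit
    only names in the domain of [p2], where a prescribed mixture need not occur; so a term is a
    whole set of pairs, fixing a name densely below [p0] and coherently up to forced equality. *)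
Definition isT F := sub F q /\ (forall a t, rel F a t -> rel m (opair a t) (opair p0 t0)) /\
  (forall a t b, rel F a t -> rel l1 b a -> rel F b t) /\
  (forall a t t', rel F a t -> rel F a t' -> EQ a t t') /\
  (forall a, rel l1 a p0 -> exists b t, rel l1 b a /\ rel F b t).
Definition inS x := exists F S, x = opair F S /\ isT F /\ sub S (prod Y q) /\
  forall a t, rel F a t -> inC (opair a t) S.
(** Terms are compared only at common first coordinates; since domains are downward closed and dense
    below [p0], these are dense as well. *)
Definition leT F' F := forall a t t', rel F' a t' -> rel F a t -> rel m (opair a t') (opair a t).
Definition leS F' S S' := forall a t, rel F' a t -> subS (opair a t) S S'.
Definition leP x' x := inS x' /\ inS x /\ exists F S F' S', x = opair F S /\ x' = opair F' S' /\
  leT F' F /\ leS F' S S'.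

Lemma dinS : D (fun j e => inS (e 0)).
Proof. pose proof dEQ; pose proof dinC; rewrite /inS /isT; df. Qed.
Lemma dleP : D (fun j e => leP (e 0) (e 1)).
Proof. pose proof dinS; pose proof dsubS; rewrite /leP /leT /leS; df. Qed.

Lemma set_inS : is_set inS.
Proof.
apply: (is_set_sub (prod (pw q) (pw (prod Y q)))); last exact: dinS.
by move=> x [F [S [-> [[h _] [h' _]]]]]; apply/opair_prod; rewrite !in_pw.
Qed.

Lemma T_q F a t : isT F -> rel F a t -> opair a t ∈ q.
Proof. by move=> [h _] /relE; exact: h. Qed.

Lemma T_p0 F a t : isT F -> rel F a t -> rel l1 a p0.
Proof. by move=> [_ [h _]] /h /relm [_ [_ []]]. Qed.

Lemma T_meet F (j : J1) a : isT F -> gi j a ∈ gG j -> rel l1 a p0 ->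
  exists b t, gi j b ∈ gG j /\ rel l1 b a /\ rel F b t.
Proof.
move=> [_ [_ [_ [_ hd]]]] ha hap.
have [||b [h1 [h2 [t h3]]]] := j_below hp1 j (fun b => exists t, rel F b t) a _ ha; first by df.
  by move=> b hb; have [c [t [k1 k2]]] := hd b (p1T _ _ _ hb hap); exists c; split=> //; exists t.
by exists b, t.
Qed.

(** Any condition below [(a, t)] can have its first coordinate shrunk into the domain of [F], and
    then lies below a pair of [F]. So a generic filter for the iteration that contains [(a, t)] also
    contains a pair of [F]. *)
Lemma T_meet_q F (j : Jq) a t : isT F -> gi j (opair a t) ∈ gG j -> rel l1 a p0 ->
  (forall b t', rel l1 b a -> rel F b t' -> rel m (opair b t) (opair b t')) ->
  exists b t', rel F b t' /\ gi j (opair b t') ∈ gG j /\ rel l1 b a.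
Proof.
move=> hF ha hap hle; have [_ [_ [_ [_ hd]]]] := hF.
have [||r [h1 [h2 [b [t' [h3 [h4 h5]]]]]]] := j_below hq j
  (fun r => exists b t', rel F b t' /\ rel l1 b a /\ rel m r (opair b t')) _ _ ha; first by df.
  move=> r hr; have [a1 [t1 [_ [_ [E _]]]]] := relm_pair _ _ _ _ _ _ hit _ _ hr; subst r.
  move/relm: (hr) => [k1 [k2 [k3 k4]]].
  have [b [t' [i1 i2]]] := hd a1 (p1T _ _ _ k3 hap).
  exists (opair b t1); split; first exact: (proj2 (q_down _ _ _ k1 i1)).
  have hba := p1T _ _ _ i1 k3.
  exists b, t'; split=> //; split=> //; apply: qT (m_restrict _ _ _ _ _ hr i1) _; exact: hle.
by exists b, t'; split=> //; split=> //; exact: j_up h5.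
Qed.

Lemma leT_EQ F a t t' : isT F -> rel F a t -> rel F a t' -> rel m (opair a t) (opair a t').
Proof.
move=> hF h h'; have hq1 := T_q _ _ _ hF h; have hq2 := T_q _ _ _ hF h'; have [_ [_ [_ [k _]]]] := hF.
case/inq: (hq1) => ha [_ k2]; apply/relm; split=> //; split=> //; split; first exact: p1R.
by move=> j hj; rewrite -(k _ _ _ h h' j hj); apply: nv_refl; exact: k2.
Qed.

Lemma leT_trans F1 F2 F3 : isT F1 -> isT F2 -> isT F3 -> leT F1 F2 -> leT F2 F3 -> leT F1 F3.
Proof.
move=> h1 h2 h3 h12 h23 a t3 t1 k1 k3; apply/relm.
have q1 := T_q _ _ _ h1 k1; have q3 := T_q _ _ _ h3 k3.
case/inq: (q1) => ha _; split=> //; split=> //; split; first exact: p1R.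
move=> j hj; have [b [t2 [i1 [i2 i3]]]] := T_meet F2 j a h2 hj (T_p0 _ _ _ h1 k1).
have [_ [_ [d1 _]]] := h1; have [_ [_ [d3 _]]] := h3.
have /relm [_ [_ [_ g1]]] := h12 _ _ _ (d1 _ _ _ k1 i2) i3.
have /relm [_ [_ [_ g2]]] := h23 _ _ _ i3 (d3 _ _ _ k3 i2).
exact: nv_trans (g1 j i1) (g2 j i1).
Qed.

Lemma leT_meet_q F1 F2 (j : Jq) a t : isT F1 -> isT F2 -> leT F1 F2 -> rel F1 a t ->
  gi j (opair a t) ∈ gG j -> exists b t', rel F2 b t' /\ gi j (opair b t') ∈ gG j /\ rel l1 b a.
Proof.
move=> h1 h2 h12 h hj; apply: (T_meet_q F2 j a t) => //; first exact: T_p0 h.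
by move=> b t' hb h'; apply: h12 => //; case: h1 => _ [_ [k _]]; exact: k hb.
Qed.

Lemma leT_refl F : isT F -> leT F F.
Proof. by move=> hF a t t' h h'; exact: leT_EQ hF h h'. Qed.

Lemma inS_pair F S : inS (opair F S) <-> isT F /\ sub S (prod Y q) /\
  forall a t, rel F a t -> inC (opair a t) S.
Proof.
split=> [[F' [S' [/opair_inj [<- <-]]]]//|h]; by exists F, S.
Qed.

Lemma leP_pair F S F' S' : leP (opair F' S') (opair F S) <->
  inS (opair F' S') /\ inS (opair F S) /\ leT F' F /\ leS F' S S'.
Proof.
split=> [[h1 [h2 [G1 [R1 [G2 [R2 [/opair_inj [<- <-] [/opair_inj [<- <-]]]]]]]]]//|[h1 [h2 h3]]].
by split=> //; split=> //; exists F, S, F', S'.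
Qed.

Lemma leP_refl x : inS x -> leP x x.
Proof.
move=> h; have [F [S [E [hT _]]]] := h; subst x; apply/leP_pair; split=> //; split=> //.
by split; [exact: leT_refl|move=> a t _ j _ z].
Qed.

Lemma leP_trans x y z : leP x y -> leP y z -> leP x z.
Proof.
move=> hxy hyz; have [[F1 [S1 [E1 [T1 _]]]] [[F2 [S2 [E2 [T2 _]]]] _]] := hxy.
have [_ [[F3 [S3 [E3 [T3 _]]]] _]] := hyz; subst x y z.
move/leP_pair: hxy => [h1 [h2 [h3 h4]]]; move/leP_pair: hyz => [_ [h5 [h6 h7]]].
apply/leP_pair; split=> //; split=> //; split; first exact: (leT_trans F1 F2 F3).
move=> a t k j hj z hz; have [b [t' [k1 [k2 _]]]] := leT_meet_q F1 F2 j a t T1 T2 h3 k hj.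
by apply: (h4 _ _ k j hj); exact: (h7 _ _ k1 j k2).
Qed.

Definition sS := mk q inS.
Lemma in_sS x : x ∈ sS <-> inS x. Proof. exact: (in_mk _ _ set_inS). Qed.

Lemma S_nonempty : exists x, inS x.
Proof.
have [F [onF hF]] := relset (fun a t => rel l1 a p0 /\ t = t0) p1 (upair t0 t0) ltac:(df).
have hF' a t : rel F a t <-> rel l1 a p0 /\ t = t0.
  rewrite hF in_sing; split=> [[_ [_ []]]//|[h ->]]; by case: (le_p _ _ hp1 _ _ h).
have hm a : rel l1 a p0 -> opair a t0 ∈ q /\ rel m (opair a t0) (opair p0 t0) by move=> h; exact: q_down.
exists (opair F S0); apply/inS_pair; split; last split=> //.
  split; last split; last split; last split.
  - by move=> z /(rel_on_in _ _ _ _ onF) [a [t [-> /hF' [h ->]]]]; case: (hm a h).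
  - by move=> a t /hF' [h ->]; case: (hm a h).
  - by move=> a t b /hF' [h ->] hb; apply/hF'; split=> //; exact: p1T h.
  - by move=> a t t' /hF' [_ ->] /hF' [_ ->].
  - move=> a ha; exists a, t0; split; last exact/hF'.
    by apply: p1R; case: (le_p _ _ hp1 _ _ ha).
move=> a t /hF' [h ->] j hj; have := H1 j (j_up j _ _ hj (proj2 (hm a h))).
by move=> [_ [h0 _]]; split=> // z.
Qed.

(* The strategy: answer with the term for the answer of the strategy named by
   [th], and with the union of the names played in the second coordinate. *)
Definition respF u := mk u (fun z => exists a t, z = opair a t /\ z ∈ q /\ rel l1 a p0 /\ resp a t u).
Definition respS u := mk u (fun z => exists b F S, rel u b (opair F S) /\ z ∈ S /\ z ∈ prod Y q).

Lemma set_respF u : is_set (fun z => exists a t, z = opair a t /\ z ∈ q /\ rel l1 a p0 /\ resp a t u).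
Proof.
pose proof dresp; apply: (is_set_sub q); last by df.
by move=> z [a [t [_ [h _]]]].
Qed.
Lemma set_respS u : is_set (fun z => exists b F S, rel u b (opair F S) /\ z ∈ S /\ z ∈ prod Y q).
Proof.
apply: (is_set_sub (prod Y q)); last by df.
by move=> z [b [F [S [_ []]]]].
Qed.
Lemma rel_respF u a t : rel (respF u) a t <-> opair a t ∈ q /\ rel l1 a p0 /\ resp a t u.
Proof.
rewrite relE (in_mk _ _ (set_respF u)); split; first by move=> [a' [t' [/opair_inj [<- <-]]]].
by move=> h; exists a, t.
Qed.
Lemma drespF : D (fun j e => e 0 = respF (e 1)).
Proof.
pose proof dresp; refine (Def_eq _ _ _ _); first by df.
by apply: DT_mk => [j e|]; [exact: set_respF|df].
Qed.
Lemma drespS : D (fun j e => e 0 = respS (e 1)).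
Proof.
refine (Def_eq _ _ _ _); first by df.
by apply: DT_mk => [j e|]; [exact: set_respS|df].
Qed.

Lemma fv_exists (j : J1) (u : gN j) : exists w, is_fv (gG j) u w.
Proof.
pose proof (dvl (gG j)) as dv.
have [B hB] : is_set (fun y : gN j => exists t : gN j, t ∈ tc u /\ y = vl (gG j) t) by apply: is_set_img.
apply: (is_set_sub (prod (tc u) B)); last by df.
move=> Z [b [F [S [a [t [h1 [h2 [h3 ->]]]]]]]]; apply/opair_prod.
have [hb hFS] := rel_tc _ _ _ h1; split=> //; apply/hB; exists t; split=> //.
have hF : F ∈ tc u.
  have k : upair F F ∈ tc u by apply: (tc_trans u _ hFS); rewrite in_upair; auto.
  by apply: (tc_trans u _ k); rewrite in_upair; auto.
by apply: (tc_mono F) => //; case: (rel_tc _ _ _ h3).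
Qed.
Lemma fv_unique (j : J1) (u w w' : gN j) : is_fv (gG j) u w -> is_fv (gG j) u w' -> w = w'.
Proof. by move=> h h'; apply: ext => Z; rewrite h h'. Qed.

Lemma fvE (j : J1) u w U W : is_fv (gG j) (gi j u) w ->
  rel w U W <-> exists b F S a t, rel u b (opair F S) /\ gi j a ∈ gG j /\ rel F a t /\ U = gi j b /\ W = nvl j t.
Proof.
have E := j_emb j => hw; rewrite relE hw; split.
  move=> [b' [F' [S' [a' [t' [h1 [h2 [h3 /opair_inj [-> ->]]]]]]]]].
  have [b [x [Eb [Ex h]]]] := emb_rel_inv _ E _ _ _ h1; subst b'.
  have [F [S [Exx [EF ES]]]] := emb_opair_inv _ E _ _ _ (eq_sym Ex); subst x F' S'.
  have [a [t [Ea [Et k]]]] := emb_rel_inv _ E _ _ _ h3; subst a' t'.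
  by exists b, F, S, a, t.
move=> [b [F [S [a [t [h1 [h2 [h3 [-> ->]]]]]]]]]; exists (gi j b), (gi j F), (gi j S), (gi j a), (gi j t).
by rewrite -(emb_opair _ E) !(emb_rel _ E).
Qed.

(** * The strategy in the term forcing *)

Section Strategy.
Variables lS hS : V.
Hypothesis hlS : forall x y, rel lS x y <-> leP x y.
Hypothesis hhS : forall u x, rel hS u x <-> u ∈ pw (prod (sc d) sS) /\ x ∈ sS /\ x = opair (respF u) (respS u).
Variables u al : V.
Hypothesis hal : al ∈ s.
Hypothesis hu : play_following sS lS s hS u al.

Lemma play_at b : b ∈ al -> exists F S, rel u b (opair F S) /\ inS (opair F S).
Proof.
move=> hb; have [[onu [_ tu]] _] := hu; have [x hx] := tu b hb.
have [_ /in_sS hxS] := rel_onP _ _ _ _ _ onu hx; have [F [S [E _]]] := hxS; subst x.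
by exists F, S.
Qed.
Lemma play_in b x : rel u b x -> b ∈ al /\ inS x.
Proof. by have [[onu _] _] := hu => /(rel_onP _ _ _ _ _ onu); rewrite in_sS. Qed.
Lemma play_inj b F S F' S' : rel u b (opair F S) -> rel u b (opair F' S') -> F = F' /\ S = S'.
Proof. by have [[_ [fu _]] _] := hu => h h'; have /opair_inj := fu _ _ _ h h'. Qed.
Lemma play_le b b' F S F' S' : b ∈ b' -> rel u b (opair F S) -> rel u b' (opair F' S') -> leT F' F /\ leS F' S S'.
Proof.
by have [_ [k _]] := hu => hb h h'; have /hlS /leP_pair [_ [_]] := k _ _ _ _ hb h h'.
Qed.

Lemma al_ord : is_ord al /\ al ∈ sc d /\ nonempty al.
Proof.
move/hs: hal => [h1 h2]; have hd : al ∈ sc d by rewrite in_sc.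
split; first by apply: (ord_in (sc d)) => //; exact: ord_sc.
split=> //; case: h2 => [[_ [h _]]//|[c [h _]]]; exists c; apply/h; auto.
Qed.

(** Coherence of terms makes the evaluated move independent of the condition used, and density of
    their domains gives a move at every stage. At the stages in [s] the pairs of [respF] force that
    [th] was obeyed. *)
Lemma play_eval (j : J1) w : gi j p0 ∈ gG j -> is_fv (gG j) (gi j u) w ->
  play_following (nvl j p2) (nvl j l2) (gi j s) (nvl j th) w (gi j al).
Proof.
move=> hj hw; have E := j_emb j.
have onq F S a t : inS (opair F S) -> rel F a t -> gi j a ∈ gG j -> nvl j t ∈ nvl j p2.
  by move=> /inS_pair [hT _] /(T_q _ _ _ hT) /inq [_ [_ k]]; exact: k.
have fw : functional w.
  move=> U W W' /(fvE _ _ _ _ _ hw) [b [F [S [a [t [h1 [h2 [h3 [-> ->]]]]]]]]].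
  move=> /(fvE _ _ _ _ _ hw) [b' [F' [S' [a' [t' [h1' [h2' [h3' [/(emb_inj _ E) Eb ->]]]]]]]]]; subst b'.
  have [EF _] := play_inj _ _ _ _ _ h1 h1'; subst F'.
  have [c [hc [c1 c2]]] := j_dir j _ _ h2 h2'.
  have [_ /inS_pair [[_ [_ [dn [co _]]]] _]] := play_in _ _ h1.
  exact: (co c t t' (dn _ _ _ h3 c1) (dn _ _ _ h3' c2) j hc).
split; last split.
- split; last split=> //.
    apply/rel_onE => Z /hw [B [F' [S' [a' [t' hZ]]]]].
    have : rel w B (vl (gG j) t').
      by apply/relE/hw; exists B, F', S', a', t'; case: hZ => ? [? [? _]].
    case: hZ => _ [_ [_ ->]] /(fvE _ _ _ _ _ hw) [b [F [S [a [t [h1 [h2 [h3 [-> ->]]]]]]]]].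
    have [hb hx] := play_in _ _ h1; apply/opair_prod; split; first exact/(emb_mem _ E).
    exact: onq hx h3 h2.
  move=> B /(emb_in _ E) [b [hb ->]]; have [F [S [h1 hx]]] := play_at b hb.
  have /inS_pair [hT _] := hx.
  have [c [t [k1 [k2 k3]]]] := T_meet F j p0 hT hj (p1R _ (j_p j _ hj)).
  by exists (nvl j t); apply/(fvE _ _ _ _ _ hw); exists b, F, S, c, t.
- move=> B B' W W' hBB /(fvE _ _ _ _ _ hw) [b [F [S [a [t [h1 [h2 [h3 [EB ->]]]]]]]]].
  move=> /(fvE _ _ _ _ _ hw) [b' [F' [S' [a' [t' [h1' [h2' [h3' [EB' ->]]]]]]]]]; subst B B'.
  move/(emb_mem _ E): hBB => hbb; have [k _] := play_le _ _ _ _ _ _ hbb h1 h1'.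
  have [c [hc [c1 c2]]] := j_dir j _ _ h2 h2'.
  have [_ /inS_pair [[_ [_ [dn _]]] _]] := play_in _ _ h1.
  have [_ /inS_pair [[_ [_ [dn' _]]] _]] := play_in _ _ h1'.
  by have /relm [_ [_ [_ g]]] := k _ _ _ (dn' _ _ _ h3' c2) (dn _ _ _ h3 c1); exact: g.
- move=> B /(emb_in _ E) [b [hb ->]] /(emb_mem _ E) hbs.
  have [_ [_ k]] := hu; have [ub [x [/is_restrictionE Eub [/hhS [_ [hx Ex]] h2]]]] := k b hb hbs.
  subst x ub; have [hT _] := proj1 (inS_pair _ _) (proj1 (in_sS _) hx).
  have [c [t [k1 [k2 k3]]]] := T_meet _ j p0 hT hj (p1R _ (j_p j _ hj)).
  have /rel_respF [_ [_ /(_ j k1) [w' [hw' k4]]]] := k3.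
  exists w', (nvl j t); split; last split=> //; last first.
    by apply/(fvE _ _ _ _ _ hw); exists b, (respF (restr u b)), (respS (restr u b)), c, t.
  apply/is_restrictionE; apply: ext => Z; rewrite in_restr; split.
    move/hw' => [B1 [F' [S' [a' [t' hZ]]]]].
    have : rel w' B1 (vl (gG j) t').
      by apply/relE/hw'; exists B1, F', S', a', t'; case: hZ => ? [? [? _]].
    case: hZ => _ [_ [_ ->]] /(fvE _ _ _ _ _ hw') [b1 [F [S [a [t1 [h3 [h4 [h5 [-> ->]]]]]]]]].
    move/rel_restr: h3 => [h3 hb1]; split.
      by apply/relE/(fvE _ _ _ _ _ hw); exists b1, F, S, a, t1.
    by exists (gi j b1), (nvl j t1); split=> //; apply/(emb_mem _ E).
  move=> [hZ [B1 [W [EZ hB]]]]; subst Z; move/relE/(fvE _ _ _ _ _ hw): hZ.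
  move=> [b1 [F [S [a [t1 [h3 [h4 [h5 [EB ->]]]]]]]]]; subst B1.
  apply/relE/(fvE _ _ _ _ _ hw'); exists b1, F, S, a, t1; split=> //.
  by apply/rel_restr; split=> //; apply/(emb_mem _ E).
Qed.

Lemma resp_val a t (j : J1) : rel l1 a p0 -> resp a t u -> gi j a ∈ gG j ->
  forall b F S c t', rel u b (opair F S) -> gi j c ∈ gG j -> rel F c t' -> rel (nvl j l2) (nvl j t) (nvl j t').
Proof.
move=> hap hr hj b F S c t' h1 h2 h3; have hj0 := j_up j _ _ hj hap.
have [w [hw hwt]] := hr j hj; have [fth st] := H2 j hj0.
have hals : gi j al ∈ gi j s by apply/(emb_mem _ (j_emb j)).
have [x [k1 [k2 k3]]] := st _ _ hals (play_eval j w hj0 hw).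
rewrite (fth _ _ _ hwt k1); apply: (k3 (gi j b)); apply/(fvE _ _ _ _ _ hw).
by exists b, F, S, c, t'.
Qed.

Lemma respF_T : isT (respF u).
Proof.
have [oal [hald [b0 hb0]]] := al_ord.
split; last split; last split; last split.
- by move=> z /(in_mk _ _ (set_respF u)) [a [t [_ [h _]]]].
- move=> a t /rel_respF [h1 [h2 h3]]; apply/relm; split=> //; split=> //; split=> // j hj.
  have [F [S [k1 /inS_pair [hT _]]]] := play_at b0 hb0.
  have [c [t' [i1 [i2 i3]]]] := T_meet F j a hT hj h2.
  apply: nv_trans (resp_val a t j h2 h3 hj _ _ _ _ _ k1 i1 i3) _.
  by have [_ [k _]] := hT; have /relm [_ [_ [_ g]]] := k _ _ i3; exact: g.
- move=> a t b /rel_respF [h1 [h2 h3]] hb; apply/rel_respF; split; first exact: (proj1 (q_down _ _ _ h1 hb)).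
  by split; [exact: p1T h2|move=> j hj; apply: h3; exact: j_up hb].
- move=> a t t' /rel_respF [h1 [h2 h3]] /rel_respF [h1' [h2' h3']] j hj.
  have [w [hw k]] := h3 j hj; have [w' [hw' k']] := h3' j hj.
  rewrite (fv_unique _ _ _ _ hw' hw) in k'.
  by have [fth _] := H2 j (j_up j _ _ hj h2); exact: fth k k'.
move=> a hap; have [ha _] := le_p _ _ hp1 _ _ hap.
have [j hj] := gext_exists hcV p1 l1 hp1 a ha; have hj0 := j_up j _ _ hj hap.
have [w hw] := fv_exists j (gi j u); have [fth st] := H2 j hj0.
have hals : gi j al ∈ gi j s by apply/(emb_mem _ (j_emb j)).
have [x [k1 [k2 k3]]] := st _ _ hals (play_eval j w hj0 hw).
(* The answer of the strategy is an element of the value of [p2], so it has a name [n] in the domain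
   of [p2], as conditions of [q] require. A condition of the filter forces that [n] names the
   answer, which gives density of the domain. *)
move/j_vl: k2 => [n [r [i1 [i2 i3]]]]; subst x.
pose Pr (j : idx (gfam V p1 l1)) (e : ev (gfam V p1 l1) j) := vl (gG j) (e 0) ∈ vl (gG j) (gi j p2) /\
  exists w, is_fv (gG j) (e 1) w /\ rel (vl (gG j) (gi j th)) w (vl (gG j) (e 0)).
have [||a' [ha' hF]] := gforces_truth hcV p1 l1 hp1 Pr j (scons n (fun _ => u)).
- by rewrite /Pr /is_fv; df.
- by split; [apply/j_vl; exists n, r|exists w].
have [b [hb [b1 b2]]] := j_dir j _ _ hj ha'.
exists b, n; split=> //; apply/rel_respF; split; last split.
- apply/inq; split; first exact: (j_p j).
  by split=> [|j' hj']; [exists r|have [] := hF j' (j_up j' _ _ hj' b2)].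
- exact: p1T hap.
- by move=> j' hj'; have [] := hF j' (j_up j' _ _ hj' b2).
Qed.

Lemma respF_le b F S : rel u b (opair F S) -> leT (respF u) F.
Proof.
move=> h a t t' /rel_respF [h1 [h2 h3]] h4; have [_ /inS_pair [hT _]] := play_in _ _ h.
apply/relm; split=> //; split; first exact: T_q hT h4.
split; first by apply: p1R; case: (le_p _ _ hp1 _ _ h2).
by move=> j hj; exact: (resp_val a t' j h2 h3 hj _ _ _ _ _ h hj h4).
Qed.

Lemma respS_svl (j : Jq) Z : Z ∈ svl j (respS u) <-> exists b F S, rel u b (opair F S) /\ Z ∈ svl j S.
Proof.
rewrite j_sval; split=> [[z [r [/relE /(in_mk _ _ (set_respS u)) [b [F [S [h1 [h2 _]]]]] [h3 ->]]]]|].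
  by exists b, F, S; split=> //; apply/j_sval; exists z, r; rewrite relE.
move=> [b [F [S [h1 /j_sval [z [r [h2 [h3 ->]]]]]]]]; exists z, r; split=> //.
apply/relE/(in_mk _ _ (set_respS u)); exists b, F, S; split=> //; move/relE: h2 => h2; split=> //.
by have [_ /inS_pair [_ [k _]]] := play_in _ _ h1; exact: k.
Qed.

(** A generic filter through [(a, t)] meets every earlier term, so the values of the second
    coordinates increase along a sequence of nonzero length [al], at most [d]. The last clause of
    [core] puts their union into the collapse. *)
Lemma respS_in a t : rel (respF u) a t -> inC (opair a t) (respS u).
Proof.
move=> hat j hj; have [oal [hald [b0 hb0]]] := al_ord; have E := j_emb j.
have hj0 : gi j (opair p0 t0) ∈ gG j.
  by apply: j_up hj _; have [_ [k _]] := respF_T; exact: k.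
have [cY [c00 [mp [mm [dis [wp [wm [apx [nd un]]]]]]]]] := H1 j hj0.
have at_b b F S : rel u b (opair F S) -> svl j S ∈ nvl j tC /\ sub (svl j S0) (svl j S).
  move=> h; have [_ /inS_pair [hT [_ k]]] := play_in _ _ h.
  have [c [t' [k1 [k2 _]]]] := leT_meet_q _ _ j a t respF_T hT (respF_le _ _ _ h) hat hj.
  exact: (k c t' k1 j k2).
split; last first.
  move=> Z hZ; apply/respS_svl; have [F [S [h _]]] := play_at b0 hb0; exists b0, F, S; split=> //.
  by have [_ k] := at_b _ _ _ h; exact: k.
have [f [_ hf]] := relset (fun B c : gN j => exists F S : gN j, rel (gi j u) B (opair F S) /\ c = sval (gG j) S)
  (gi j al) (nvl j tC) ltac:(df).
have hf' (B c : gN j) : rel f B c <-> exists b F S, rel u b (opair F S) /\ B = gi j b /\ c = svl j S.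
  rewrite hf; split.
    move=> [_ [_ [F' [S' [h ->]]]]]; have [b [x [-> [Ex h']]]] := emb_rel_inv _ E _ _ _ h.
    have [F [S [Exx [EF ES]]]] := emb_opair_inv _ E _ _ _ (eq_sym Ex); subst x F' S'.
    by exists b, F, S.
  move=> [b [F [S [h [-> ->]]]]]; have [k _] := at_b _ _ _ h; have [hb _] := play_in _ _ h.
  split; first exact/(emb_mem _ E); split=> //.
  by exists (gi j F), (gi j S); rewrite -(emb_opair _ E) (emb_rel _ E).
apply: (un (gi j al) f).
- exact/(emb_mem _ E).
- by exists (gi j b0); apply/(emb_mem _ E).
- move=> B c c' /hf' [b [F [S [h [-> ->]]]]] /hf' [b' [F' [S' [h' [/(emb_inj _ E) Eb ->]]]]]; subst b'.
  by have [_ ->] := play_inj _ _ _ _ _ h h'.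
- move=> B /(emb_in _ E) [b [hb ->]]; have [F [S [h _]]] := play_at b hb.
  by exists (svl j S); apply/hf'; exists b, F, S.
- by move=> B c /hf [h1 [h2 _]].
- move=> B B' c c' hB /hf' [b [F [S [h [EB ->]]]]] /hf' [b' [F' [S' [h' [EB' ->]]]]]; subst B B'.
  move/(emb_mem _ E): hB => hb; have [_ k] := play_le _ _ _ _ _ _ hb h h'.
  have [_ /inS_pair [hT _]] := play_in _ _ h'.
  have [e [t' [k1 [k2 _]]]] := leT_meet_q _ _ j a t respF_T hT (respF_le _ _ _ h') hat hj.
  exact: (k e t' k1 j k2).
- move=> Z; rewrite respS_svl; split.
    by move=> [b [F [S [h hZ]]]]; exists (gi j b), (svl j S); split=> //; apply/hf'; exists b, F, S.
  by move=> [B [c [/hf' [b [F [S [h [_ ->]]]]] hZ]]]; exists b, F, S.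
Qed.

Lemma respS_step : exists x, rel hS u x /\ x ∈ sS /\ forall b y, rel u b y -> rel lS x y.
Proof.
have hx : inS (opair (respF u) (respS u)).
  apply/inS_pair; split; first exact: respF_T; split; last exact: respS_in.
  by move=> z /(in_mk _ _ (set_respS u)) [b [F [S [_ [_ h]]]]].
exists (opair (respF u) (respS u)); split; last split; last 1 first.
- move=> b y h; have [_ hy] := play_in _ _ h; have [F [S [Ey _]]] := hy; subst y.
  apply/hlS/leP_pair; split=> //; split=> //; split; first exact: respF_le h.
  by move=> a t hat j hj Z hZ; apply/respS_svl; exists b, F, S.
- apply/hhS; split; last by split=> //; apply/in_sS.
  apply/in_pw => z hz; have [[onu _] _] := hu; have [b [y [Ez h]]] := rel_on_in _ _ _ _ onu hz.
  subst z; have [hb hy] := play_in _ _ h; apply/opair_prod; split; last exact/in_sS.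
  have [_ [hald _]] := al_ord; exact: (proj1 (ord_sc _ od) al hald).
- exact/in_sS.
Qed.
End Strategy.

Lemma S_closed : exists lS, (forall x y, rel lS x y <-> leP x y) /\ is_poset sS lS /\
  exists hS, functional hS /\ forall a f, a ∈ s -> play_following sS lS s hS f a ->
    exists x, rel hS f x /\ x ∈ sS /\ forall b y, rel f b y -> rel lS x y.
Proof.
have [lS [onl hl]] := relset leP sS sS dleP.
have hlS x y : rel lS x y <-> leP x y.
  rewrite hl !in_sS; split=> [[_ []]//|h]; by case: (h) => h1 [h2 _].
exists lS; split=> //; split.
  split; first by have [x hx] := S_nonempty; exists x; apply/in_sS.
  split=> //; split; first by move=> x /in_sS hx; apply/hlS; exact: leP_refl.
  by move=> x y z /hlS h /hlS h'; apply/hlS; exact: leP_trans h'.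
pose proof drespF; pose proof drespS.
have [hS [_ hh]] := relset (fun u x => x = opair (respF u) (respS u)) (pw (prod (sc d) sS)) sS ltac:(df).
exists hS; split; first by move=> u x y /hh [_ [_ ->]] /hh [_ [_ ->]].
by move=> a f ha hf; exact: (respS_step lS hS hlS hh f a).
Qed.

Definition ext_forced S tD r S' x := sub S' (prod Y q) /\ forall j : Jq, gi j r ∈ gG j ->
  svl j S' ∈ nvl j tC /\ sub (svl j S) (svl j S') /\ rel (nvl j tD) (svl j S') (gi j x).
Lemma dext_forced S tD : D (fun j e => ext_forced S tD (e 0) (e 1) (e 2)).
Proof.
pose Q r S' x := forall j : Jq, gi j r ∈ gG j ->
  svl j S' ∈ nvl j tC /\ sub (svl j S) (svl j S') /\ rel (nvl j tD) (svl j S') (gi j x).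
have dQ : D (fun j e => Q (e 0) (e 1) (e 2)).
  exact: (dgforces hcV q m hq (fun j e => sval (gG j) (e 0) ∈ vl (gG j) (gi j tC) /\
    sub (sval (gG j) (gi j S)) (sval (gG j) (e 0)) /\
    rel (vl (gG j) (gi j tD)) (sval (gG j) (e 0)) (e 1)) ltac:(df)).
by rewrite /ext_forced -/Q; df.
Qed.

Lemma ext_of (j : Jq) r S tD x (c : gN j) : gi j r ∈ gG j -> rel m r (opair p0 t0) ->
  c ∈ nvl j tC -> sub (svl j S) c -> rel (nvl j tD) c (gi j x) ->
  exists r' S', rel m r' r /\ ext_forced S tD r' S' x.
Proof.
move=> hr hr0' hc hS hD; have [cY _] := H1 j (j_up j _ _ hr hr0').
have [S' [h1 h2]] := subset_name hcV q m hq j Y c (cY _ hc); subst c.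
have [||r' [hr' h]] := gforces_truth hcV q m hq (fun j e => sval (gG j) (e 0) ∈ vl (gG j) (gi j tC) /\
    sub (sval (gG j) (gi j S)) (sval (gG j) (e 0)) /\
    rel (vl (gG j) (gi j tD)) (sval (gG j) (e 0)) (e 1)) j (scons S' (fun _ => x)).
- by df.
- by [].
have [b [hb [b1 b2]]] := j_dir j _ _ hr hr'.
exists b, S'; split=> //; split=> // j' hj'; exact: (h j' (j_up j' _ _ hj' b2)).
Qed.

(** * Amalgamation of two incompatible extensions *)

Section Mix.
Variables (F S : V) (pa pb t1 u su S1 u' su' S2 x tD1 tD2 : V).
Hypothesis hFS : inS (opair F S).
Hypothesis hpa : rel F pa t1.
Hypothesis hpb : rel F pb t1.
Hypothesis inc : ~ compatible p1 l1 pa pb.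
Hypothesis le1 : rel m (opair u su) (opair pa t1).
Hypothesis le2 : rel m (opair u' su') (opair pb t1).
Hypothesis ex1 : ext_forced S tD1 (opair u su) S1 x.
Hypothesis ex2 : ext_forced S tD2 (opair u' su') S2 x.
Notation inco a b := (~ compatible p1 l1 a b).

Let hT : isT F. Proof. by case/inS_pair: hFS. Qed.

Lemma compat_le a b c : compatible p1 l1 a c -> rel l1 a b -> compatible p1 l1 b c.
Proof. by move=> [e [h1 [h2 h3]]] h; exists e; split=> //; split=> //; exact: p1T h. Qed.
Lemma compat_common a b c : rel l1 c a -> rel l1 c b -> compatible p1 l1 a b.
Proof. by move=> h1 h2; exists c; split=> //; case: (le_p _ _ hp1 _ _ h1). Qed.

Lemma u_inc a : rel l1 a u -> rel l1 a u' -> False.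
Proof.
move=> h1 h2; apply: inc; move/relm: le1 => [_ [_ [k1 _]]]; move/relm: le2 => [_ [_ [k2 _]]].
by apply: (compat_common _ _ a); [exact: p1T k1|exact: p1T k2].
Qed.

(** The term becomes [su] below [u] and [su'] below [u'], and is kept at conditions incompatible
    with both. The remaining conditions leave the domain, which stays dense. *)
Definition mixF := mk q (fun z => exists a t, z = opair a t /\
  ((rel l1 a u /\ t = su) \/ (rel l1 a u' /\ t = su') \/ (rel F a t /\ inco a u /\ inco a u'))).

Lemma mixF_q a t : (rel l1 a u /\ t = su) \/ (rel l1 a u' /\ t = su') \/ (rel F a t /\ inco a u /\ inco a u') ->
  opair a t ∈ q.
Proof.
move/relm: le1 => [q1 _]; move/relm: le2 => [q2 _].
move=> [[h ->]|[[h ->]|[h _]]]; [exact: (proj1 (q_down _ _ _ q1 h))|exact: (proj1 (q_down _ _ _ q2 h))|].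
exact: T_q hT h.
Qed.
Lemma rel_mixF a t : rel mixF a t <->
  (rel l1 a u /\ t = su) \/ (rel l1 a u' /\ t = su') \/ (rel F a t /\ inco a u /\ inco a u').
Proof.
have sF : is_set (fun z => exists a t, z = opair a t /\
  ((rel l1 a u /\ t = su) \/ (rel l1 a u' /\ t = su') \/ (rel F a t /\ inco a u /\ inco a u'))).
  apply: (is_set_sub q); last by rewrite /compatible; df.
  by move=> z [a' [t' [-> h]]]; exact: mixF_q.
rewrite relE (in_mk _ _ sF); split; first by move=> [a' [t' [/opair_inj [<- <-]]]].
by move=> h; exists a, t.
Qed.
Lemma mixF_sub : sub mixF q.
Proof.
move=> z; have sF : is_set (fun z => exists a t, z = opair a t /\
  ((rel l1 a u /\ t = su) \/ (rel l1 a u' /\ t = su') \/ (rel F a t /\ inco a u /\ inco a u'))).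
  apply: (is_set_sub q); last by rewrite /compatible; df.
  by move=> z' [a' [t' [-> h]]]; exact: mixF_q.
by move/(in_mk _ _ sF) => [a [t [-> h]]]; exact: mixF_q.
Qed.

Lemma F_down a b t : rel F a t -> rel l1 b a -> rel F b t.
Proof. by case: hT => _ [_ [k _]]; exact: k. Qed.
Lemma le1_at a : rel l1 a u -> rel F a t1 /\ rel m (opair a su) (opair a t1).
Proof.
move=> h; split; last exact: m_restrict le1 h.
by apply: F_down hpa _; move/relm: le1 => [_ [_ [k _]]]; exact: p1T k.
Qed.
Lemma le2_at a : rel l1 a u' -> rel F a t1 /\ rel m (opair a su') (opair a t1).
Proof.
move=> h; split; last exact: m_restrict le2 h.
by apply: F_down hpb _; move/relm: le2 => [_ [_ [k _]]]; exact: p1T k.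
Qed.

Lemma mixF_le a t : rel mixF a t -> exists t', rel F a t' /\ rel m (opair a t) (opair a t').
Proof.
move/rel_mixF => [[h ->]|[[h ->]|[h _]]]; [exists t1; exact: le1_at|exists t1; exact: le2_at|].
by exists t; split=> //; exact: (leT_EQ _ _ _ _ hT h h).
Qed.

Lemma mixF_T : isT mixF.
Proof.
split; first exact: mixF_sub.
split; last split; last split.
- move=> a t /mixF_le [t' [h1 h2]]; apply: qT h2 _; by case: hT => _ [k _]; exact: k.
- move=> a t b /rel_mixF h hb; apply/rel_mixF; case: h => [[h ->]|[[h ->]|[h [k1 k2]]]].
  + by left; split=> //; exact: p1T h.
  + by right; left; split=> //; exact: p1T h.
  + right; right; split; first exact: F_down h hb.
    by split=> k; [apply: k1|apply: k2]; exact: compat_le k hb.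
- move=> a t t' /rel_mixF h /rel_mixF h'.
  have self w : rel l1 a w -> inco a w -> False.
    by move=> k; apply; apply: (compat_common _ _ a) => //; apply: p1R; case: (le_p _ _ hp1 _ _ k).
  case: h => [[g ->]|[[g ->]|[g [k1 k2]]]]; case: h' => [[g' ->]|[[g' ->]|[g' [k1' k2']]]] //.
  + by case: (u_inc a).
  + by case: (self u).
  + by case: (u_inc a).
  + by case: (self u').
  + by case: (self u).
  + by case: (self u').
  + by case: hT => _ [_ [_ [k _]]]; exact: k.
- move=> a ha; case: (classic (compatible p1 l1 a u)) => [[c [_ [h1 h2]]]|n1].
    by exists c, su; split=> //; apply/rel_mixF; auto.
  case: (classic (compatible p1 l1 a u')) => [[c [_ [h1 h2]]]|n2].
    by exists c, su'; split=> //; apply/rel_mixF; auto.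
  case: hT => _ [_ [_ [_ k]]]; have [b [t [h1 h2]]] := k a ha; exists b, t; split=> //.
  apply/rel_mixF; right; right; split=> //.
  by split=> h; [apply: n1|apply: n2]; exact: compat_le h h1.
Qed.

(** A pair of an old name survives at those stronger conditions whose first coordinate has settled
    the case. Thus the new name takes the value of [S1], [S2] or [S] according to the generic of the
    first factor. *)
Definition mixS_cond z r := exists a t r', r = opair a t /\ rel m r r' /\
  ((rel l1 a u /\ rel S1 z r') \/ (rel l1 a u' /\ rel S2 z r') \/ (inco a u /\ inco a u' /\ rel S z r')).

Lemma mixS_exists : exists S', sub S' (prod Y q) /\
  forall z r, rel S' z r <-> z ∈ Y /\ r ∈ q /\ mixS_cond z r.
Proof.
have [S' [on hS]] := relset mixS_cond Y q ltac:(rewrite /mixS_cond /compatible; df).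
by exists S'; split=> //; apply/rel_onE.
Qed.

Lemma mixS_val S' (R : V) (j : Jq) a t : sub R (prod Y q) ->
  (forall z r, rel S' z r <-> z ∈ Y /\ r ∈ q /\ mixS_cond z r) ->
  gi j (opair a t) ∈ gG j ->
  (forall b s z r, rel l1 b a -> rel m (opair b s) r -> rel R z r -> mixS_cond z (opair b s)) ->
  (forall b c z r, rel l1 c a -> rel l1 c b ->
     ((rel l1 b u /\ rel S1 z r) \/ (rel l1 b u' /\ rel S2 z r) \/ (inco b u /\ inco b u' /\ rel S z r)) -> rel R z r) ->
  svl j S' = svl j R.
Proof.
move=> sR hS' hj k1 k2; apply: ext => Z; rewrite !j_sval; split=> -[z [r [h [hr ->]]]].
  move/hS': h => [_ [_ [b [s' [r' [E [h1 h2]]]]]]]; subst r.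
  have [e [he [e1 e2]]] := j_dir j _ _ hj hr.
  have [c [s2 [_ [_ [Ee _]]]]] := relm_pair _ _ _ _ _ _ hit _ _ e1; subst e.
  move/relm: e1 => [_ [_ [e1 _]]]; move/relm: e2 => [_ [_ [e2 _]]].
  by exists z, r'; split; [exact: (k2 b c z r' e1 e2 h2)|split=> //; exact: j_up h1].
have [e [he [e1 e2]]] := j_dir j _ _ hj hr.
have [c [s2 [_ [_ [Ee _]]]]] := relm_pair _ _ _ _ _ _ hit _ _ e1; subst e.
have [c1 _] := le_p _ _ hq _ _ e1; move/relm: e1 => [_ [_ [e1 _]]].
exists z, (opair c s2); split=> //; apply/hS'; split; last by split=> //; exact: k1 e2 h.
by move/relE/sR/opair_prod: h => [].
Qed.

(** One pair can hold both decisions because each is read off only below its own condition of the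
    first factor. *)
Lemma mix_terms : exists F' S', leP (opair F' S') (opair F S) /\
  (forall a t, rel F' a t -> rel l1 a u -> holds tD1 (opair a t) S' x) /\
  (forall a t, rel F' a t -> rel l1 a u' -> holds tD2 (opair a t) S' x).
Proof.
have [S' [sS' hS']] := mixS_exists; have [sx1 fx1] := ex1; have [sx2 fx2] := ex2.
have [_ [sS hC]] := proj1 (inS_pair _ _) hFS.
have self a w : rel l1 a w -> inco a w -> False.
  by move=> k; apply; apply: (compat_common _ _ a) => //; apply: p1R; case: (le_p _ _ hp1 _ _ k).
have v1 (j : Jq) a t : rel l1 a u -> gi j (opair a t) ∈ gG j -> svl j S' = svl j S1.
  move=> ha hj; apply: (mixS_val S' S1 j a t) => //.
    by move=> b s' z r hb hm hz; exists b, s', r; split=> //; split=> //; left; split=> //; exact: p1T ha.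
  move=> b c z r hca hcb [[_ //]|[[h _]|[h _]]].
    by case: (u_inc c); [exact: p1T ha|exact: p1T h].
  by case: h; apply: (compat_common _ _ c) => //; exact: p1T ha.
have v2 (j : Jq) a t : rel l1 a u' -> gi j (opair a t) ∈ gG j -> svl j S' = svl j S2.
  move=> ha hj; apply: (mixS_val S' S2 j a t) => //.
    by move=> b s' z r hb hm hz; exists b, s', r; split=> //; split=> //; right; left; split=> //; exact: p1T ha.
  move=> b c z r hca hcb [[h _]|[[_ //]|[_ [h _]]]].
    by case: (u_inc c); [exact: p1T h|exact: p1T ha].
  by case: h; apply: (compat_common _ _ c) => //; exact: p1T ha.
have v3 (j : Jq) a t : inco a u -> inco a u' -> gi j (opair a t) ∈ gG j -> svl j S' = svl j S.
  move=> n1 n2 hj; apply: (mixS_val S' S j a t) => //.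
    move=> b s' z r hb hm hz; exists b, s', r; split=> //; split=> //; right; right.
    by split; [move=> k; apply: n1; exact: compat_le k hb|split=> // k; apply: n2; exact: compat_le k hb].
  move=> b c z r hca hcb [[h _]|[[h _]|[_ [_ //]]]].
    by case: n1; apply: (compat_common _ _ c) => //; exact: p1T h.
  by case: n2; apply: (compat_common _ _ c) => //; exact: p1T h.
move/relm: (le1) => [q1 _]; move/relm: (le2) => [q2 _].
have up1 (j : Jq) a : rel l1 a u -> gi j (opair a su) ∈ gG j -> gi j (opair u su) ∈ gG j.
  by move=> h hj; apply: j_up hj _; exact: (proj2 (q_down _ _ _ q1 h)).
have up2 (j : Jq) a : rel l1 a u' -> gi j (opair a su') ∈ gG j -> gi j (opair u' su') ∈ gG j.
  by move=> h hj; apply: j_up hj _; exact: (proj2 (q_down _ _ _ q2 h)).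
have key (j : Jq) a t : rel mixF a t -> gi j (opair a t) ∈ gG j ->
    svl j S' ∈ nvl j tC /\ sub (svl j S) (svl j S').
  move=> /rel_mixF [[h E]|[[h E]|[h [n1 n2]]]] hj; try subst t.
  - by rewrite (v1 j a su h hj); have [? []] := fx1 j (up1 j a h hj).
  - by rewrite (v2 j a su' h hj); have [? []] := fx2 j (up2 j a h hj).
  - by rewrite (v3 j a t n1 n2 hj); have [k _] := hC a t h j hj; split=> // z.
exists mixF, S'; split; last split.
- have hm : inS (opair mixF S').
    apply/inS_pair; split; first exact: mixF_T; split=> // a t h j hj.
    have [k1 k2] := key j a t h hj; split=> // Z hZ; apply: k2.
    have [t' [i1 i2]] := mixF_le _ _ h.
    by have [_ k] := hC a t' i1 j (j_up j _ _ hj i2); exact: k.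
  apply/leP_pair; split=> //; split=> //; split; last by move=> a t h j hj; case: (key j a t h hj).
  move=> a t t' h h'; have [t2 [i1 i2]] := mixF_le _ _ h; apply: qT i2 _; exact: leT_EQ hT i1 h'.
- move=> a t /rel_mixF h ha j hj; case: h => [[h E]|[[h E]|[h [n1 n2]]]].
  + by subst t; rewrite (v1 j a su h hj); have [_ []] := fx1 j (up1 j a h hj).
  + by case: (u_inc a).
  + by case: (self a u).
- move=> a t /rel_mixF h ha j hj; case: h => [[h E]|[[h E]|[h [n1 n2]]]].
  + by case: (u_inc a).
  + by subst t; rewrite (v2 j a su' h hj); have [_ []] := fx2 j (up2 j a h hj).
  + by case: (self a u').
Qed.
End Mix.

(** * Splitting points and the contradiction *)

Hypothesis hnt : nontrivial p1 l1.
Hypothesis hPX : PX = pw X.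

Definition decides tD u F S x := forall a t, rel F a t -> rel l1 a u -> holds tD (opair a t) S x.
(** Both answers about [x] remain available by moves below [p] in the first factor alone, with the
    pair [(F, S)] kept fixed. *)
Definition splits p F S x := x ∈ X /\ exists u u', rel l1 u p /\ rel l1 u' p /\
  decides tDp u F S x /\ decides tDm u' F S x.
Definition task_done p y := rel l1 p p0 -> exists F S x, y = opair F S /\ splits p F S x.

Lemma dsplits F S : D (fun j e => splits (e 0) F S (e 1)).
Proof. pose proof (dholds tDp); pose proof (dholds tDm); rewrite /splits /decides; df. Qed.
Lemma dtask : D (fun j e => task_done (e 0) (e 1)).
Proof. pose proof (dholds tDp); pose proof (dholds tDm); rewrite /task_done /splits /decides; df. Qed.

(** A generic filter through the stronger term also meets the weaker one, where the decision was
    made; monotonicity of the relation named by [tD] carries it over to the larger collapse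
    condition. *)
Lemma decides_open tD u F S F' S' x :
  (forall j : Jq, gi j (opair p0 t0) ∈ gG j -> forall c c' : gN j, c ∈ nvl j tC -> c' ∈ nvl j tC -> sub c c' ->
     rel (nvl j tD) c (gi j x) -> rel (nvl j tD) c' (gi j x)) ->
  leP (opair F' S') (opair F S) -> decides tD u F S x -> decides tD u F' S' x.
Proof.
move=> mono /leP_pair [/inS_pair [T' [_ C']] [/inS_pair [T [_ C]] [h1 h2]]] hd a t ha hau j hj.
have [b [t' [k1 [k2 k3]]]] := leT_meet_q F' F j a t T' T h1 ha hj.
have hj0 : gi j (opair p0 t0) ∈ gG j by apply: j_up hj _; case: T' => _ [k _]; exact: k.
apply: (mono j hj0 (svl j S)).
- by case: (C b t' k1 j k2).
- by case: (C' a t ha j hj).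
- exact: (h2 a t ha j hj).
- exact: (hd b t' k1 (p1T _ _ _ k3 hau) j k2).
Qed.

Lemma task_open p y y' : task_done p y -> leP y' y -> task_done p y'.
Proof.
move=> h hle hp; have [F [S [x [E [hx [u [u' [h1 [h2 [h3 h4]]]]]]]]]] := h hp; subst y.
have [[F' [S' [E _]]] _] := hle; subst y'; exists F', S', x; split=> //; split=> //.
exists u, u'; split=> //; split=> //; split; [apply: decides_open hle h3|apply: decides_open hle h4] => j hj c c' h5 h6 h7.
  by have [_ [_ [k _]]] := H1 j hj; exact: k.
by have [_ [_ [_ [k _]]]] := H1 j hj; exact: k.
Qed.

(** Otherwise let [B] be the set, in the ground model, of points that can still be forced into A
    below [(pa, t1)]. No point of [B] can be forced out and no other point can be forced in, so the
    value of [S] already decides A to be [B], which [core] forbids. *)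
Lemma split_exists F S pa t1 : inS (opair F S) -> rel F pa t1 -> exists x, x ∈ X /\
  (exists r' S', rel m r' (opair pa t1) /\ ext_forced S tDp r' S' x) /\
  (exists r' S', rel m r' (opair pa t1) /\ ext_forced S tDm r' S' x).
Proof.
move=> /inS_pair [hT [_ hC]] hpa; apply: NNPP => n.
have hr0' : rel m (opair pa t1) (opair p0 t0) by case: hT => _ [k _]; exact: k.
have [j hj] := gext_exists hcV q m hq _ (T_q _ _ _ hT hpa); have E := j_emb j.
have [cY [c00 [mp [mm [dis [wp [wm [apx [nd un]]]]]]]]] := H1 j (j_up j _ _ hj hr0').
have [c1 c2] := hC _ _ hpa j hj.
pose proof (dext_forced S tDp) as dx.
have [B hB] : is_set (fun x => x ∈ X /\ exists r' S', rel m r' (opair pa t1) /\ ext_forced S tDp r' S' x).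
  by apply: is_set_sep; df.
apply: (nd (svl j S) (gi j B) c1 c2).
  by rewrite hPX; apply/(emb_mem _ E)/in_pw => x /hB [].
move=> x' /(emb_in _ E) [x [hx ->]]; split=> [/(emb_mem _ E) /hB [_ hex]|hnB]; apply: NNPP => K.
  apply: n; exists x; split=> //; split=> //.
  have [|c' [k1 [k2 k3]]] := wp _ (gi j x) c1 _ K; first exact/(emb_mem _ E).
  exact: ext_of hj hr0' k1 k2 k3.
apply: hnB; apply/(emb_mem _ E)/hB; split=> //.
have [|c' [k1 [k2 k3]]] := wm _ (gi j x) c1 _ K; first exact/(emb_mem _ E).
exact: ext_of hj hr0' k1 k2 k3.
Qed.

Lemma decide_exists F S pb t1 x : inS (opair F S) -> rel F pb t1 -> x ∈ X ->
  (exists r' S', rel m r' (opair pb t1) /\ ext_forced S tDp r' S' x) \/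
  (exists r' S', rel m r' (opair pb t1) /\ ext_forced S tDm r' S' x).
Proof.
move=> /inS_pair [hT [_ hC]] hpb hx.
have hr0' : rel m (opair pb t1) (opair p0 t0) by case: hT => _ [k _]; exact: k.
have [j hj] := gext_exists hcV q m hq _ (T_q _ _ _ hT hpb); have E := j_emb j.
have [cY [c00 [mp [mm [dis [wp [wm [apx [nd un]]]]]]]]] := H1 j (j_up j _ _ hj hr0').
have [c1 c2] := hC _ _ hpb j hj.
have hx' : gi j x ∈ gi j X by apply/(emb_mem _ E).
case: (classic (rel (nvl j tDp) (svl j S) (gi j x))) => [/dis K|K].
  by left; have [c' [k1 [k2 k3]]] := wm _ _ c1 hx' K; exact: ext_of hj hr0' k1 k2 k3.
by right; have [c' [k1 [k2 k3]]] := wp _ _ c1 hx' K; exact: ext_of hj hr0' k1 k2 k3.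
Qed.

Lemma task_dense p y : inS y -> exists y', leP y' y /\ task_done p y'.
Proof.
move=> hy; case: (classic (rel l1 p p0)) => hp; last first.
  by exists y; split; [exact: leP_refl|].
have [F [S [E [hT _]]]] := hy; subst y.
have [p' [t1 [h1 h2]]] : exists b t, rel l1 b p /\ rel F b t by case: hT => _ [_ [_ [_ k]]]; exact: k.
have [hp'1 _] := le_p _ _ hp1 _ _ h1.
have [pa [pb [ha [hb hinc]]]] := hnt p' hp'1.
have [_ [_ [dn _]]] := hT; have hFa := dn _ _ _ h2 ha; have hFb := dn _ _ _ h2 hb.
have [x [hx [[r1 [S1 [m1 e1]]] [r2 [S2 [m2 e2]]]]]] := split_exists F S pa t1 hy hFa.
have pr r b : rel m r (opair b t1) -> exists u su, r = opair u su /\ rel l1 u b.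
  move=> h; have [u [su [_ [_ [Er _]]]]] := relm_pair _ _ _ _ _ _ hit _ _ h; subst r.
  by exists u, su; split=> //; move/relm: h => [_ [_ []]].
have [u1 [su1 [E1 l1']]] := pr _ _ m1; have [u2 [su2 [E2 l2']]] := pr _ _ m2; subst r1 r2.
(* The side [pb] is decided first, in whichever way is possible; the side [pa], where both answers
   are open, then supplies the opposite one. *)
case: (decide_exists F S pb t1 x hy hFb hx) => -[r3 [S3 [m3 e3]]];
  have [u3 [su3 [E3 l3']]] := pr _ _ m3; subst r3.
  have [F' [S' [k1 [k2 k3]]]] := mix_terms F S pa pb t1 u2 su2 S2 u3 su3 S3 x tDm tDp hy hFa hFb hinc m2 m3 e2 e3.
  exists (opair F' S'); split=> // _; exists F', S', x; split=> //; split=> //; exists u3, u2.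
  split; first by apply: p1T l3' _; exact: p1T h1.
  by split; first by apply: p1T l2' _; exact: p1T h1.
have [F' [S' [k1 [k2 k3]]]] := mix_terms F S pa pb t1 u1 su1 S1 u3 su3 S3 x tDp tDm hy hFa hFb hinc m1 m3 e1 e3.
exists (opair F' S'); split=> // _; exists F', S', x; split=> //; split=> //; exists u1, u3.
split; first by apply: p1T l1' _; exact: p1T h1.
by split; first by apply: p1T l3' _; exact: p1T h1.
Qed.

Variable b0 : V.
Hypothesis hb0 : b0 ∈ d.
Hypothesis hcl : injects p1 b0.
Hypothesis hSM : forall a, a ∈ SM <-> sub a X /\ injects a b0.

Lemma core_false : False.
Proof.
have [lS [hlS [hpo [hS [fS stS]]]]] := S_closed.
have [e [he je]] := hcl.
have [||y [/in_sS hy hall]] := strategic_distributive sS lS s hS d hpo od hs fS stS p1 b0 e task_done hb0 he je dtask.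
- by move=> p y hp /in_sS hy; have [y' [k1 k2]] := task_dense p y hy; exists y'; rewrite hlS.
- by move=> p y y' h /hlS; exact: task_open.
have [F [S [Ey [hT [_ hC]]]]] := hy; subst y.
pose proof (dsplits F S) as dsp.
have [ch [fch hch]] := choose (fun p x => splits p F S x) p1 dsp.
have [a ha] : is_set (fun x => x ∈ X /\ exists p, p ∈ p1 /\ (rel ch p x /\ splits p F S x)).
  by apply: is_set_sep; df.
have haSM : a ∈ SM.
  apply/hSM; split; first by move=> x /ha [].
  apply: (injects_rel (fun x b => exists p, rel ch p x /\ rel e p b)).
  - exact: ord_in hb0.
  - by df.
  - move=> x /ha [_ [p [k1 [k2 _]]]]; have [b hb] := proj2 (proj2 he) p k1.
    by exists b; split; [case: (rel_onP _ _ _ _ _ (proj1 he) hb)|exists p].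
  - move=> x x' b _ _ [p [k1 k2]] [p' [k1' k2']].
    by have Ep := je _ _ _ k2 k2'; subst p'; exact: fch k1 k1'.
have hp0 : p0 ∈ p1 by case/inq: hr0.
have [a1 [t1 [h1 h2]]] : exists b t, rel l1 b p0 /\ rel F b t.
  by case: hT => _ [_ [_ [_ k]]]; apply: k; exact: p1R.
have hr1 : rel m (opair a1 t1) (opair p0 t0) by case: hT => _ [k _]; exact: k.
have [j hj] := gext_exists hcV q m hq _ (T_q _ _ _ hT h2); have E := j_emb j.
have [cY [c00 [mp [mm [dis [wp [wm [apx [nd un]]]]]]]]] := H1 j (j_up j _ _ hj hr1).
have [c1 c2] := hC _ _ h2 j hj.
have [|c' [B' [k1 [k2 [k3 k4]]]]] := apx (gi j a) (svl j S) _ c1 c2; first exact/(emb_mem _ E).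
have [B EB] := emb_tr _ E _ _ k3; subst B'.
have [S' [i1 i2]] := subset_name hcV q m hq j Y c' (cY _ k1); subst c'.
have [||r' [hr' hf]] := gforces_truth hcV q m hq (fun j e => sval (gG j) (e 0) ∈ vl (gG j) (gi j tC) /\
    sub (sval (gG j) (gi j S)) (sval (gG j) (e 0)) /\ forall x : gN j, x ∈ gi j a ->
    (x ∈ gi j B -> rel (vl (gG j) (gi j tDp)) (sval (gG j) (e 0)) x) /\
    (x ∉ gi j B -> rel (vl (gG j) (gi j tDm)) (sval (gG j) (e 0)) x)) j (fun _ => S').
- by df.
- by [].
have [r2 [hr2 [m1 m2]]] := j_dir j _ _ hj hr'.
have [a2 [t2 [_ [_ [Er _]]]]] := relm_pair _ _ _ _ _ _ hit _ _ m1; subst r2.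
move/relm: (m1) => [q2 [_ [l21 _]]].
have [ha2 _] := le_p _ _ hp1 _ _ l21.
(* The point examined is the one chosen for [a2] itself, the first coordinate of a condition that
   already forces the trace on [a] to be [B]. *)
have [F2 [S2 [x0 [/opair_inj [EF ES] hsp0]]]] := hall a2 ha2 (p1T _ _ _ l21 h1); subst F2 S2.
have [x [hx hsp]] := hch a2 ha2 (ex_intro _ x0 hsp0).
have hxa : x ∈ a by apply/ha; case: (hsp) => hxX _; split=> //; exists a2.
have [hxX [u [u' [hu [hu' [dp dm]]]]]] := hsp.
(* Shrinking the first coordinate of [(a2, t2)] to [w] preserves the forced trace, while the pair
   [(w, t1)] of the term activates the decision attached to [w]. *)
have at_u w : rel l1 w a2 -> exists j' : Jq, core (gi j' Y) (gi j' X) (gi j' SM) (gi j' PX) (gi j' (sc d))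
     (nvl j' tC) (nvl j' tDp) (nvl j' tDm) (svl j' S0) /\ gi j' (opair w t1) ∈ gG j' /\ gi j' r' ∈ gG j'.
  move=> hw; have [q3 m3] := q_down _ _ _ q2 hw.
  have [j' hj'] := gext_exists hcV q m hq _ q3; exists j'.
  have hj2 := j_up j' _ _ hj' m3.
  split; first by apply: H1; apply: j_up (j_up j' _ _ hj2 m1) hr1.
  by split; [apply: j_up hj' _; exact: m_restrict m1 hw|exact: j_up hj2 m2].
have Fw w : rel l1 w a2 -> rel F w t1.
  by move=> hw; case: hT => _ [_ [k _]]; apply: k h2 _; exact: p1T l21.
have hself w : rel l1 w a2 -> rel l1 w w by move=> hw; apply: p1R; case: (le_p _ _ hp1 _ _ hw).
have inB : x ∈ B.
  apply: NNPP => nB; have [j' [co [g1 g2]]] := at_u u hu; have E' := j_emb j'.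
  have [_ [_ [mp' [_ [dis' _]]]]] := co; have [f1 [f2 f3]] := hf j' g2.
  have hxa' : gi j' x ∈ gi j' a by apply/(emb_mem _ E').
  have [_ f4] := f3 _ hxa'.
  have nB' : gi j' x ∉ gi j' B by move/(emb_mem _ E').
  apply: (dis' _ _ _ (f4 nB')); apply: (mp' (svl j' S)) => //.
    by case: (hC _ _ (Fw u hu) j' g1).
  exact: (dp _ _ (Fw u hu) (hself u hu) j' g1).
have [j' [co [g1 g2]]] := at_u u' hu'; have E' := j_emb j'.
have [_ [_ [_ [mm' [dis' _]]]]] := co; have [f1 [f2 f3]] := hf j' g2.
have hxa' : gi j' x ∈ gi j' a by apply/(emb_mem _ E').
have [f4 _] := f3 _ hxa'.
have inB' : gi j' x ∈ gi j' B by apply/(emb_mem _ E').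
apply: (dis' _ _ (f4 inB')); apply: (mm' (svl j' S)) => //.
  by case: (hC _ _ (Fw u' hu') j' g1).
exact: (dm _ _ (Fw u' hu') (hself u' hu') j' g1).
Qed.

End Terms.

(** * Generic filters for equivalent posets *)

Section Equivalent.
Context {V : structure} {HV : ZFC V}.
Variables P lP q m r n e e' : V.
Hypothesis hP : is_poset P lP.
Hypothesis hq : is_poset q m.
Hypothesis hr : is_poset r n.
Hypothesis he : dense_embedding e P lP r n.
Hypothesis he' : dense_embedding e' q m r n.
Implicit Types a b c x y z : V.
Notation D := (Def (single V)).
Notation E := (ap e).
Notation E' := (ap e').

Lemma E_rel a : a ∈ P -> rel e a (E a) /\ E a ∈ r.
Proof.
case: he => [[on [fe te]] _] ha; have [x hx] := te a ha; rewrite (ap_eq _ _ _ fe hx).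
by split=> //; case: (rel_onP _ _ _ _ _ on hx).
Qed.
Lemma E'_rel a : a ∈ q -> rel e' a (E' a) /\ E' a ∈ r.
Proof.
case: he' => [[on [fe te]] _] ha; have [x hx] := te a ha; rewrite (ap_eq _ _ _ fe hx).
by split=> //; case: (rel_onP _ _ _ _ _ on hx).
Qed.
Lemma E_mono a b : rel lP a b -> rel n (E a) (E b).
Proof.
move=> h; have [ha hb] := le_p _ _ hP _ _ h; case: he => _ [k _].
by apply: k h; [case: (E_rel a ha)|case: (E_rel b hb)].
Qed.
Lemma E'_mono a b : rel m a b -> rel n (E' a) (E' b).
Proof.
move=> h; have [ha hb] := le_p _ _ hq _ _ h; case: he' => _ [k _].
by apply: k h; [case: (E'_rel a ha)|case: (E'_rel b hb)].
Qed.
Lemma E_compat a b : a ∈ P -> b ∈ P -> rel n (E a) (E b) -> exists c, rel lP c a /\ rel lP c b.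
Proof.
move=> ha hb h; have [h1 h2] := E_rel a ha; have [h3 h4] := E_rel b hb; case: he => _ [_ [k _]].
have [|c [_ [k1 k2]]] := k _ _ _ _ h1 h3; last by exists c.
by exists (E a); split=> //; split=> //; exact: (le_refl _ _ hr).
Qed.
Lemma E'_compat a b : a ∈ q -> b ∈ q -> rel n (E' a) (E' b) -> exists c, rel m c a /\ rel m c b.
Proof.
move=> ha hb h; have [h1 h2] := E'_rel a ha; have [h3 h4] := E'_rel b hb; case: he' => _ [_ [k _]].
have [|c [_ [k1 k2]]] := k _ _ _ _ h1 h3; last by exists c.
by exists (E' a); split=> //; split=> //; exact: (le_refl _ _ hr).
Qed.
Lemma E_below x : x ∈ r -> exists a, a ∈ P /\ rel n (E a) x.
Proof.
case: he => [[on [fe _]] [_ [_ k]]] /k [a [x' [h1 h2]]]; exists a.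
by rewrite (ap_eq _ _ _ fe h1); case: (rel_onP _ _ _ _ _ on h1).
Qed.
Lemma E'_below x : x ∈ r -> exists a, a ∈ q /\ rel n (E' a) x.
Proof.
case: he' => [[on [fe _]] [_ [_ k]]] /k [a [x' [h1 h2]]]; exists a.
by rewrite (ap_eq _ _ _ fe h1); case: (rel_onP _ _ _ _ _ on h1).
Qed.
(** Density of [e] gives [a] with image below [E' y]; compatibility is reflected by [e], so [a] and
    [b] have a common extension. *)
Lemma E_step b y : b ∈ P -> y ∈ q -> rel n (E' y) (E b) -> exists c, rel lP c b /\ rel n (E c) (E' y).
Proof.
move=> hb hy h; have [_ hy'] := E'_rel y hy; have [a [ha k]] := E_below _ hy'.
have [c [c1 c2]] := E_compat a b ha hb (le_trans _ _ hr _ _ _ k h).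
by exists c; split=> //; apply: (le_trans _ _ hr) k; exact: E_mono.
Qed.

Variables (N : structure) (i : V -> N) (G : N).
Hypothesis hN : generic_extension V P lP N i G.

(** [G'] consists of the conditions of [q] lying above some member of [G] in the common poset; its
    filter properties are density arguments in [P]. In turn [R] recovers [G] from [G'], so names can
    be translated. *)
Lemma equiv_generic : exists G', generic_extension V q m N i G'.
Proof.
pose proof (gen_zfc _ _ _ _ _ _ hN) as HN.
have hi := gen_emb hN; have hG := inG_filter _ _ _ _ _ hN.
have [R [_ hR]] := relset (fun y a => rel n (E' y) (E a)) q P ltac:(df).
have [Q [_ hQ]] := relset (fun a y => rel n (E a) (E' y)) P q ltac:(df).
have [G' hG'] : is_set (fun Y => Y ∈ i q /\ exists A, A ∈ G /\ rel (i Q) A Y) by apply: is_set_sep; df.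
have inG' y : i y ∈ G' <-> y ∈ q /\ exists a, inG N i G a /\ rel n (E a) (E' y).
  rewrite hG' (emb_mem _ hi); split=> [[hy [A [hA /(emb_rel_inv _ hi) [a [y' [EA [/(emb_inj _ hi) <- /hQ [_ [_ k]]]]]]]]]|].
    by subst A; split=> //; exists a.
  move=> [hy [a [ha k]]]; split=> //; exists (i a); split=> //; apply/(emb_rel _ hi)/hQ; split=> //.
  exact: (g_sub _ _ _ hG).
have GP a : inG N i G a -> a ∈ P by exact: (g_sub _ _ _ hG).
have below Dn a := @gfilter_below V HV P lP hP (inG N i G) Dn a hG.
exists G'; apply: (change_forcing P lP N i G hN q m R G').
- by move=> Y /hG' [].
- have [a Ga] := g_ne _ _ _ hG.
  have [||c [Gc [_ [y [hy k]]]]] := below (fun c => exists y, y ∈ q /\ rel n (E c) (E' y)) a _ Ga; first by df.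
    move=> b hb; have [b_P _] := le_p _ _ hP _ _ hb; have [_ hEb] := E_rel b b_P.
    have [y [hy k]] := E'_below _ hEb; have [c [c1 c2]] := E_step b y b_P hy k.
    by exists c; split=> //; exists y.
  by exists (i y); apply/inG'; split=> //; exists c.
- move=> y y' /inG' [hy [a [Ga k]]] h; apply/inG'; split; first by case: (le_p _ _ hq _ _ h).
  by exists a; split=> //; apply: (le_trans _ _ hr) k _; exact: E'_mono.
- move=> y y' /inG' [hy [a [Ga k]]] /inG' [hy' [a' [Ga' k']]].
  have [b0 [Gb [b1 b2]]] := g_dir _ _ _ hG _ _ Ga Ga'.
  have [||c [Gc [_ [z [z1 [z2 z3]]]]]] := below
    (fun c => exists z, rel m z y /\ rel m z y' /\ rel n (E c) (E' z)) b0 _ Gb; first by df.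
    move=> b hb; have [b_P _] := le_p _ _ hP _ _ hb; have [_ hEb] := E_rel b b_P.
    have kb : rel n (E b) (E' y).
      by apply: (le_trans _ _ hr) k; apply: E_mono; exact: (le_trans _ _ hP _ b0).
    have kb' : rel n (E b) (E' y').
      by apply: (le_trans _ _ hr) k'; apply: E_mono; exact: (le_trans _ _ hP _ b0).
    have [z0 [hz0 i0]] := E'_below _ hEb.
    have [z1 [j1 j2]] := E'_compat z0 y hz0 hy (le_trans _ _ hr _ _ _ i0 kb).
    have [hz1 _] := le_p _ _ hq _ _ j1.
    have i1 : rel n (E' z1) (E b) by apply: (le_trans _ _ hr) i0; exact: E'_mono.
    have [z2 [j3 j4]] := E'_compat z1 y' hz1 hy' (le_trans _ _ hr _ _ _ i1 kb').
    have [hz2 _] := le_p _ _ hq _ _ j3.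
    have i2 : rel n (E' z2) (E b) by apply: (le_trans _ _ hr) i1; exact: E'_mono.
    have [c [c1 c2]] := E_step b z2 b_P hz2 i2.
    by exists c; split=> //; exists z2; split=> //; exact: (le_trans _ _ hq _ z1).
  exists z; split=> //; apply/inG'; split; last by exists c.
  by case: (le_p _ _ hq _ _ z1).
- move=> d [hd1 hd2]; have [a Ga] := g_ne _ _ _ hG.
  have [||c [Gc [_ [z [hz k]]]]] := below (fun c => exists z, z ∈ d /\ rel n (E c) (E' z)) a _ Ga; first by df.
    move=> b hb; have [b_P _] := le_p _ _ hP _ _ hb; have [_ hEb] := E_rel b b_P.
    have [z0 [hz0 i0]] := E'_below _ hEb; have [z [hz j1]] := hd2 z0 hz0.
    have [|c [c1 c2]] := E_step b z b_P (hd1 _ hz); last by exists c; split=> //; exists z.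
    by apply: (le_trans _ _ hr) i0; exact: E'_mono.
  by exists z; split=> //; apply/inG'; split; [exact: hd1|exists c].
- move=> a; split=> [Ga|[y [/inG' [hy [a0 [Ga0 k]]] /hR [_ [ha k']]]]].
    have [||c [Gc [_ [y [hy [k1 k2]]]]]] := below
      (fun c => exists y, y ∈ q /\ rel n (E c) (E' y) /\ rel n (E' y) (E a)) a _ Ga; first by df.
      move=> b hb; have [b_P a_P] := le_p _ _ hP _ _ hb; have [_ hEb] := E_rel b b_P.
      have [y [hy i0]] := E'_below _ hEb; have [c [c1 c2]] := E_step b y b_P hy i0.
      exists c; split=> //; exists y; split=> //; split=> //.
      by apply: (le_trans _ _ hr) i0 _; exact: E_mono.
    by exists y; split; [apply/inG'; split=> //; exists c|apply/hR; split=> //; split=> //; exact: GP].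
  have [||c [Gc [_ k1]]] := below (fun c => rel lP c a) a0 _ Ga0; first by df.
    move=> b hb; have [b_P _] := le_p _ _ hP _ _ hb.
    have [|c [c1 c2]] := E_compat b a b_P ha; last by exists c.
    apply: (le_trans _ _ hr) (E_mono _ _ hb) _; exact: (le_trans _ _ hr) k k'.
  exact: (g_up _ _ _ hG c a Gc k1).
Qed.
End Equivalent.

Lemma emb_prod {M N : structure} {HM : ZF M} {HN : ZF N} (k : M -> N) (hk : tr_emb k) (a b : M) :
  k (prod a b) = prod (k a) (k b).
Proof.
apply: ext => Z; rewrite (emb_in _ hk) in_prod; split.
  move=> [z [/in_prod [x [y [-> [hx hy]]]] ->]]; exists (k x), (k y).
  by rewrite (emb_opair _ hk) !(emb_mem _ hk).
move=> [X [Y [-> [/(emb_in _ hk) [x [hx ->]] /(emb_in _ hk) [y [hy ->]]]]]].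
by exists (opair x y); rewrite opair_prod (emb_opair _ hk).
Qed.

(** * The approximation property *)

Section Approximation.
Context {V : structure} {HV : ZFC V} (hcV : countable V).
Variables p1 l1 p2 l2 q m d b0 Y : V.
Hypothesis hp1 : is_poset p1 l1.
Hypothesis hnt : nontrivial p1 l1.
Hypothesis od : is_ord d.
Hypothesis hb0 : b0 ∈ d.
Hypothesis hcl : injects p1 b0.
Hypothesis hfc : forall a, a ∈ p1 -> forces p1 l1 a (name_closed_poset p2 l2 d).
Hypothesis hit : is_iteration p1 l1 p2 l2 q m.
Hypothesis qne : nonempty q.

Let hq : is_poset q m := hq p1 l1 p2 l2 q m d hp1 hfc hit qne.
Notation nvl j t := (vl (gG j) (gi j t)).
Notation svl j t := (sval (gG j) (gi j t)).

(** All data receive names and a condition forces [core]. A second condition, of the first factor,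
    forces that [th] names a winning strategy; its set of stages is absolute and so comes from [V].
    A common first coordinate [p0] makes both facts forced, as the term forcing requires. *)
Lemma no_core (j : gext V q m) (X SM : V) (C Dp Dm c0 : gN j) :
  (forall a, a ∈ SM <-> sub a X /\ injects a b0) ->
  ~ core (gi j Y) (gi j X) (gi j SM) (gi j (pw X)) (gi j (sc d)) C Dp Dm c0.
Proof.
move=> hSM hco.
have [tC EC] := j_name j C; have [tDp EDp] := j_name j Dp; have [tDm EDm] := j_name j Dm; subst C Dp Dm.
have [cY [hc0 _]] := hco.
have [S0 [hS0 E0]] := subset_name hcV q m hq j Y c0 (cY _ hc0); subst c0.
have [||r0 [hjr0 hr0]] := gforces_truth hcV q m hq (fun j e => core (gi j Y) (gi j X) (gi j SM) (gi j (pw X))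
  (gi j (sc d)) (vl (gG j) (gi j tC)) (vl (gG j) (gi j tDp)) (vl (gG j) (gi j tDm)) (sval (gG j) (gi j S0)))
  j (fun _ => d); [by rewrite /core; df|by []|].
have hr0q := j_p j _ hjr0.
have [pa [t0 Er]] := q_pair _ _ _ _ _ _ hit _ hr0q; subst r0.
have [s hs] := stages_exist d od.
have hpa : pa ∈ p1 by case/(inq _ _ _ _ _ _ hit): hr0q.
have [j1 hj1] := gext_exists hcV p1 l1 hp1 pa hpa; have E1 := j_emb j1.
have [_ [s' [h [hs' [fh st]]]]] := closed_j p1 l1 p2 l2 d hfc j1.
have Es : s' = gi j1 s.
  apply: (stages_unique s' _ (gi j1 d)) => //; first exact/(emb_ord _ E1).
  exact: (emb_stages _ E1).
subst s'; have [th Eh] := j_name j1 h; subst h.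
have [||pb [hpb hst]] := gforces_truth hcV p1 l1 hp1 (fun j e => functional (vl (gG j) (gi j th)) /\
  forall a f, a ∈ gi j s -> play_following (vl (gG j) (gi j p2)) (vl (gG j) (gi j l2)) (gi j s)
    (vl (gG j) (gi j th)) f a -> exists x, rel (vl (gG j) (gi j th)) f x /\ x ∈ vl (gG j) (gi j p2) /\
    forall b y, rel f b y -> rel (vl (gG j) (gi j l2)) x y) j1 (fun _ => d); [by df|by []|].
have [p0 [hp0 [k1 k2]]] := j_dir j1 _ _ hj1 hpb.
have [hr1 hm1] := q_down p1 l1 p2 l2 q m d hp1 hfc hit _ _ _ hr0q k1.
apply: (core_false hcV p1 l1 p2 l2 q m d hp1 hfc hit p0 t0 th tC tDp tDm S0 Y X SM (pw X) s hr1 od hs hS0 _ _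
  hnt _ b0 hb0 hcl hSM) => //.
- by move=> j' hj'; apply: (hr0 j'); exact: (j_up j' _ _ hj' hm1).
- by move=> j' hj'; apply: (hst j'); exact: (j_up j' _ _ hj' k2).
Qed.

Variables (N : structure) (i : V -> N) (Gq : N).
Hypothesis hN : generic_extension V q m N i Gq.
Variables (C lC : N).
Hypothesis hC : is_poset C lC.
Hypothesis relC : forall f g, rel lC f g <-> f ∈ C /\ g ∈ C /\ sub g f.
Hypothesis CY : forall c, c ∈ C -> sub c (i Y).
Hypothesis Cun : forall a f u, a ∈ i (sc d) -> nonempty a -> functional f -> (forall b, b ∈ a -> exists c, rel f b c) ->
     (forall b c, rel f b c -> b ∈ a /\ c ∈ C) ->
     (forall b b' c c', b ∈ b' -> rel f b c -> rel f b' c' -> sub c c') ->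
     (forall z, z ∈ u <-> exists b c, rel f b c /\ z ∈ c) -> u ∈ C.
Hypothesis hcN : countable N.
Variables (W : structure) (k : N -> W) (g : W).
Hypothesis hW : generic_extension N C lC W k g.

(** Failure is forced by some [c0] in the collapse. Recording on sets which conditions force a point
    into or out of A yields [Dp] and [Dm], so the situation is described by [core] in the extension
    by [q] alone. *)
Theorem approximation (X : V) (A : W) : sub A (k (i X)) ->
  (forall a, sub a X -> injects a b0 -> exists b, forall z, z ∈ k (i b) <-> z ∈ A /\ z ∈ k (i a)) ->
  exists B, k (i B) = A.
Proof.
move=> sA hap; apply: NNPP => nA.
pose proof (gen_zfc _ _ _ _ _ _ hN) as HN; pose proof (gen_zfc _ _ _ _ _ _ hW) as HW.
have hi := gen_emb hN; have hk := gen_emb hW.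
have [SM hSM] : is_set (fun a => sub a X /\ injects a b0).
  by apply: (is_set_sub (pw X)) => [a [h _]|]; [apply/in_pw|df].
pose jW := Gext _ _ _ _ _ _ hW.
have [t Et] := j_name jW A; rewrite /= in Et.
pose psi (j : idx (gfam N C lC)) (e : ev (gfam N C lC) j) :=
  (forall a, a ∈ gi j (i SM) -> exists b, b ∈ gi j (i (pw X)) /\
     forall x, x ∈ a -> (x ∈ vl (gG j) (gi j t) <-> x ∈ b)) /\
  forall b, b ∈ gi j (i (pw X)) -> ~ forall x, x ∈ gi j (i X) -> (x ∈ vl (gG j) (gi j t) <-> x ∈ b).
have [||c0 [hc0 hpsi]] := gforces_truth hcN C lC hC psi jW (fun _ => C).
- by rewrite /psi; df.
- rewrite /psi /= -Et; split.
    move=> a /(emb_in _ hk) [a' [/(emb_in _ hi) [a0 [/hSM [h1 h2] ->]] ->]].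
    have [b hb] := hap a0 h1 h2; exists (k (i b)); split.
      apply/(emb_mem _ hk)/(emb_mem _ hi)/in_pw => z hz; apply: h1.
      by apply/(emb_mem _ hi)/(emb_mem _ hk); case: (proj1 (hb (k (i z)))) => //; apply/(emb_mem _ hk)/(emb_mem _ hi).
    move=> x hx; rewrite hb; tauto.
  move=> b /(emb_in _ hk) [b' [/(emb_in _ hi) [b1 [/in_pw hb1 ->]] ->]] H; apply: nA; exists b1.
  apply: ext => z; split=> hz; last by apply/H => //; exact: sA.
  by apply/H => //; move: z hz; apply/(emb_sub _ hk)/(emb_sub _ hi).
have c0C : c0 ∈ C by exact: j_p hc0.
pose fin x c := forall j : gext N C lC, gi j c ∈ gG j -> gi j x ∈ vl (gG j) (gi j t).
pose fout x c := forall j : gext N C lC, gi j c ∈ gG j -> gi j x ∉ vl (gG j) (gi j t).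
have din : Def (single N) (fun j e => fin (e 1) (e 0)).
  exact: (dgforces hcN C lC hC (fun j e => e 0 ∈ vl (gG j) (gi j t)) ltac:(df)).
have dout : Def (single N) (fun j e => fout (e 1) (e 0)).
  exact: (dgforces hcN C lC hC (fun j e => e 0 ∉ vl (gG j) (gi j t)) ltac:(df)).
have [Dp [_ hDp]] := relset (fun c x => fin x c) C (i X) din.
have [Dm [_ hDm]] := relset (fun c x => fout x c) C (i X) dout.
pose j0 := Gext _ _ _ _ _ _ hN.
apply: (no_core j0 X SM C Dp Dm c0 hSM); rewrite /core /=.
have pick c : c ∈ C -> exists j : gext N C lC, gi j c ∈ gG j by exact: gext_exists.
have up (j : gext N C lC) c c' : gi j c' ∈ gG j -> c ∈ C -> c' ∈ C -> sub c c' -> gi j c ∈ gG j.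
  by move=> h h1 h2 h3; apply: (j_up j _ _ h); apply/relC.
have common (j : gext N C lC) c c' : gi j c ∈ gG j -> gi j c' ∈ gG j ->
    exists c2, c2 ∈ C /\ sub c c2 /\ sub c' c2.
  by move=> h h'; have [c2 [_ [/relC [? [_ ?]] /relC [_ [_ ?]]]]] := j_dir j _ _ h h'; exists c2.
split; first exact: CY.
split=> //.
split; first by move=> c c' x h1 h2 h3 /hDp [_ [hx h]]; apply/hDp; split=> //; split=> // j hj; apply: h; exact: (up j c c').
split; first by move=> c c' x h1 h2 h3 /hDm [_ [hx h]]; apply/hDm; split=> //; split=> // j hj; apply: h; exact: (up j c c').
split.
  by move=> c x /hDp [hc [_ h]] /hDm [_ [_ h']]; have [j hj] := pick c hc; exact: (h' j hj (h j hj)).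
split.
  move=> c x hc hx nD.
  have [j [hj hxj]] : exists j : gext N C lC, gi j c ∈ gG j /\ gi j x ∉ vl (gG j) (gi j t).
    apply: NNPP => K; apply: nD; apply/hDp; split=> //; split=> // j hj; apply: NNPP => hn; apply: K; by exists j.
  have [||c1 [hc1 hf]] := gforces_truth hcN C lC hC (fun j e => e 0 ∉ vl (gG j) (gi j t)) j (fun _ => x); [by df|by []|].
  have [c2 [h1 [h2 h3]]] := common j c c1 hj hc1; exists c2; split=> //; split=> //.
  apply/hDm; split=> //; split=> // j' hj'; apply: (hf j'); apply: (up j' c1 c2) => //; exact: j_p hc1.
split.
  move=> c x hc hx nD.
  have [j [hj hxj]] : exists j : gext N C lC, gi j c ∈ gG j /\ gi j x ∈ vl (gG j) (gi j t).
    apply: NNPP => K; apply: nD; apply/hDm; split=> //; split=> // j hj hn; apply: K; by exists j.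
  have [||c1 [hc1 hf]] := gforces_truth hcN C lC hC (fun j e => e 0 ∈ vl (gG j) (gi j t)) j (fun _ => x); [by df|by []|].
  have [c2 [h1 [h2 h3]]] := common j c c1 hj hc1; exists c2; split=> //; split=> //.
  apply/hDp; split=> //; split=> // j' hj'; apply: (hf j'); apply: (up j' c1 c2) => //; exact: j_p hc1.
split.
  move=> a c ha hc h0; have [j hj] := pick c hc; have E := j_emb j.
  have [p1' _] := hpsi j (up j c0 c hj c0C hc h0).
  have [|B [/(emb_in _ E) [b [hb EB]] hx]] := p1' (gi j a); [exact/(emb_mem _ E)|subst B].
  have [||c1 [hc1 hf]] := gforces_truth hcN C lC hC
    (fun j e => forall x, x ∈ e 0 -> (x ∈ vl (gG j) (gi j t) <-> x ∈ e 1)) j (scons a (fun _ => b)); [by df|by []|].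
  have [c2 [h1 [h2 h3]]] := common j c c1 hj hc1; exists c2, b; split=> //; split=> //; split=> // x hxa.
  have hxX : x ∈ i X.
    move/(emb_in _ hi): ha => [a0 [/hSM [hs _] Ea]]; subst a.
    by move: x hxa; apply/(emb_sub _ hi).
  have key (j' : gext N C lC) : gi j' c2 ∈ gG j' -> gi j' x ∈ vl (gG j') (gi j' t) <-> x ∈ b.
    move=> hj'; rewrite -(emb_mem _ (j_emb j')); apply: (hf j'); last exact/(emb_mem _ (j_emb j')).
    by apply: (up j' c1 c2) => //; exact: j_p hc1.
  split=> hxb; [apply/hDp|apply/hDm]; split=> //; split=> // j' hj'; by rewrite (key j' hj').
split; last exact: Cun.
move=> c b hc h0 hb H; have [j hj] := pick c hc; have E := j_emb j.
have [_ p2'] := hpsi j (up j c0 c hj c0C hc h0).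
apply: (p2' (gi j b)); first exact/(emb_mem _ E).
move=> x' /(emb_in _ E) [x [hx ->]]; have [h1 h2] := H x hx; rewrite (emb_mem _ E).
case: (classic (x ∈ b)) => hxb; [have /hDp [_ [_ h]] := h1 hxb|have /hDm [_ [_ h]] := h2 hxb];
  have := h j hj; tauto.
Qed.
End Approximation.

(** * Measures *)

Section Measure.
Context {W : structure} {HW : ZFC W} (K U : W).
Hypothesis hK : uncountable_card K.
Hypothesis hU : complete_ultrafilter K K U.
Hypothesis np : nonprincipal U.
Implicit Types a b c f g x y z w : W.
Notation D := (Def (single W)).

(** The predicate is only required to hold on a set of [U], so it need not be definable;
    definability is asked where the set itself has to be formed. *)
Definition ae (P : W -> Prop) := exists s, s ∈ U /\ forall a, a ∈ s -> P a.

Let cK : is_card K. Proof. by case: hK. Qed.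
Let oK : is_ord K. Proof. by case: cK. Qed.

Lemma U_sub s a : s ∈ U -> a ∈ s -> a ∈ K.
Proof. by case: hU => k _ /k; apply. Qed.
Lemma U_nonempty s : s ∈ U -> nonempty s.
Proof.
move=> hs; apply: NNPP => n; have [_ [hKU [_ [co _]]]] := hU.
have E : s = emp K by apply: emp_unique => // -[z /in_emp].
have := co K (emp K) (fun z hz => hz); case.
  by move=> z; split=> [/in_emp//|[]].
by move=> k _; apply: (k hKU); rewrite -E.
Qed.
Lemma ae_mono (P Q : W -> Prop) : ae P -> (forall a, a ∈ K -> P a -> Q a) -> ae Q.
Proof. by move=> [s [hs h]] k; exists s; split=> // a ha; apply: k; [exact: U_sub ha|exact: h]. Qed.
Lemma ae_ex (P : W -> Prop) : ae P -> exists a, a ∈ K /\ P a.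
Proof. by move=> [s [hs h]]; have [a ha] := U_nonempty s hs; exists a; split; [exact: U_sub ha|exact: h]. Qed.
Lemma ae_true (P : W -> Prop) : (forall a, a ∈ K -> P a) -> ae P.
Proof. by move=> h; exists K; split=> //; case: hU => _ []. Qed.
Lemma ae_dich (P : W -> Prop) : D (fun j e => P (e 0)) -> ae P \/ ae (fun a => ~ P a).
Proof.
move=> dP; have [s hs] := is_set_sep K P dP; have [t ht] := is_set_sep K (fun a => ~ P a) ltac:(df).
have [_ [_ [_ [co _]]]] := hU.
have [|h1 h2] := co s t (fun z hz => proj1 (proj1 (hs z) hz)).
  move=> z; rewrite ht hs; tauto.
case: (classic (s ∈ U)) => h; first by left; exists s; split=> // a /hs [].
by right; exists t; split; [apply: NNPP; tauto|move=> a /ht []].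
Qed.

Lemma ae_all (P : W -> W -> Prop) c : D (fun j e => P (e 0) (e 1)) -> card_lt c K ->
  (forall x, x ∈ c -> ae (P x)) -> ae (fun a => forall x, x ∈ c -> P x a).
Proof.
(* Completeness is stated for nonempty families, so an empty index set is treated apart. *)
move=> dP hc h; case: (classic (nonempty c)) => [[x0 hx0]|n]; last first.
  by apply: ae_true => a _ x hx; case: n; exists x.
have sP x : is_set (fun a => a ∈ K /\ P x a) by apply: is_set_sep; df.
pose S x := mk K (fun a => a ∈ K /\ P x a).
have dS : D (fun j e => e 0 = S (e 1)).
  refine (Def_eq _ _ _ _); first by df.
  by apply: DT_mk => [j e|]; [exact: sP|df].
have [_ [_ [up [_ un]]]] := hU.
have SU x : x ∈ c -> S x ∈ U.
  move=> hx; have [s [hs k]] := h x hx; apply: (up s _ hs).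
    by move=> a ha; apply/(in_mk _ _ (sP x)); split; [exact: U_sub ha|exact: k].
  by move=> a /(in_mk _ _ (sP x)) [].
have [f hf] := is_set_img c S dS.
have [b hb] : is_set (fun z => z ∈ K /\ forall a, a ∈ f -> z ∈ a) by apply: is_set_sep; df.
exists b; split; last first.
  move=> a /hb [_ k] x hx; have : a ∈ S x by apply: k; apply/hf; exists x.
  by move/(in_mk _ _ (sP x)) => [].
apply: (un f b).
- by move=> s /hf [x [hx ->]]; exact: SU.
- by exists (S x0); apply/hf; exists x0.
- by apply: (card_lt_img c K S) => // s /hf.
- move=> z; rewrite hb; split=> [[]//|k]; split=> //.
  have : z ∈ S x0 by apply: k; apply/hf; exists x0.
  by move/(in_mk _ _ (sP x0)) => [].
Qed.

(** Intersections of two sets come from completeness for families of size less than [K]; omega lies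
    in [K] and provides [z0] and [sc z0] to count the pair. *)
Lemma ae_and (P Q : W -> Prop) : ae P -> ae Q -> ae (fun a => P a /\ Q a).
Proof.
move=> [s [hs h]] [t [ht k]]; have [_ [_ [up [_ un]]]] := hU.
have [w [ow hw]] : exists w, is_omega w /\ w ∈ K by case: hK.
have wl : is_limit w by case: ow.
have [z0 hz0] : nonempty w by case: wl => _ [].
have hz1 : sc z0 ∈ w by exact: is_limit_sc.
have hn : nonempty (upair s t) by exists s; rewrite in_upair; auto.
have [b hb] : is_set (fun z => z ∈ K /\ forall a, a ∈ upair s t -> z ∈ a) by apply: is_set_sep; df.
exists b; split; last first.
  by move=> a /hb [_ i]; split; [apply: h|apply: k]; apply: i; rewrite in_upair; auto.
apply: (un (upair s t) b) => //.
- by move=> a /in_upair [->|->].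
- exists w; split=> //.
  apply: (injects_rel (fun x y => (x = s /\ y = z0) \/ (x = t /\ y = sc z0))).
  + by case: wl.
  + by df.
  + by move=> x /in_upair [->|->]; [exists z0|exists (sc z0)]; auto.
  + move=> x x' y _ _ [[-> ->]|[-> ->]] [[-> E]|[-> E]] //.
      by case: (mem_irr z0); rewrite {2}E in_sc; auto.
    by case: (mem_irr z0); rewrite -{2}E in_sc; auto.
- move=> z; rewrite hb; split=> [[]//|i]; split=> //; apply: (U_sub s) => //; apply: i; rewrite in_upair; auto.
Qed.

Lemma ae_absurd (P : W -> Prop) : ae P -> ae (fun a => ~ P a) -> False.
Proof. by move=> h h'; have [a [_ []]] := ae_ex _ (ae_and _ _ h h'). Qed.

Lemma ae_or (P Q : W -> Prop) : D (fun j e => P (e 0)) -> ae (fun a => P a \/ Q a) -> ae P \/ ae Q.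
Proof.
move=> dP h; case: (ae_dich P dP) => k; [by left|right].
by apply: ae_mono (ae_and _ _ h k) _ => a _ [[]].
Qed.

(** Otherwise every piece is null, and by completeness so is the union of fewer than [K] pieces. *)
Lemma ae_part (R : W -> W -> Prop) c : D (fun j e => R (e 0) (e 1)) -> card_lt c K ->
  ae (fun a => exists x, x ∈ c /\ R x a) -> exists x, x ∈ c /\ ae (R x).
Proof.
move=> dR hc h; apply: NNPP => n.
have k : ae (fun a => forall x, x ∈ c -> ~ R x a).
  apply: (ae_all (fun x a => ~ R x a)) => //; first by df.
  by move=> x hx; case: (ae_dich (R x)) => //; [df|move=> hR; case: n; exists x].
by have [a [_ [[x [hx hR]] k']]] := ae_ex _ (ae_and _ _ h k); exact: k' hR.
Qed.

Lemma ae_point x : ~ ae (fun a => a = x).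
Proof.
move=> [s [hs h]]; have [a ha] := U_nonempty s hs; have Ea := h a ha; subst a.
apply: (np x s) => // w; split=> [hw|[->|->]//]; by left; exact: h.
Qed.

Lemma card_lt_elem x : x ∈ K -> card_lt x K.
Proof. by move=> hx; exists x; split=> //; exact: injects_sub. Qed.

Lemma ae_inj f y : (forall x x' y, rel f x y -> rel f x' y -> x = x') -> ~ ae (fun a => rel f a y).
Proof.
move=> jf h; have [a [ha k]] := ae_ex _ h; apply: (ae_point a); apply: ae_mono h _ => a' _ k'.
exact: jf k' k.
Qed.

(** Regularity of [K] by means of the measure: an injection of [K] into the union would almost
    everywhere land in one piece, then at one point, against injectivity. *)
Lemma small_union (R : W -> W -> Prop) a u : D (fun j e => R (e 0) (e 1)) -> card_lt a K ->
  (forall z, z ∈ u -> exists b, b ∈ a /\ R b z) ->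
  (forall b, b ∈ a -> exists c, card_lt c K /\ forall z, z ∈ u -> R b z -> z ∈ c) -> card_lt u K.
Proof.
move=> dR ha hu hc; case: (card_compare K u cK) => // -[f [[onf [ff tf]] jf]].
have [||b [hb h]] := ae_part (fun b al => exists z, rel f al z /\ R b z) a _ ha; first by df.
  apply: ae_true => al /tf [z hz]; have [_ hzu] := rel_onP _ _ _ _ _ onf hz.
  by have [b [hb hR]] := hu z hzu; exists b; split=> //; exists z.
have [c [hcs hcz]] := hc b hb.
have [||z [hz k]] := ae_part (fun z al => rel f al z) c _ hcs; first by df.
  apply: ae_mono h _ => al hal [z [h1 h2]]; exists z; split=> //; apply: hcz => //.
  by case: (rel_onP _ _ _ _ _ onf h1).
by case: (ae_inj f z jf k).
Qed.

Lemma small_adjoin c z : card_lt c K -> card_lt (cup c (upair z z)) K.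
Proof.
move=> hc; case: (card_compare K (cup c (upair z z)) cK) => // -[f [[onf [ff tf]] jf]].
have h : ae (fun al => (exists y, y ∈ c /\ rel f al y) \/ rel f al z).
  apply: ae_true => al /tf [y hy]; have [_ /in_cup [h|/in_sing h]] := rel_onP _ _ _ _ _ onf hy.
    by left; exists y.
  by right; rewrite -h.
case: (ae_or _ _ _ h) => [|h1|h1]; first by df.
  have [|y [_ k]] := ae_part (fun y al => rel f al y) c _ hc h1; first by df.
  by case: (ae_inj f y jf k).
by case: (ae_inj f z jf h1).
Qed.

(* The least such function represents kappa in the ultrapower. *)

Definition unb f := forall y, y ∈ K -> ~ ae (fun a => rel f a y).
Definition ltU f g := ae (fun a => exists x y, rel f a x /\ rel g a y /\ x ∈ y).

(** Well-foundedness of the ultrapower. Otherwise a sequence descending modulo [U] is built along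
    the internal omega; by completeness it descends at every step for a single [al], giving a
    nonempty set without minimal element. *)
Lemma least_unbounded : exists h, is_fun h K K /\ unb h /\
  forall f, is_fun f K K -> unb f -> ~ ltU f h.
Proof.
apply: NNPP => n.
have [FF hFF] : is_set (fun f => f ∈ pw (prod K K) /\ (is_fun f K K /\ unb f)).
  by apply: is_set_sep; rewrite /unb /ae; df.
have inFF f : f ∈ FF <-> is_fun f K K /\ unb f.
  rewrite hFF; split=> [[]//|h]; split=> //; apply/in_pw; apply/rel_onE; by case: h => -[].
have [id [onid hid]] := relset (fun x y => x = y) K K ltac:(df).
(* The identity starts the sequence; it is unbounded because [U] is nonprincipal. *)
have idF : id ∈ FF.
  apply/inFF; split.
    split=> //; split=> [x y y' /hid [_ [_ <-]] /hid [_ [_ <-]]//|x hx].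
    by exists x; apply/hid.
  by move=> y hy h; apply: (ae_point y); apply: ae_mono h _ => a _ /hid [_ [_ ->]].
have [c [fc hc]] := choose (fun f f' => f' ∈ FF /\ ltU f' f) FF ltac:(rewrite /ltU /ae; df).
have step f : f ∈ FF -> ap c f ∈ FF /\ ltU (ap c f) f.
  move=> hf; have [|f' [h1 h2]] := hc f hf; last by rewrite (ap_eq _ _ _ fc h1).
  apply: NNPP => K'; move/inFF: (hf) => [f1 f2]; apply: n; exists f; split=> //; split=> // f' g1 g2 hl.
  by apply: K'; exists f'; split=> //; apply/inFF.
pose Ph x g y := (~ nonempty x /\ y = id) \/ exists m, is_succ x m /\ y = ap c (ap g m).
have uPh x g y y' : Ph x g y -> Ph x g y' -> y = y'.
  move=> [[h1 ->]|[m [h1 ->]]] [[h1' ->]|[m' [h1' ->]]] //.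
  - by case: h1; exists m'; apply/h1'; auto.
  - by case: h1'; exists m; apply/h1; auto.
  - by move/is_succE: h1 => h1; move/is_succE: h1'; rewrite h1 => /sc_inj ->.
pose H x g := the x (Ph x g).
have dH : D (fun j e => e 0 = H (e 1) (e 2)).
  refine (Def_eq _ _ _ _); first by df.
  by apply: DT_the => [j e y y'|]; [exact: uPh|rewrite /Ph; df].
pose F := recF H; pose proof (dRecF _ dH : D (fun j e => e 0 = F (e 1))) as dF.
have F0 x : ~ nonempty x -> F x = id.
  by move=> hx; rewrite /F (recF_eq _ dH); apply: the_eq => [|y' hy']; [left|apply: uPh hy' _; left].
have FS x : F (sc x) = ap c (F x).
  have hy : Ph (sc x) (lam (tc (sc x)) F) (ap c (F x)).
    right; exists x; split; first by rewrite is_succE.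
    by rewrite ap_lam //; apply: sub_tc; rewrite in_sc; auto.
  by rewrite {1}/F (recF_eq _ dH); apply: the_eq => // y' hy'; exact: uPh hy' hy.
have [w [[wl wn] hwK]] : exists w, is_omega w /\ w ∈ K by case: hK.
have ow : is_ord w by case: wl.
have Fw x : x ∈ w -> F x ∈ FF.
  move=> hx; have ox : is_ord x by exact: ord_in hx.
  move: x ox hx; apply: (ord_ind (fun x => x ∈ w -> F x ∈ FF)); first by df.
  move=> x ox IH hx; case: (ord_cases x ox) => [e|[[m Em]|lx]]; first by rewrite F0.
    have hm : m ∈ x by rewrite Em in_sc; auto.
    by rewrite Em FS; case: (step (F m)) => //; apply: IH => //; exact: (proj1 ow x).
  by case: (wn x hx).
have h : ae (fun al => forall m, m ∈ w -> exists x y, rel (F (sc m)) al x /\ rel (F m) al y /\ x ∈ y).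
  apply: (ae_all (fun m al => exists x y, rel (F (sc m)) al x /\ rel (F m) al y /\ x ∈ y)).
  - by df.
  - exact: card_lt_elem.
  - by move=> m hm; rewrite FS; case: (step _ (Fw m hm)).
have [al [_ k]] := ae_ex _ h.
have [s hs] : is_set (fun y => y ∈ K /\ exists m, m ∈ w /\ rel (F m) al y) by apply: is_set_sep; df.
have inK m y : m ∈ w -> rel (F m) al y -> y ∈ K.
  by move=> /Fw /inFF [[on _] _] hr; case: (rel_onP _ _ _ _ _ on hr).
have [|y [/hs [hy [m [hm hmy]]] hmin]] := zf_found _ (ZFC_ZF _ HW) s.
  have [m hm] : nonempty w by case: wl => _ [].
  have [x [y [_ [h2 _]]]] := k m hm.
  by exists y; apply/hs; split; [exact: inK h2|exists m].
have [x [y' [h1 [h2 h3]]]] := k m hm.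
have Ey : y' = y by move/Fw/inFF: hm => [[_ [fF _]] _]; exact: fF h2 hmy.
subst y'; have hsm : sc m ∈ w by exact: is_limit_sc.
apply: (hmin x) => //; apply/hs; split; [exact: inK h1|by exists (sc m)].
Qed.

(** * Normality of the least unbounded function *)

Section Least.
Variable h : W.
Hypothesis hf : is_fun h K K.
Hypothesis hu : unb h.
Hypothesis hmin : forall f, is_fun f K K -> unb f -> ~ ltU f h.

Lemma h_total a : a ∈ K -> exists y, rel h a y /\ y ∈ K.
Proof.
by case: hf => on [_ t] /t [y hy]; exists y; case: (rel_onP _ _ _ _ _ on hy).
Qed.

(** The least [b] below [h] with [R a b] defines a function smaller than [h] modulo [U]. By
    minimality it is not unbounded, so it is constant almost everywhere. *)
Lemma h_normal (R : W -> W -> Prop) : D (fun j e => R (e 0) (e 1)) ->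
  ae (fun a => exists b y, rel h a y /\ b ∈ y /\ R a b) -> exists b, b ∈ K /\ ae (fun a => R a b).
Proof.
move=> dR H.
have [z0 hz0] : nonempty K by have [w [_ hw]] := proj2 hK; exists w.
pose G a b := exists y, rel h a y /\ b ∈ y /\ R a b.
have dG : D (fun j e => G (e 0) (e 1)) by rewrite /G; df.
(* [z0] is a default value where no such [b] exists: minimality of [h] speaks of total functions. *)
have [f [onf rf]] := relset (fun a b => (G a b /\ forall c, c ∈ b -> ~ G a c) \/ ((~ exists c, G a c) /\ b = z0)) K K ltac:(df).
have GK a b : G a b -> b ∈ K.
  by move=> [y [hy [hb _]]]; have [_ hyK] := rel_onP _ _ _ _ _ (proj1 hf) hy; exact: (proj1 oK y).
have least a b : G a b -> exists b', b' ∈ K /\ G a b' /\ forall c, c ∈ b' -> ~ G a c.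
  move=> hG; have [|b' [_ [h1 h2]]] := ord_least (G a) b _ (ord_in _ _ oK (GK _ _ hG)) hG; first by df.
  by exists b'; split=> //; exact: GK h1.
have ff : is_fun f K K.
  split=> //; split.
    move=> a b b' /rf [_ [hb h1]] /rf [_ [hb' h2]].
    case: h1 => [[h1 l1]|[h1 ->]]; case: h2 => [[h2 l2]|[h2 ->]] //; [|by case: h2; exists b|by case: h1; exists b'].
    case: (ord_tri b b' (ord_in _ _ oK hb) (ord_in _ _ oK hb')) => [k|[//|k]].
      by case: (l2 _ k). by case: (l1 _ k).
  move=> a ha; case: (classic (exists c, G a c)) => [[c /least [b [h1 h2]]]|nc].
    by exists b; apply/rf; split=> //; split=> //; left.
  by exists z0; apply/rf; split=> //; split=> //; right.
have fG a b : (exists c, G a c) -> rel f a b -> G a b.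
  by move=> ex /rf [_ [_ [[]//|[n _]]]].
have H' : ae (fun a => exists c, G a c).
  by apply: ae_mono H _ => a _ [b [y [h1 h2]]]; exists b, y.
have fl : ltU f h.
  apply: ae_mono H' _ => a ha ex; have [b hb] := proj2 (proj2 ff) a ha.
  by have [y [h1 [h2 h3]]] := fG _ _ ex hb; exists b, y.
have [b [hb hab]] : exists b, b ∈ K /\ ae (fun a => rel f a b).
  apply: NNPP => n; apply: (hmin f ff) => // y hy hae; apply: n; by exists y.
exists b; split=> //; apply: ae_mono (ae_and _ _ H' hab) _ => a _ [ex hab'].
by have [y [_ []]] := fG _ _ ex hab'.
Qed.

(** Otherwise the values of [h] are almost everywhere at most [b], and completeness makes one of
    them constant, against unboundedness. *)
Lemma h_above b : b ∈ K -> ae (fun a => exists y, rel h a y /\ b ∈ y).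
Proof.
move=> hb; case: (ae_dich (fun a => exists y, rel h a y /\ b ∈ y)) => [|//|k]; first by df.
have k' : ae (fun a => rel h a b \/ exists y, y ∈ b /\ rel h a y).
  apply: ae_mono k _ => a ha nb; have [y [hy hyK]] := h_total a ha.
  case: (ord_tri y b (ord_in _ _ oK hyK) (ord_in _ _ oK hb)) => [h1|[h1|h1]].
  - by right; exists y.
  - by left; rewrite -h1.
  - by case: nb; exists y.
case: (ae_or _ _ _ k') => [|h1|h1]; first by df.
  by case: (hu b hb h1).
have [|y [hy h2]] := ae_part (fun y a => rel h a y) b _ (card_lt_elem b hb) h1; first by df.
by case: (hu y (proj1 oK b hb y hy) h2).
Qed.
End Least.
End Measure.

(** * Supercompactness in the ground model *)

Section Supercompact.
Context {V W : structure} {HV : ZFC V} {HW : ZFC W} (k : V -> W) (hk : tr_emb k).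
Variables kap th b0 : V.
Hypothesis ckap : is_card kap.
Hypothesis hb0 : b0 ∈ kap.
Notation K := (k kap).
Variable U : W.
Hypothesis hK : uncountable_card K.
Hypothesis hU : complete_ultrafilter K K U.
Hypothesis AP : forall (X : V) (A : W), sub A (k X) ->
  (forall a, sub a X -> injects a b0 -> exists b, forall z, z ∈ k b <-> z ∈ A /\ z ∈ k a) ->
  exists B, k B = A.
Variable F : W.
Hypothesis fF : functional F.
Hypothesis onF : forall b x, rel F b x -> b ∈ K /\ x ∈ k th.
Hypothesis sF : forall x, x ∈ k th -> exists b, rel F b x.
Variable h : W.
Hypothesis hf : is_fun h K K.
Hypothesis hu : unb K U h.
Hypothesis hmin : forall f, is_fun f K K -> unb K U f -> ~ ltU U f h.
Notation D := (Def (single W)).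
Notation ae_mono := (ae_mono K U hU).
Notation ae_ex := (ae_ex K U hU).
Notation ae_dich := (ae_dich K U hU).
Notation ae_all := (ae_all K U hK hU).
Notation ae_and := (ae_and K U hK hU).
Notation ae_absurd := (ae_absurd K U hK hU).
Notation ae_part := (ae_part K U hK hU).

Let okap : is_ord kap. Proof. by case: ckap. Qed.
Let oK : is_ord K. Proof. by apply/(emb_ord _ hk). Qed.
Let cK : is_card K. Proof. by case: hK. Qed.
Let hb0K : k b0 ∈ K. Proof. by apply/(emb_mem _ hk). Qed.

(** An injection of [kap] into [Y] would persist to [W], where [K] is a cardinal. *)
Lemma small_down (Y : V) : card_lt (k Y) K -> card_lt Y kap.
Proof.
move=> hY; case: (card_compare kap Y ckap) => // /(emb_injects _ hk) hi.
by case: (not_both K (k Y) cK hY hi).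
Qed.
Lemma small_b0 (a : V) : injects a b0 -> card_lt (k a) K.
Proof. by move=> /(emb_injects _ hk) hi; exists (k b0). Qed.

Definition Ss (al : W) : W := mk F (fun x => exists y b, rel h al y /\ b ∈ y /\ rel F b x).
Lemma set_Ss (al : W) : is_set (fun x => exists y b, rel h al y /\ b ∈ y /\ rel F b x).
Proof.
apply: (is_set_sub (un (un F))); last by df.
by move=> x [y [b [_ [_ /rel_un2 []]]]].
Qed.
Lemma in_Ss al x : x ∈ Ss al <-> exists y b, rel h al y /\ b ∈ y /\ rel F b x.
Proof. exact: (in_mk _ _ (set_Ss al)). Qed.
Lemma dSs : D (fun j e => e 0 = Ss (e 1)).
Proof.
refine (Def_eq _ _ _ _); first by df.
by apply: DT_mk => [j e|]; [exact: set_Ss|df].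
Qed.
Lemma Ss_sub al : sub (Ss al) (k th).
Proof. by move=> x /in_Ss [y [b [_ [_ /onF []]]]]. Qed.
Lemma Ss_small al : al ∈ K -> card_lt (Ss al) K.
Proof.
move=> hal; have [y [hy hyK]] := h_total K h hf al hal.
apply: (card_lt_rel (fun x b => rel F b x) (Ss al) y K oK (card_lt_elem K y hyK)); first by df.
  move=> x /in_Ss [y' [b [h1 [h2 h3]]]]; exists b; split=> //.
  by rewrite (proj1 (proj2 hf) _ _ _ hy h1).
by move=> x x' b _ _; exact: fF.
Qed.
Lemma Ss_fine x : x ∈ k th -> ae U (fun al => x ∈ Ss al).
Proof.
move=> hx; have [b hb] := sF x hx; have [hbK _] := onF _ _ hb.
apply: ae_mono (h_above K U hK hU h hf hu b hbK) _ => al _ [y [h1 h2]].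
by apply/in_Ss; exists y, b.
Qed.
Lemma Ss_cover c : sub c (k th) -> card_lt c K -> ae U (fun al => forall x, x ∈ c -> x ∈ Ss al).
Proof.
pose proof dSs as dS; move=> hc sc'; apply: (ae_all (fun x al => x ∈ Ss al)) => //; first by df.
by move=> x hx; apply: Ss_fine; exact: hc.
Qed.

(** Choosing [x] in [Ss al] amounts to choosing a preimage under [F] below the value of [h] at [al],
    so normality of [h] carries over to [theta]. *)
Lemma Ss_normal (R : W -> W -> Prop) : D (fun j e => R (e 0) (e 1)) ->
  ae U (fun al => exists x, x ∈ Ss al /\ R al x) -> exists x, x ∈ k th /\ ae U (fun al => R al x).
Proof.
move=> dR H.
have [||b [hb hab]] := h_normal K U hK hU h hf hmin (fun al b => exists x, rel F b x /\ R al x); first by df.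
  by apply: ae_mono H _ => al _ [x [/in_Ss [y [b [h1 [h2 h3]]]] hR]]; exists b, y; split=> //; split=> //; exists x.
have [al [_ [x [hx _]]]] := ae_ex _ hab; exists x; split; first by case: (onF _ _ hx).
by apply: ae_mono hab _ => al' _ [x' [hx' hR]]; rewrite (fF _ _ _ hx hx').
Qed.

(** * Limits of small sets of the ground model *)

Section AlmostIn.
Variable ca : W.
Hypothesis fca : functional ca.
Notation in_a al x := (exists a, rel ca al a /\ x ∈ a).
Variable SM : V.
Hypothesis hSM : forall a, a ∈ SM <-> sub a th /\ injects a b0.
Hypothesis hca : ae U (fun al => exists a, rel ca al a /\ a ∈ k SM).

Lemma a_in_V al a : rel ca al a -> a ∈ k SM -> exists a0, a = k a0 /\ sub a0 th /\ injects a0 b0.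
Proof. by move=> _ /(emb_in _ hk) [a0 [/hSM h1 ->]]; exists a0. Qed.

(** Write a_al for the value of [ca]. On a small [a] of V, completeness gives one [al] at which the
    limit and a_al have the same trace, so approximation puts the limit into V. For its size, choose
    injections of the a_al into [b0] and send [x] to the value taken almost everywhere. *)
Lemma limit_set : exists B : V, sub B th /\ card_lt (k B) K /\
  forall x, x ∈ k B <-> x ∈ k th /\ ae U (fun al => in_a al x).
Proof.
have [b hb] : is_set (fun x => x ∈ k th /\ ae U (fun al => in_a al x)).
  by apply: is_set_sep; rewrite /ae; df.
have sb : sub b (k th) by move=> x /hb [].
have [B EB] : exists B, k B = b.
  apply: (AP th) => // a ha hi.
  have H : ae U (fun al => forall x, x ∈ k a -> (x ∈ b <-> in_a al x)).
    apply: (ae_all (fun x al => x ∈ b <-> in_a al x)); [by df|exact: small_b0|].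
    move=> x hx; have hxt : x ∈ k th by move: x hx; apply/(emb_sub _ hk).
    case: (ae_dich (fun al => in_a al x)) => [|h1|h1]; first by df.
      by apply: (ae_mono _ _ h1) => al _ h2; split=> [_|_]; [exact: h2|apply/hb; split].
    apply: (ae_mono _ _ h1) => al _ h2; split=> // /hb [_ h3]; by case: (ae_absurd _ h3 h1).
  have [al [_ [H1 [a1 [h1 h2]]]]] := ae_ex _ (ae_and _ _ H hca).
  have [a0 [Ea [_ _]]] := a_in_V _ _ h1 h2; subst a1.
  have [c hc] := is_set_sep a (fun x => x ∈ a0) ltac:(df).
  exists c => z; rewrite (emb_in _ hk); split.
    move=> [z' [/hc [i1 i2] ->]]; have i3 : k z' ∈ k a by apply/(emb_mem _ hk).
    by split=> //; apply/(H1 _ i3); exists (k a0); split=> //; apply/(emb_mem _ hk).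
  move=> [i1 i2]; have [a2 [i3 i4]] := proj1 (H1 _ i2) i1.
  rewrite (fca _ _ _ i3 h1) in i4; move/(emb_in _ hk): (i2) => [z' [i5 E]]; subst z.
  by exists z'; split=> //; apply/hc; split=> //; apply/(emb_mem _ hk).
exists B; rewrite EB; split; first by apply/(emb_sub _ hk); rewrite EB.
split=> //.
have [cf [fcf hcf]] := choose (fun al f => exists a, rel ca al a /\ is_fun f a (k b0) /\
   forall x x' y, rel f x y -> rel f x' y -> x = x') K ltac:(df).
have hcf' : ae U (fun al => exists f a, rel cf al f /\ rel ca al a /\ is_fun f a (k b0) /\
   forall x x' y, rel f x y -> rel f x' y -> x = x').
  apply: ae_mono hca _ => al hal [a [h1 h2]]; have [a0 [Ea [_ hi]]] := a_in_V _ _ h1 h2; subst a.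
  have [f0 [i1 i2]] := emb_injects _ hk _ _ hi.
  have [f [j1 [a [j2 [j3 j4]]]]] := hcf al hal (ex_intro _ f0 (ex_intro _ (k a0) (conj h1 (conj i1 i2)))).
  by exists f, a.
exists (k b0); split=> //.
apply: (injects_rel (fun x g => ae U (fun al => exists f, rel cf al f /\ rel f x g))).
- exact: ord_in hb0K.
- by rewrite /ae; df.
- move=> x /hb [hx hax].
  apply: (ae_part (fun g al => exists f, rel cf al f /\ rel f x g)); [by df|exact: card_lt_elem|].
  apply: ae_mono (ae_and _ _ hcf' hax) _ => al _ [[f [a [i1 [i2 [i3 i4]]]]] [a' [i5 i6]]].
  rewrite (fca _ _ _ i5 i2) in i6; have [g hg] := proj2 (proj2 i3) x i6.
  by exists g; split; [case: (rel_onP _ _ _ _ _ (proj1 i3) hg)|exists f].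
- move=> x x' g _ _ h1 h2.
  have [al [_ [[f [a [i1 [_ [_ i4]]]]] [[f1 [j1 j2]] [f2 [j3 j4]]]]]] := ae_ex _ (ae_and _ _ hcf' (ae_and _ _ h1 h2)).
  rewrite (fcf _ _ _ j1 i1) in j2; rewrite (fcf _ _ _ j3 i1) in j4; exact: i4 j2 j4.
Qed.
End AlmostIn.

(** If not, approximation fails for almost every [Ss al], at some small a_al of V whose intersection
    with [Ss al] is not in V. Let [B] be the limit of the a_al. Fineness and smallness put [B]
    inside [Ss al], and normality puts the intersection of [Ss al] with a_al inside [B]. So that
    intersection is the one of [B] with a_al, which is in V. *)
Lemma Ss_ground : ae U (fun al => Ss al ∈ k (pw th)).
Proof.
pose proof dSs as dS.
case: (ae_dich (fun al => Ss al ∈ k (pw th))) => [|//|hn]; first by df.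
have [SM hSM] : is_set (fun a => sub a th /\ injects a b0).
  by apply: (is_set_sub (pw th)) => [a [h1 _]|]; [apply/in_pw|df].
pose Q al a := a ∈ k SM /\ ~ exists b, b ∈ k (pw th) /\ forall z, z ∈ b <-> z ∈ Ss al /\ z ∈ a.
have dQ : D (fun j e => Q (e 0) (e 1)) by rewrite /Q; df.
have exQ al : Ss al ∉ k (pw th) -> exists a, Q al a.
  move=> nS; apply: NNPP => nQ; apply: nS.
  have [|B EB] := AP th (Ss al) (Ss_sub al); last first.
    rewrite -EB; apply/(emb_mem _ hk)/in_pw; apply/(emb_sub _ hk); rewrite EB; exact: Ss_sub.
  move=> a ha hi; apply: NNPP => nb; apply: nQ; exists (k a); split; first by apply/(emb_mem _ hk)/hSM.
  by move=> [b [/(emb_in _ hk) [b' [_ ->]] hb]]; apply: nb; exists b'.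
have [ca [fca hca]] := choose Q K dQ.
have H : ae U (fun al => exists a, rel ca al a /\ Q al a).
  by apply: ae_mono hn _ => al hal /exQ; exact: hca.
have H' : ae U (fun al => exists a, rel ca al a /\ a ∈ k SM).
  by apply: ae_mono H _ => al _ [a [h1 [h2 _]]]; exists a.
have [B [sB [cB hB]]] := limit_set ca fca SM hSM H'.
have H1 : ae U (fun al => forall x, x ∈ k B -> x ∈ Ss al).
  by apply: Ss_cover => //; apply/(emb_sub _ hk).
have H2 : ae U (fun al => forall x, x ∈ Ss al -> (exists a, rel ca al a /\ x ∈ a) -> x ∈ k B).
  case: (ae_dich (fun al => forall x, x ∈ Ss al -> (exists a, rel ca al a /\ x ∈ a) -> x ∈ k B)) => [|//|n].
    by df.
  have [||x [hx k2]] := Ss_normal (fun al x => (exists a, rel ca al a /\ x ∈ a) /\ x ∉ k B); first by df.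
    apply: ae_mono n _ => al _ nn; apply: NNPP => ne; apply: nn => x i1 i2; apply: NNPP => i3.
    by apply: ne; exists x.
  have [al [_ [_ nB]]] := ae_ex _ k2; case: nB; apply/hB; split=> //.
  by apply: ae_mono k2 _ => al' _ [].
have [al [_ [[a [h1 [h2 h3]]] [h4 h5]]]] := ae_ex _ (ae_and _ _ H (ae_and _ _ H1 H2)).
have [a0 [Ea [sa _]]] := a_in_V ca SM hSM _ _ h1 h2; subst a.
have [c hc] := is_set_sep B (fun x => x ∈ a0) ltac:(df).
case: h3; exists (k c); split; first by apply/(emb_mem _ hk)/in_pw => x /hc [/sB].
move=> z; rewrite (emb_in _ hk); split.
  move=> [z' [/hc [i1 i2] ->]]; split; last exact/(emb_mem _ hk).
  by apply: h4; apply/(emb_mem _ hk).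
move=> [i1 i2]; have : z ∈ k B by apply: h5 => //; exists (k a0).
move/(emb_in _ hk) => [z' [i3 E]]; subst z; exists z'; split=> //; apply/hc; split=> //.
exact/(emb_mem _ hk).
Qed.

(** The measure [mu] itself is in V by approximation: on a small family of V one [al] settles all
    memberships, and as [Ss al] is a set [s] of V there, the trace is formed of the members
    containing [s]. The measure properties are then those of [ae], [Ss_fine] and [Ss_normal]. *)
Lemma supercompact_ground : supercompact kap th.
Proof.
pose proof dSs as dS.
have [x hx] : is_set (fun a => sub a th /\ card_lt a kap).
  by apply: (is_set_sub (pw th)) => [a [h1 _]|]; [apply/in_pw|df].
have Hx : ae U (fun al => Ss al ∈ k x).
  apply: ae_mono Ss_ground _ => al hal /(emb_in _ hk) [s [/in_pw hs E]]; rewrite E; apply/(emb_mem _ hk)/hx.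
  by split=> //; apply: small_down; rewrite -E; exact: Ss_small.
have [mu hmu] : is_set (fun Y => Y ∈ k (pw x) /\ ae U (fun al => Ss al ∈ Y)).
  by apply: is_set_sep; rewrite /ae; df.
have [u Eu] : exists u, k u = mu.
  apply: (AP (pw x)); first by move=> Y /hmu [].
  move=> a ha hi.
  have H : ae U (fun al => forall Y, Y ∈ k a -> (Y ∈ mu <-> Ss al ∈ Y)).
    apply: (ae_all (fun Y al => Y ∈ mu <-> Ss al ∈ Y)); [by df|exact: small_b0|].
    move=> Y hY; have hYx : Y ∈ k (pw x) by move: Y hY; apply/(emb_sub _ hk).
    case: (ae_dich (fun al => Ss al ∈ Y)) => [|h1|h1]; first by df.
      by apply: (ae_mono _ _ h1) => al _ h2; split=> // _; apply/hmu.
    apply: (ae_mono _ _ h1) => al _ h2; split=> // /hmu [_ h3]; by case: (ae_absurd _ h3 h1).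
  have [al [_ [H1 /(emb_in _ hk) [s [_ Es]]]]] := ae_ex _ (ae_and _ _ H Hx).
  have [c hc] := is_set_sep a (fun Y => s ∈ Y) ltac:(df).
  exists c => Z; rewrite (emb_in _ hk); split.
    move=> [Y [/hc [i1 i2] ->]]; have i3 : k Y ∈ k a by apply/(emb_mem _ hk).
    by split=> //; apply/(H1 _ i3); rewrite Es; apply/(emb_mem _ hk).
  move=> [i1 i2]; move/(H1 _ i2): i1; rewrite Es; move/(emb_in _ hk): (i2) => [Y [i3 ->]] /(emb_mem _ hk) i4.
  by exists Y; split=> //; apply/hc.
have inu Y : Y ∈ u <-> sub Y x /\ ae U (fun al => Ss al ∈ k Y).
  by rewrite -(emb_mem _ hk) Eu hmu (emb_mem _ hk) in_pw.
split.
  split=> //; have [_ [w [ow hw]]] := hK.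
  move/(emb_in _ hk): hw => [w0 [h1 E]]; subst w; exists w0; split=> //; case: ow => [/(emb_limit _ hk) lw nw].
  by split=> // y hy /(emb_limit _ hk); apply: nw; apply/(emb_mem _ hk).
exists x, u; split=> //; split; last split.
- split; last split; last split; last split.
  + by move=> a /inu [].
  + by apply/inu; split=> // z.
  + move=> a b /inu [_ h1] hab hb; apply/inu; split=> //; apply: ae_mono h1 _ => al _ h2.
    by apply: (proj2 (emb_sub _ hk _ _) hab).
  + move=> a b ha hb; rewrite !inu; split=> [[_ h1] [_ h2]|nb].
      have [al [_ [i1 i2]]] := ae_ex _ (ae_and _ _ h1 h2).
      move/(emb_in _ hk): i1 => [s [i3 Es]]; move: i2; rewrite Es => /(emb_mem _ hk) /hb [_ i4]; exact: i4.
    split=> //; case: (ae_dich (fun al => Ss al ∈ k a)) => [|//|n]; first by df.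
    case: nb; split; first by move=> z /hb [].
    apply: ae_mono (ae_and _ _ Hx n) _ => al _ [/(emb_in _ hk) [s [i1 Es]]]; rewrite Es => i2.
    by apply/(emb_mem _ hk)/hb; split=> // i3; apply: i2; apply/(emb_mem _ hk).
  + move=> f b hfu [a0 ha0] hcf hb; apply/inu; split.
      by move=> z /hb /(_ a0 ha0); move: z; case/inu: (hfu _ ha0).
    have H : ae U (fun al => forall Y, Y ∈ k f -> Ss al ∈ Y).
      apply: (ae_all (fun Y al => Ss al ∈ Y)); [by df|exact: (emb_card_lt _ hk)|].
      by move=> Y /(emb_in _ hk) [Y0 [/hfu /inu [_ h1] ->]].
    apply: ae_mono (ae_and _ _ H Hx) _ => al _ [i1 /(emb_in _ hk) [s [_ Es]]].
    rewrite Es; apply/(emb_mem _ hk)/hb => a ha; apply/(emb_mem _ hk); rewrite -Es; apply: i1.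
    exact/(emb_mem _ hk).
- move=> a b ha hb; apply/inu; split; first by move=> z /hb [].
  have ha' : k a ∈ k th by apply/(emb_mem _ hk).
  apply: ae_mono (ae_and _ _ Hx (Ss_fine _ ha')) _ => al _ [/(emb_in _ hk) [s [i1 Es]]]; rewrite Es => /(emb_mem _ hk) i2.
  by apply/(emb_mem _ hk)/hb.
- move=> f a ff /inu [sa ha] hreg.
  have [||y [hy hay]] := Ss_normal (fun al y => rel (k f) (Ss al) y); first by df.
    apply: ae_mono ha _ => al _ /(emb_in _ hk) [s [i1 Es]]; have [y [i2 i3]] := hreg s i1.
    by exists (k y); rewrite Es; split; [apply/(emb_mem _ hk)|apply/(emb_rel _ hk)].
  move/(emb_in _ hk): hy => [y0 [_ Ey]]; subst y.
  have [b hb] := is_set_sep a (fun s => rel f s y0) ltac:(df).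
  exists y0, b; split; last by move=> s /hb [].
  apply/inu; split; first by move=> s /hb [/sa].
  apply: ae_mono (ae_and _ _ ha hay) _ => al _ [/(emb_in _ hk) [s [i1 Es]]]; rewrite Es => /(emb_rel _ hk) i2.
  by apply/(emb_mem _ hk)/hb.
Qed.
End Supercompact.

(** * The collapse *)

Lemma coll_exists {M : structure} {HM : ZFC M} (K T : M) : exists c l, is_coll K T c l.
Proof.
have [c hc] : is_set (fun f => rel_on f K T /\ functional f /\ card_lt f K).
  by apply: (is_set_sub (pw (prod K T))) => [f [/rel_onE h _]|]; [apply/in_pw|df].
have [l [onl hl]] := relset (fun f g => sub g f) c c ltac:(df).
exists c, l; split=> // z; split.
  move=> hz; have [f [g [E [hf hg]]]] := onl z hz; exists f, g; split=> //; split=> //; split=> //.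
  have : rel l f g by exists z.
  by move/hl => [_ [_]].
by move=> [f [g [/is_opairE -> [hf [hg h]]]]]; apply/relE/hl.
Qed.

Section Coll.
Context {M : structure} {HM : ZFC M} (K T c l : M).
Hypothesis hc : is_coll K T c l.

Lemma coll_rel f g : rel l f g <-> f ∈ c /\ g ∈ c /\ sub g f.
Proof.
case: hc => _ hl; split.
  move=> [z [/is_opairE Ez /hl [f' [g' [/is_opairE E h]]]]].
  by move: E; rewrite Ez => /opair_inj [-> ->].
by move=> h; exists (opair f g); split; [apply/is_opairE|apply/hl; exists f, g; split=> //; apply/is_opairE].
Qed.
Lemma coll_poset : nonempty K -> is_poset c l.
Proof.
move=> [z hz]; split; last split; last split.
- exists (emp K); apply/(proj1 hc); split; last split.
  + by move=> w /in_emp.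
  + by move=> x y y' /relE /in_emp.
  + by exists z; split=> //; apply: injects_sub => w /in_emp.
- move=> w /(proj2 hc) [f [g [E [hf [hg _]]]]]; by exists f, g.
- by move=> f hf; apply/coll_rel; split=> //; split=> // z'.
- move=> f g h /coll_rel [hf [_ h1]] /coll_rel [_ [hh h2]]; apply/coll_rel; split=> //; split=> // w /h2; exact: h1.
Qed.
Lemma coll_sub f : f ∈ c -> sub f (prod K T).
Proof. by move/(proj1 hc) => [/rel_onE]. Qed.

Section Measurable.
Context {W : structure} {HW : ZFC W} (k : M -> W) (hk : tr_emb k) (U : W).
Hypothesis hK : uncountable_card (k K).
Hypothesis hU : complete_ultrafilter (k K) (k K) U.
Hypothesis np : nonprincipal U.

Let cK : is_card K. Proof. by apply: (emb_card _ hk); case: hK. Qed.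
Let oK : is_ord K. Proof. by case: cK. Qed.
Let down := small_down k hk K cK hK.

(** Sizes are counted in [W], where the measure makes the image of [K] regular; smallness then
    descends because injections persist upwards. *)
Lemma coll_union a f u : a ∈ K -> functional f ->
  (forall b, b ∈ a -> exists x, rel f b x) ->
  (forall b x, rel f b x -> b ∈ a /\ x ∈ c) ->
  (forall b b' x x', b ∈ b' -> rel f b x -> rel f b' x' -> sub x x') ->
  (forall z, z ∈ u <-> exists b x, rel f b x /\ z ∈ x) -> u ∈ c.
Proof.
move=> ha ff tf onf inc hu; apply/(proj1 hc).
have oa b : b ∈ a -> is_ord b by move=> hb; apply: ord_in hb; exact: ord_in ha.
split; last split.
- by move=> z /hu [b [x [/onf [_ /(proj1 hc) [h _]] hz]]]; exact: h.
- move=> x y y' /relE /hu [b [v [hb hv]]] /relE /hu [b' [v' [hb' hv']]].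
  have fv w : w ∈ c -> functional w by move/(proj1 hc) => [_ []].
  have [ib iv] := onf _ _ hb; have [ib' iv'] := onf _ _ hb'.
  case: (ord_tri b b' (oa _ ib) (oa _ ib')) => [h|[h|h]].
  + by apply: (fv v' iv' x); apply/relE => //; exact: (inc _ _ _ _ h hb hb').
  + subst b'; rewrite (ff _ _ _ hb' hb) in hv'; by apply: (fv v iv x); apply/relE.
  + by apply: (fv v iv x); apply/relE => //; exact: (inc _ _ _ _ h hb' hb).
- apply: down.
  apply: (small_union (k K) U hK hU np (fun b z => exists x, rel (k f) b x /\ z ∈ x) (k a) (k u)).
  + by df.
  + by apply: card_lt_elem; apply/(emb_mem _ hk).
  + move=> z /(emb_in _ hk) [z' [/hu [b [x [hb hz]]] ->]]; exists (k b); split.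
      by apply/(emb_mem _ hk); case: (onf _ _ hb).
    by exists (k x); split; [apply/(emb_rel _ hk)|apply/(emb_mem _ hk)].
  + move=> b /(emb_in _ hk) [b' [hb ->]]; have [x hx] := tf b' hb; exists (k x); split.
      by apply: (emb_card_lt _ hk); case/(proj1 hc): (proj2 (onf _ _ hx)) => _ [].
    move=> z _ [y [hy hz]]; suff <- : y = k x by [].
    by apply: (proj2 (emb_functional _ hk f) ff _ _ _ hy); apply/(emb_rel _ hk).
Qed.

(** A condition has size less than the cardinal [K], so some argument is free to receive the value
    [x]; the enlarged condition is again measured in [W]. *)
Lemma coll_hit f x : f ∈ c -> x ∈ T -> exists f' b, f' ∈ c /\ sub f f' /\ rel f' b x.
Proof.
move=> hf hx; have [onf [ff cf]] := proj1 (proj1 hc f) hf.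
have [b [hb nb]] : exists b, b ∈ K /\ ~ exists y, rel f b y.
  apply: NNPP => n; apply: (not_both K K cK); last exact: injects_sub.
  apply: (card_lt_rel (fun b z => exists y, z = opair b y) K f K oK cf); first by df.
    move=> b hb; apply: NNPP => n1; apply: n; exists b; split=> // -[y hy]; apply: n1.
    by exists (opair b y); split; [apply/relE|exists y].
  by move=> b b' z _ _ [y ->] [y' /opair_inj []].
have hz z : z ∈ cup f (upair (opair b x) (opair b x)) <-> z ∈ f \/ z = opair b x by rewrite in_cup in_sing.
exists (cup f (upair (opair b x) (opair b x))), b; split; last first.
  by split; [move=> z ?; apply/hz; left|apply/relE/hz; right].
apply/(proj1 hc); split; last split.
- move=> z /hz [/onf//|->]; exists b, x; split=> //; exact/is_opairE.
- move=> v y y' /relE /hz h /relE /hz h'; case: h => h; case: h' => h'.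
  + by apply: (ff v); apply/relE.
  + by case: (opair_inj _ _ _ _ h') => E _; case: nb; exists y; apply/relE; rewrite -E.
  + by case: (opair_inj _ _ _ _ h) => E _; case: nb; exists y'; apply/relE; rewrite -E.
  + by case: (opair_inj _ _ _ _ h) => _ ->; case: (opair_inj _ _ _ _ h').
- apply: down; apply: (card_lt_sub _ (cup (k f) (upair (k (opair b x)) (k (opair b x))))); last first.
    by apply: (small_adjoin (k K) U hK hU np); exact: emb_card_lt.
  move=> z /(emb_in _ hk) [z' [/hz h ->]]; apply/in_cup; case: h => [h|->]; last by right; apply/in_sing.
  by left; apply/(emb_mem _ hk).
Qed.

Lemma coll_surj g : generic_extension M c l W k g ->
  exists F, functional F /\ (forall b x, rel F b x -> b ∈ k K /\ x ∈ k T) /\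
    forall x, x ∈ k T -> exists b, rel F b x.
Proof.
move=> hg; exists (un g).
have relF b x : rel (un g) b x <-> exists f, k f ∈ g /\ f ∈ c /\ rel (k f) b x.
  rewrite relE in_un; split.
    move=> [y [hy hz]]; move/(gen_sub _ _ _ _ _ _ hg)/(emb_in _ hk): (hy) => [f [hf E]]; subst y.
    by exists f; split=> //; split=> //; apply/relE.
  by move=> [f [h1 [_ /relE h2]]]; exists (k f).
split; last split.
- move=> b x x' /relF [f [h1 [_ h2]]] /relF [f' [h1' [_ h2']]].
  have [h [_ [/coll_rel [ih [_ s1]] /coll_rel [_ [_ s2]]]]] := gen_directed _ _ _ _ _ _ hg _ _ h1 h1'.
  have fh : functional (k h) by apply/(emb_functional _ hk); case/(proj1 hc): ih => _ [].
  move/relE: h2 => h2; move/relE: h2' => h2'.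
  by apply: (fh b); apply/relE; [exact: (proj2 (emb_sub _ hk _ _) s1 _ h2)|exact: (proj2 (emb_sub _ hk _ _) s2 _ h2')].
- move=> b x /relF [f [_ [hf hr]]]; case/(proj1 hc): hf => /(emb_rel_on _ hk) on _.
  exact: rel_onP on hr.
- move=> x /(emb_in _ hk) [x' [hx ->]].
  have [dn hdn] := is_set_sep c (fun f => exists b, rel f b x') ltac:(df).
  have [|f [/hdn [hf [b hb]] hfg]] := gen_generic _ _ _ _ _ _ hg dn.
    split=> [f /hdn [] //|f hf]; have [f' [b [h1 [h2 h3]]]] := coll_hit f x' hf hx.
    by exists f'; split; [apply/hdn; split=> //; exists b|apply/coll_rel].
  by exists (k b); apply/relF; exists f; split=> //; split=> //; apply/(emb_rel _ hk).
Qed.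
End Measurable.
End Coll.

Lemma generic_countable (V : structure) (p l : V) N i G :
  countable V -> generic_extension V p l N i G -> countable N.
Proof.
move=> [e he] hN; exists (fun n => nv N i G (e n)) => Y.
have [t ->] := nv_surj _ _ _ _ _ hN Y; have [n <-] := he t; by exists n.
Qed.

Theorem theorem5p3
    (V : structure) (hV : ZFC V) (hcount : countable V)
    (kappa theta : V)
    (hkappa : is_card kappa) (htheta : is_ord theta)
    (hle : kappa ∈ theta \/ kappa = theta)
    (P leP : V) (hP : is_poset P leP)
    (hgap : admits_gap_below P leP kappa)
    (VG : structure) (i : V -> VG) (G : VG)
    (hVG : generic_extension V P leP VG i G)
    (hmeas : forall C leC : VG, is_coll (i kappa) (i theta) C leC ->
       forall (VGg : structure) (j : VG -> VGg) (g : VGg),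
         generic_extension VG C leC VGg j g -> measurable (j (i kappa))) :
  supercompact kappa theta.
Proof.
have ok : is_ord kappa by case: hkappa.
case: hgap => [p1 [l1 [p2 [l2 [q [m [d [hp1 [hnt [hdk [[b0 [hb0 hcl]] [hfc [hit [r [n [hr [[e he] [e' he']]]]]]]]]]]]]]]]]].
have od : is_ord d by exact: ord_in hdk.
(* The range of a dense embedding meets every cone of the nonempty common poset, so its domain has
   an element. *)
have qne : nonempty q.
  case: he' => -[on _] [_ [_ dn]]; have [a ha] := proj1 hr; have [b [b' [hb _]]] := dn a ha.
  by exists b; case: (rel_onP _ _ _ _ _ on hb).
have hq : is_poset q m by exact: (hq p1 l1 p2 l2 q m d).
(* The same structure is reread as an extension by the two-step iteration, where the gap can be
   exploited. *)
have [Gq hN] := equiv_generic P leP q m r n e e' hP hq hr he he' VG i G hVG.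
have HN : ZFC VG := gen_zfc _ _ _ _ _ _ hVG.
have hi := gen_emb hVG.
have hcN := generic_countable _ _ _ _ _ _ hcount hVG.
have [C [lC hC]] := coll_exists (i kappa) (i theta).
have kne : nonempty (i kappa) by exists (i d); apply/(emb_mem _ hi).
pose proof (coll_poset _ _ _ _ hC kne) as pC; have [c0 hc0] := proj1 pC.
(* A single collapse extension suffices; it exists because a generic extension of a countable
   structure is countable. *)
have [W [j [g [hW _]]]] := generic_extension_exists C lC pC hcN c0 hc0.
have HW : ZFC W := gen_zfc _ _ _ _ _ _ hW.
have hj := gen_emb hW.
have [hK [U [hU np]]] := hmeas C lC hC W j g hW.
have [h [hf [hu hmin]]] := least_unbounded _ _ hK hU np.
have [F [fF [onF sF]]] := coll_surj _ _ _ _ hC j hj U hK hU np g hW.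
apply: (supercompact_ground _ (emb_comp i j hi hj) kappa theta b0 hkappa _ U hK hU _ F fF onF sF h hf hu hmin).
  exact: (proj1 ok d).
apply: (approximation hcount p1 l1 p2 l2 q m d b0 (prod kappa theta) hp1 hnt od hb0 hcl hfc hit qne VG i Gq hN
  C lC pC (coll_rel _ _ _ _ hC) _ _ hcN W j g hW).
  by move=> c hc; rewrite (emb_prod _ hi); exact: (coll_sub _ _ _ _ hC _ hc).
(* Chains of length at most [d] are below kappa, where unions of collapse conditions are again
   conditions. *)
move=> a f u ha _; apply: (coll_union _ _ _ _ hC j hj U hK hU np).
move: ha; rewrite (emb_sc _ hi) in_sc => ha; have hdk' : i d ∈ i kappa by apply/(emb_mem _ hi).
case: ha => [ha|-> //]; apply: (proj1 (proj2 (emb_ord _ hi _) ok) (i d)) => //.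
Qed.
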